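(* There is a universal constant $C>0$ and, for every integer $d\ge 5$, a constant $c_d>0$ depending only on $d$, such that for every real $\lambda\ge 3$ with $\lambda^2\in\mathbb{N}$, $$c_d\,\lambda^{\frac{d-2}{d-1}}\le \Gamma_d(\lambda)\le 2(d-2)\lambda+\exp\Bigl(\frac{C\ln\lambda}{\ln\ln\lambda}\Bigr).$$
   Context: Let $\mathbb{T}^d=\mathbb{R}^d/(2\pi\mathbb{Z})^d$ and, for $\lambda\ge 0$ with $\lambda^2\in\mathbb{N}$, let $\mathcal{E}_d(\lambda)=\{u\in C^\infty(\mathbb{T}^d): -\Delta u=\lambda^2u\}$ (complex-valued functions). For nonzero $u\in\mathcal{E}_d(\lambda)$, $\Gamma(u)$ is the order of vanishing of $u$ at the origin: the largest $N\in\mathbb{N}=\{0,1,2,\dots\}$ such that $\partial_x^\alpha u(0)=0$ for all $\alpha\in\mathbb{N}^d$ with $|\alpha|\le N$ (with the convention $\Gamma(u)=-1$ if $u(0)\neq0$). The maximal order of vanishing is $\Gamma_d(\lambda)=\sup_{0\ne u\in\mathcal{E}_d(\lambda)}\Gamma(u)$. *)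

(* Defs.v *)
From HB Require Import structures.
From mathcomp Require Import all_boot all_order all_algebra.
From mathcomp Require Import complex.
From mathcomp Require Import all_classical all_reals all_analysis.

Set Implicit Arguments.
Unset Strict Implicit.
Unset Printing Implicit Defensive.

Import Order.TTheory GRing.Theory Num.Theory.
Import numFieldNormedType.Exports.

Local Open Scope classical_set_scope.
Local Open Scope complex_scope.
Local Open Scope ring_scope.

(* Functions on the torus R^d / (2 pi Z)^d are represented by their lifts,
   i.e. by functions on 'rV[R]_d that are 2 pi-periodic in each coordinate. *)

Definition basis_vec {R : realType} {d : nat} (i : 'I_d) : 'rV[R]_d :=
  delta_mx 0 i.

Definition torus_periodic {R : realType} {d : nat} (u : 'rV[R]_d -> R[i]) :=
  forall (i : 'I_d) (x : 'rV[R]_d), u (x + (2 * pi) *: basis_vec i) = u x.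

(* R[i] carries no normed R-module structure in the library, so derivatives
   along real directions are taken on real and imaginary parts. *)
Definition Cderivable {R : realType} {d : nat} (u : 'rV[R]_d -> R[i])
    (x v : 'rV[R]_d) : Prop :=
  derivable (fun y => complex.Re (u y) : R) x v /\
  derivable (fun y => complex.Im (u y) : R) x v.

Definition Ccontinuous {R : realType} {d : nat} (u : 'rV[R]_d -> R[i]) : Prop :=
  continuous (fun y => complex.Re (u y) : R) /\
  continuous (fun y => complex.Im (u y) : R).

Definition partial {R : realType} {d : nat} (i : 'I_d) (u : 'rV[R]_d -> R[i])
    : 'rV[R]_d -> R[i] :=
  fun x => 'D_(basis_vec i) (fun y => complex.Re (u y) : R) x +i*
           'D_(basis_vec i) (fun y => complex.Im (u y) : R) x.

(* 'D_v f x is total (a junk value is returned when the limit does not exist),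
   hence the explicit derivability requirement. *)
Definition smooth {R : realType} {d : nat} (u : 'rV[R]_d -> R[i]) : Prop :=
  forall s : seq 'I_d,
    let w := foldr partial u s in
    Ccontinuous w /\ forall (i : 'I_d) (x : 'rV[R]_d), Cderivable w x (basis_vec i).

Definition laplacian {R : realType} {d : nat} (u : 'rV[R]_d -> R[i])
    : 'rV[R]_d -> R[i] :=
  fun x => \sum_(i < d) partial i (partial i u) x.

Definition torus_eigenspace {R : realType} (d : nat) (lambda : R)
    : set ('rV[R]_d -> R[i]) :=
  [set u | [/\ torus_periodic u, smooth u &
    forall x, - laplacian u x = (lambda ^+ 2)%:C * u x]].

Definition multi_partial {R : realType} {d : nat} (alpha : 'I_d -> nat)
    (u : 'rV[R]_d -> R[i]) : 'rV[R]_d -> R[i] :=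
  foldr (fun i w => iter (alpha i) (partial i) w) u (enum 'I_d).

Definition vanishes_to_order {R : realType} {d : nat} (u : 'rV[R]_d -> R[i])
    (N : nat) : Prop :=
  forall alpha : 'I_d -> nat,
    (\sum_(i < d) alpha i <= N)%N -> multi_partial alpha u 0 = 0.

(* Valued in extended reals: the supremum is the largest admissible N
   whenever one exists, and +oo for a function that is flat at the origin. *)
Definition vanishing_order {R : realType} {d : nat} (u : 'rV[R]_d -> R[i])
    : \bar R :=
  if u 0 == 0 then
    ereal_sup [set (N%:R)%:E | N in [set N | vanishes_to_order u N]]
  else (- 1)%:E.

Definition max_vanishing_order {R : realType} (d : nat) (lambda : R) : \bar R :=
  ereal_sup [set vanishing_order u |
    u in [set u | torus_eigenspace lambda u /\ u <> (fun _ : 'rV[R]_d => 0)]].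

(* Main.v *)
(* In the basis of functions prod_j cas(k_j x_j), cas = cos + sin, k in Z^d, a real
   eigenfunction is a sum over the lattice points k with |k|^2 = lambda^2 =: n, and
   up to a sign depending only on alpha its derivative of order alpha at 0 is the moment
   sum_k b_k k^alpha of its coefficients.  Vanishing to order N thus means that the
   coefficients annihilate all polynomials of degree at most N on the lattice sphere.

   Upper bound: a lattice point k is separated from the others by a polynomial of degree
   2 (d-2) lambda that fixes its first d-2 coordinates, times one that separates the
   lattice points of a circle, whose number is bounded by a multiple of the square of
   the divisor function.

   Lower bound: since k_d^2 is a polynomial in the other coordinates, moments of degree
   at most N impose about N^(d-1) conditions, while the sphere carries at least a
   multiple of n^((d-2)/2) points.  The latter reduces to r_4(m) >= m for m odd, which
   follows from Jacobi's count of the representations of 4m as a sum of four odd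
   squares, proved by Liouville's method. *)

Require Import Defs.
From mathcomp Require Import all_boot all_order all_algebra.
From mathcomp Require Import complex.
From mathcomp Require Import all_classical all_reals all_analysis.
From mathcomp Require Import zify ring lra.

Set Implicit Arguments.
Unset Strict Implicit.
Unset Printing Implicit Defensive.

Import Order.TTheory GRing.Theory Num.Theory.
Import numFieldNormedType.Exports.

Local Open Scope ring_scope.

(** * Four odd squares *)

(** The function cas is chosen because its derivative is its own shift by pi/2 and because it equals
    1 or -1, never 0, at every multiple of pi/2. So each derivative of a product of cas is nonzero
    at the origin up to its frequency factor, one real function per lattice point suffices, and real
    and imaginary parts of an eigenfunction can be treated separately.

    The upper bound needs every smooth eigenfunction to be a finite sum of such products. Its
    Fourier coefficients are taken one coordinate at a time, as one-dimensional integrals with the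
    other coordinates as parameters; bounds uniform in these parameters replace integration over a
    product space and differentiation under the integral.

    The count of lattice points starts in dimension 5 because in dimension 4 it is bounded along
    powers of 2. One extra coordinate can absorb the parity: it is chosen so that the remaining four
    squares have an odd sum. *)

Lemma reindex_seq (V : nmodType) (I J : eqType) (s : seq I) (t : seq J)
    (P : pred I) (Q : pred J) (g : J -> I) (h : I -> J) (F : I -> V) :
  uniq s -> uniq t ->
  (forall i, i \in s -> P i -> [/\ h i \in t, Q (h i) & g (h i) = i]) ->
  (forall j, j \in t -> Q j -> [/\ g j \in s, P (g j) & h (g j) = j]) ->
  \sum_(i <- s | P i) F i = \sum_(j <- t | Q j) F (g j).
Proof.
move=> us ut sP tQ.
rewrite -big_filter -[RHS]big_filter -(big_map g xpredT F).
apply: perm_big; apply: uniq_perm; first exact: filter_uniq.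
  rewrite map_inj_in_uniq ?filter_uniq // => j j'.
  rewrite !mem_filter => /andP[Qj tj] /andP[Qj' tj'] e.
  by have [_ _ <-] := tQ _ tj Qj; have [_ _ <-] := tQ _ tj' Qj'; rewrite e.
move=> i; rewrite mem_filter; apply/andP/mapP => [[Pi si]|[j]].
  have [th Qh e] := sP _ si Pi; exists (h i) => //.
  by rewrite mem_filter Qh.
rewrite mem_filter => /andP[Qj tj] ->.
by have [-> -> _] := tQ _ tj Qj.
Qed.

Definition zball (N : nat) : seq int :=
  [seq i%:Z - N%:Z | i <- iota 0 N.*2.+1].

Lemma zball_uniq N : uniq (zball N).
Proof. by rewrite map_inj_uniq ?iota_uniq // => i j; lia. Qed.

Lemma mem_zball N (x : int) : (x \in zball N) = (`|x| <= N)%N.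
Proof.
apply/mapP/idP => [[k] |xN]; first by rewrite mem_iota => ? ->; lia.
exists (absz (x + N%:Z)); last by lia.
by rewrite mem_iota; lia.
Qed.

(** The triples (j, d, e) of Zagier's involution proof of the two-square theorem. Positivity of d
    and e confines all three entries to [-N, N], so sums over the triples are sums over the finite
    box [zbox N]. *)
Definition zagier (N : nat) (t : int * (int * int)) : bool :=
  [&& t.1 ^+ 2 + 4 * t.2.1 * t.2.2 == N%:Z, 0 < t.2.1 & 0 < t.2.2].

Definition zbox (N : nat) : seq (int * (int * int)) :=
  [seq (x, yz) | x <- zball N, yz <- [seq (y, z) | y <- zball N, z <- zball N]].

Lemma zbox_uniq N : uniq (zbox N).
Proof.
apply: allpairs_uniq; rewrite ?zball_uniq //; last by move=> [? ?] [? ?] _ _ [] -> ->.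
apply: allpairs_uniq; rewrite ?zball_uniq //; by move=> [? ?] [? ?] _ _ [] -> ->.
Qed.

Lemma zagier_in_zbox N t : zagier N t -> t \in zbox N.
Proof.
case: t => j [d e] /and3P[/= /eqP E d0 e0].
have H : `|j| <= N%:Z /\ `|d| <= N%:Z /\ `|e| <= N%:Z.
  have j2 : `|j| <= j ^+ 2 by nia.
  have dd : d <= d * e by nia.
  have ee : e <= d * e by nia.
  have := sqr_ge0 j; lia.
apply: allpairs_f; first by rewrite mem_zball; lia.
by apply: allpairs_f; rewrite mem_zball; lia.
Qed.

Lemma reindex_zagier (V : nmodType) N (P Q : pred (int * (int * int))) g h F :
  (forall t, P t -> zagier N t) -> (forall t, Q t -> zagier N t) ->
  (forall t, P t -> Q (h t) /\ g (h t) = t) ->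
  (forall t, Q t -> P (g t) /\ h (g t) = t) ->
  \sum_(t <- zbox N | P t) F t = \sum_(t <- zbox N | Q t) F (g t) :> V.
Proof.
move=> sP sQ hP gQ; apply: (@reindex_seq V _ _ _ _ _ _ g h) => //; try exact: zbox_uniq.
  by move=> t _ Pt; have [Qt gt] := hP _ Pt; split=> //; exact/zagier_in_zbox/sQ.
by move=> t _ Qt; have [Pt ht] := gQ _ Qt; split=> //; exact/zagier_in_zbox/sP.
Qed.

Section ZagierSum.
Variable N : nat.
Hypothesis Nsq : forall x : int, x ^+ 2 != N%:Z.

Let S := zagier N.
(** [up] says that the middle entry of (2e - j, d + j - e, e) is positive, [lo] that the last entry
    of (j - 2d, d, e + j - d) is: the domains of the two substitutions that follow. *)
Let up (t : int * (int * int)) := 0 < t.2.1 + t.1 - t.2.2.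
Let lo (t : int * (int * int)) := 0 < t.2.2 + t.1 - t.2.1.
Let F (t : int * (int * int)) := (t.2.2 - t.1) * (t.1 + 2 * t.2.1) ^+ 2.

Let sum_up : \sum_(t <- zbox N | S t && up t) F t = 0.
Proof.
pose g (t : int * (int * int)) := (2 * t.2.2 - t.1, (t.2.1 + t.1 - t.2.2, t.2.2)).
have gP t : S t && up t -> S (g t) && up (g t) /\ g (g t) = t.
  case: t => j [d e]; rewrite /S /zagier /up /g /= => /andP[/and3P[/eqP E d0 e0] u0].
  split; last by congr (_, (_, _)); ring.
  by apply/andP; split; [apply/and3P; split|]; try lia; apply/eqP; rewrite -E; ring.
have E : \sum_(t <- zbox N | S t && up t) F t = - \sum_(t <- zbox N | S t && up t) F t.
  rewrite {1}(reindex_zagier (Q := fun t => S t && up t) (g := g) (h := g)) //;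
    try by move=> t /andP[].
  by rewrite -sumrN; apply: eq_bigr => -[j [d e]] _; rewrite /F /g /=; ring.
by lia.
Qed.

(** Off [up] one has e >= d + j, and equality would make N the square of j + 2d. Hence the last
    entry of [h] is strictly positive, and in the new variables the weight (e - j)(j + 2d)^2 reads
    (d + e) j^2. *)
Let sum_lo : \sum_(t <- zbox N | S t && ~~ up t) F t =
  \sum_(t <- zbox N | S t && lo t) (t.2.1 + t.2.2) * t.1 ^+ 2.
Proof.
pose h (t : int * (int * int)) := (t.1 + 2 * t.2.1, (t.2.1, t.2.2 - t.1 - t.2.1)).
pose g (t : int * (int * int)) := (t.1 - 2 * t.2.1, (t.2.1, t.2.2 + t.1 - t.2.1)).
rewrite (reindex_zagier (Q := fun t => S t && lo t) (g := g) (h := h)).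
- by apply: eq_bigr => -[j [d e]] _; rewrite /F /g /=; ring.
- by move=> t /andP[].
- by move=> t /andP[].
- case=> j [d e]; rewrite /S /zagier /up /lo /g /h /= => /andP[/and3P[/eqP E d0 e0] u0].
  split; last by congr (_, (_, _)); ring.
  have ne : e != j + d.
    apply: contra (Nsq (j + 2 * d)) => /eqP ee; rewrite -E ee; apply/eqP; ring.
  by apply/andP; split; [apply/and3P; split|]; try lia; apply/eqP; rewrite -E; ring.
case=> j [d e]; rewrite /S /zagier /up /lo /g /h /= => /andP[/and3P[/eqP E d0 e0] u0].
split; last by congr (_, (_, _)); ring.
by apply/andP; split; [apply/and3P; split|]; try lia; apply/eqP; rewrite -E; ring.
Qed.

(** The map (j, d, e) -> (-j, e, d) preserves the summand and exchanges [lo] with its complement;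
    the borderline d = j + e would again make N a square. *)
Let sum_half : (\sum_(t <- zbox N | S t && lo t) (t.2.1 + t.2.2) * t.1 ^+ 2) *+ 2 =
  \sum_(t <- zbox N | S t) (t.2.1 + t.2.2) * t.1 ^+ 2.
Proof.
rewrite [RHS](bigID lo) /= mulr2n; congr (_ + _).
pose g (t : int * (int * int)) := (- t.1, (t.2.2, t.2.1)).
rewrite [RHS](reindex_zagier (Q := fun t => S t && lo t) (g := g) (h := g)).
- by apply: eq_bigr => -[j [d e]] _; rewrite /g /=; ring.
- by move=> t /andP[].
- by move=> t /andP[].
- case=> j [d e]; rewrite /S /zagier /up /lo /g /= => /andP[/and3P[/eqP E d0 e0] u0].
  split; last by congr (_, (_, _)); ring.
  have ne : d != j + e.
    apply: contra (Nsq (j + 2 * e)) => /eqP ee; rewrite -E ee; apply/eqP; ring.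
  by apply/andP; split; [apply/and3P; split|]; try lia; apply/eqP; rewrite -E; ring.
case=> j [d e]; rewrite /S /zagier /up /lo /g /= => /andP[/and3P[/eqP E d0 e0] u0].
split; last by congr (_, (_, _)); ring.
by apply/andP; split; [apply/and3P; split|]; try lia; apply/eqP; rewrite -E; ring.
Qed.

Let swap (G : int * (int * int) -> int) :
  \sum_(t <- zbox N | S t) G t = \sum_(t <- zbox N | S t) G (t.1, (t.2.2, t.2.1)).
Proof.
pose g (t : int * (int * int)) := (t.1, (t.2.2, t.2.1)).
rewrite (reindex_zagier (Q := S) (g := g) (h := g)) //;
case=> j [d e]; rewrite /S /zagier /g /= => /and3P[/eqP E d0 e0];
by split=> //; apply/and3P; split=> //; apply/eqP; rewrite -E; ring.
Qed.

Let oppj (G : int * (int * int) -> int) :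
  \sum_(t <- zbox N | S t) G t = \sum_(t <- zbox N | S t) G (- t.1, t.2).
Proof.
pose g (t : int * (int * int)) := (- t.1, t.2).
rewrite (reindex_zagier (Q := S) (g := g) (h := g)) //;
case=> j [d e]; rewrite /S /zagier /g /= => /and3P[/eqP E d0 e0];
split=> //; rewrite ?opprK //; by apply/and3P; split=> //; apply/eqP; rewrite -E; ring.
Qed.

(* Liouville's method with the weight F(x, y) = x y^2 at (x, y) = (e - j, j + 2d):
   the involution (j, d, e) -> (2e - j, d + j - e, e) flips x and fixes y. *)
Lemma zagier_sum :
  \sum_(t <- zbox N | zagier N t) (t.2.1 * t.2.2 - t.1 ^+ 2) * t.2.2 = 0.
Proof.
(* Twice the total weight is computed in two ways: by the substitutions above, and by averaging over
   the sign of j. Exchanging d and e makes every term a multiple of e, and the two values differ by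
   eight times the claim. *)
have E1 : (\sum_(t <- zbox N | S t) F t) *+ 2 =
    \sum_(t <- zbox N | S t) (t.2.1 + t.2.2) * t.1 ^+ 2.
  by rewrite -sum_half -sum_lo [in LHS](bigID up) /= sum_up add0r.
have E2 : (\sum_(t <- zbox N | S t) F t) *+ 2 =
    \sum_(t <- zbox N | S t) (F t + F (- t.1, t.2)).
  by rewrite big_split /= -oppj mulr2n.
have E3 : \sum_(t <- zbox N | S t) (t.2.1 + t.2.2) * t.1 ^+ 2 =
  \sum_(t <- zbox N | S t) 2 * t.2.2 * t.1 ^+ 2.
  rewrite [RHS](eq_bigr (fun t => t.2.2 * t.1 ^+ 2 + t.2.2 * t.1 ^+ 2)); last by move=> t _; ring.
  rewrite big_split /= [X in _ = X + _]swap /= -big_split /=.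
  by apply: eq_bigr => t _; ring.
have E4 : \sum_(t <- zbox N | S t) (F t + F (- t.1, t.2)) =
  \sum_(t <- zbox N | S t) (8 * t.2.1 * t.2.2 * t.2.2 - 6 * t.2.2 * t.1 ^+ 2).
  rewrite [LHS](eq_bigr (fun t => (2 * t.2.2 * t.1 ^+ 2) + (- 8 * t.2.1 * t.1 ^+ 2 + 8 * t.2.1 ^+ 2 * t.2.2))); last first.
    by move=> -[j [d e]] _; rewrite /F /=; ring.
  rewrite big_split /= [X in _ + X = _]swap /= -big_split /=.
  by apply: eq_bigr => t _; ring.
have E5 : \sum_(t <- zbox N | S t) (t.2.1 * t.2.2 - t.1 ^+ 2) * t.2.2 *+ 8 = 0.
  move: E1; rewrite E2 E3 E4 => /eqP; rewrite -subr_eq0 -sumrB => /eqP E.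
  by rewrite -[RHS]E; apply: eq_bigr => t _; ring.
by move/eqP: E5; rewrite sumrMnl mulrn_eq0 /= => /eqP.
Qed.
End ZagierSum.

Definition sigma1 (m : nat) : int := \sum_(e <- divisors m) e%:Z.

Lemma five_mod_eight_not_square m : odd m -> forall x : int, x ^+ 2 != (4 * m + 1)%N%:Z.
Proof.
move=> om x; apply/eqP => E.
have {}E : (absz x * absz x = 4 * m + 1)%N by nia.
have ox : odd (absz x) by move: (congr1 odd E); rewrite oddM oddD oddM /=; case: odd.
have Ex : (absz x = (absz x)./2.*2.+1)%N by rewrite -{1}(odd_double_half (absz x)) ox.
have Em : ((absz x)./2 * ((absz x)./2).+1 = m)%N by nia.
by move: om; rewrite -Em oddM /=; case: odd.
Qed.

(** As N = 4m + 1 is 5 modulo 8, it is odd and not a square. So j = 2i + 1 up to sign and de = m -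
    i(i+1); summing e over the divisors of this number gives [sigma1], and de - j^2 = m - 1 -
    5i(i+1). *)
Lemma sigma1_rec (m K : nat) : odd m -> (m < K)%N ->
  \sum_(i <- iota 0 K | (i * i.+1 < m)%N)
     (m%:Z - 1 - 5 * (i * i.+1)%N%:Z) * sigma1 (m - i * i.+1) = 0.
Proof.
move=> om mK; set N := (4 * m + 1)%N.
have Z := zagier_sum (five_mod_eight_not_square om).
rewrite (bigID (fun t => 0 < t.1)) /= in Z.
pose w (t : int * (int * int)) := (t.2.1 * t.2.2 - t.1 ^+ 2) * t.2.2.
have En : \sum_(t <- zbox N | zagier N t && ~~ (0 < t.1)) w t =
          \sum_(t <- zbox N | zagier N t && (0 < t.1)) w t.
  pose g (t : int * (int * int)) := (- t.1, t.2).
  rewrite (reindex_zagier (N := N) (Q := fun t => zagier N t && (0 < t.1)) (g := g) (h := g)).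
  - by apply: eq_bigr => t _; rewrite /w /g /= sqrrN.
  - by move=> t /andP[].
  - by move=> t /andP[].
  - case=> j [d e]; rewrite /zagier /g /= => /andP[/and3P[/eqP E d0 e0] j0].
    rewrite opprK sqrrN E eqxx d0 e0; split=> //=.
    have : j != 0 by apply/eqP => j0'; move: E; rewrite j0' /N; lia.
    by lia.
  case=> j [d e]; rewrite /zagier /g /= => /andP[/and3P[/eqP E d0 e0] j0].
  rewrite opprK sqrrN E eqxx d0 e0; split=> //=; lia.
move: Z; rewrite -/N [X in _ + X]En.
set X := (X in X + X = _) => XX.
have {XX} X0 : X = 0 by lia.
pose t := [seq (p, e) | p <- iota 0 K, e <- divisors (m - p * p.+1)].
pose g (q : nat * nat) : int * (int * int) :=
  ((q.1.*2.+1)%:Z, (((m - q.1 * q.1.+1) %/ q.2)%N%:Z, q.2%:Z)).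
pose h (t : int * (int * int)) := ((absz t.1)./2, absz t.2.2).
move: X0; rewrite /X (reindex_seq (t := t) (Q := fun q => (q.1 * q.1.+1 < m)%N) (g := g) (h := h)).
- rewrite /t big_mkcond big_allpairs_dep /= => E; rewrite -[RHS]E big_mkcond /=.
  apply: eq_bigr => i _; case: ifP => im; last by rewrite big1.
  rewrite /sigma1 mulr_sumr; apply: eq_big_seq => e.
  rewrite -dvdn_divisors ?subn_gt0 // => ed.
  rewrite /g /= -PoszM divnK //; congr (_ * _); nia.
- exact: zbox_uniq.
- apply: allpairs_uniq_dep; rewrite ?iota_uniq //; first by move=> *; apply: divisors_uniq.
  by move=> [a b] [a' b'] _ _ /= [] -> ->.
- case=> j [d e] _ /andP[Sj]; move: (Sj); rewrite /zagier /h /g /= => /and3P[/eqP E].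
  case: d E Sj => [d|//] E Sj; case: e E Sj => [e|//] E Sj; case: j E Sj => [j|//] E Sj d0 e0 j0.
  have {}E : (j * j + 4 * (d * e) = 4 * m + 1)%N.
    move: E; rewrite /N expr2; lia.
  have oj : odd j.
    by move: (congr1 odd E); rewrite oddD (oddD (4 * m)) !oddM /=; case: (odd j).
  have Ek : j = (j./2).*2.+1 by rewrite -{1}(odd_double_half j) oj.
  set k := j./2 in Ek *; rewrite /= -/k.
  have Ede : (d * e = m - k * k.+1)%N by move: E; rewrite Ek; nia.
  have km : (k * k.+1 < m)%N by rewrite -subn_gt0 -Ede; nia.
  rewrite km; split=> //; last first.
    by rewrite -Ede mulnK; [rewrite -Ek|lia].
  apply/allpairsPdep; exists k, e; split=> //; first by rewrite mem_iota; nia.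
  by rewrite -dvdn_divisors ?subn_gt0 // -Ede dvdn_mull.
case=> k e /allpairsPdep[k' [e' [_ e'd [-> ->]]]]; rewrite /g /h /zagier /= => km.
have e'd' : (e' %| m - k' * k'.+1)%N by rewrite dvdn_divisors // subn_gt0.
have e'0 : (0 < e')%N by apply: dvdn_gt0 e'd'; rewrite subn_gt0.
have d0 : (0 < (m - k' * k'.+1) %/ e')%N by rewrite divn_gt0 // dvdn_leq // subn_gt0.
have E := divnK e'd'.
have zg : zagier N (g (k', e')).
  by apply/and3P; split=> //; apply/eqP; rewrite /g /N /=; nia.
split; [exact: zagier_in_zbox|by rewrite -[X in X && _]/(zagier N (g (k', e'))) zg|].
by rewrite uphalf_double.
Qed.

(** * The theta polynomial of odd squares and its fourth power *)

Definition odd_theta (K : nat) : {poly int} := \sum_(i < K) 'X^((i.*2.+1) ^ 2).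

Lemma coef_sumXnM (R : nzRingType) (I : Type) (s : seq I) (P : pred I) (e : I -> nat) (c : I -> R)
    (p : {poly R}) n :
  ((\sum_(i <- s | P i) c i *: 'X^(e i)) * p)`_n = \sum_(i <- s | P i && (e i <= n)%N) c i * p`_(n - e i).
Proof.
rewrite mulr_suml coef_sum big_mkcondr /=; apply: eq_bigr => i _.
by rewrite -scalerAl coefZ coefXnM ltnNge; case: leqP; rewrite ?mulr0.
Qed.

(* theta (theta^4)' = 4 theta' theta^4, read off coefficientwise. *)
Lemma odd_theta_rec (K N : nat) :
  \sum_(i < K | ((i.*2.+1) ^ 2 <= N)%N)
    (N%:Z - 5 * ((i.*2.+1) ^ 2)%N%:Z) * (odd_theta K ^+ 4)`_(N - (i.*2.+1) ^ 2) = 0.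
Proof.
set th := odd_theta K; pose Q := th ^+ 4.
have E : th * ('X * Q^`()) = ('X * th^`()) * Q *+ 4.
  by rewrite /Q deriv_exp /=; ring.
rewrite -/Q; clearbody Q.
have Eth : th = \sum_(i < K) 1 *: 'X^((i.*2.+1) ^ 2).
  by apply: eq_bigr => i _; rewrite scale1r.
have Edth : 'X * th^`() = \sum_(i < K) ((i.*2.+1) ^ 2)%N%:Z *: 'X^((i.*2.+1) ^ 2).
  rewrite /th /odd_theta raddf_sum mulr_sumr; apply: eq_bigr => i _.
  rewrite /= derivXn mulrnAr -exprS prednK ?expn_gt0 //.
  by rewrite -scaler_nat natz.
have := congr1 (fun p : {poly int} => p`_N) E.
rewrite coefMn Edth Eth !coef_sumXnM -sumrMnl => /eqP; rewrite -subr_eq0 -sumrB => /eqP E'.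
rewrite -[RHS]E'; apply: eq_bigr => i /= iN.
rewrite mul1r coefXM.
have [k ->] : exists k, N = (k + i.*2.+1 ^ 2)%N by exists (N - i.*2.+1 ^ 2)%N; rewrite subnK.
rewrite addnK PoszD; case: k => [|k] /=; first by ring.
by rewrite coef_deriv -mulr_natl natz; ring.
Qed.

(** Since (2i+1)^2 = 4i(i+1) + 1, [odd_theta_rec] at 4m + 1 is four times the recursion of
    [sigma1_rec]. Its term i = 0 carries the factor m - 1, nonzero for m > 1, and the other terms
    involve m - i(i+1), which is smaller and again odd. So both sides are determined by their common
    value at m = 1. *)
Lemma coef_odd_theta4 (K m : nat) : odd m -> (m < K)%N ->
  (odd_theta K ^+ 4)`_(4 * m) = sigma1 m.
Proof.
elim/ltn_ind: m => m IH om mK.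
have [m1|m1] := leqP m 1.
  have {IH m1}-> : m = 1%N by case: m om m1 {mK IH} => [|[|]].
  case: K mK => // K _; rewrite /odd_theta big_ord_recl /= expr1.
  set S := \sum_(i < K) _.
  have [T ->] : exists T, S = 'X^9 * T.
    exists (\sum_(i < K) 'X^(((bump 0 i).*2.+1) ^ 2 - 9)); rewrite /S mulr_sumr.
    apply: eq_bigr => i _; rewrite -exprD subnKC // /bump; nia.
  have -> : ('X + 'X^9 * T) ^+ 4 = 'X^4 * (1 + 'X * ('X^7 * T)) ^+ 4 by ring.
  rewrite coefXnM /= -horner_coef0 !hornerE ?mul0r ?addr0 ?expr1n.
  by rewrite /sigma1 /= big_seq1.
have E2 := sigma1_rec om mK; rewrite -[K in iota 0 K]subn0 -/(index_iota 0 K) big_mkord in E2.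
have E1 : \sum_(i < K | (i * i.+1 < m)%N)
    (m%:Z - 1 - 5 * (i * i.+1)%N%:Z) * (odd_theta K ^+ 4)`_(4 * (m - i * i.+1)) = 0.
  have := odd_theta_rec K (4 * m + 1).
  (* The borderline i(i+1) = m cannot occur, the left side being even and m odd. *)
  have cE (i : 'I_K) : (i.*2.+1 ^ 2 <= 4 * m + 1)%N = (i * i.+1 < m)%N.
    have : (i * i.+1 != m)%N by apply: contraTneq om => <-; rewrite oddM /=; case: (odd i).
    by rewrite expnS expn1; nia.
  rewrite (eq_bigl _ _ cE) => E.
  suff : (\sum_(i < K | (i * i.+1 < m)%N)
    (m%:Z - 1 - 5 * (i * i.+1)%N%:Z) * (odd_theta K ^+ 4)`_(4 * (m - i * i.+1))) *+ 4 = 0.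
    by move/eqP; rewrite mulrn_eq0 => /eqP.
  rewrite -[RHS]E -sumrMnl; apply: eq_bigr => i im.
  have -> : (4 * m + 1 - i.*2.+1 ^ 2 = 4 * (m - i * i.+1))%N.
    by rewrite expnS expn1; nia.
  have -> : ((i.*2.+1) ^ 2)%N%:Z = 4 * (i * i.+1)%N%:Z + 1 by rewrite expnS expn1; nia.
  by rewrite PoszD PoszM; ring.
suff : (m%:Z - 1) * ((odd_theta K ^+ 4)`_(4 * m) - sigma1 m) = 0.
  by move/eqP; rewrite mulf_eq0 => /orP[|/eqP]; lia.
have K0 : (0 < K)%N by lia.
have m0 : (0 < m)%N by lia.
move: E1 E2; rewrite (bigD1 (Ordinal K0)) //= [in X in _ -> X](bigD1 (Ordinal K0)) //=.
rewrite !mul0n !subn0 !mulr0 !subr0 => E1 E2.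
have := etrans E1 (esym E2); set S2 := (X in _ = _ + X); set S1 := (X in _ + X = _).
have -> : S1 = S2; last by move/addIr; rewrite mulrBr => ->; rewrite subrr.
apply: eq_bigr => i /andP[im i0]; rewrite IH //.
- have i1 : (0 < i)%N by rewrite lt0n; apply: contraNneq i0 => e; apply/eqP/val_inj.
  by rewrite ltn_subrL muln_gt0 i1 m0.
- by rewrite (oddB (ltnW im)) om oddM /=; case: (odd i).
- by apply: leq_ltn_trans mK; apply: leq_subr.
Qed.

Lemma coef_odd_theta4_ge (K m : nat) : odd m -> (m < K)%N ->
  m%:Z <= (odd_theta K ^+ 4)`_(4 * m).
Proof.
move=> om mK; rewrite coef_odd_theta4 // /sigma1.
have m0 : (0 < m)%N by case: m om {mK}.
rewrite (big_rem m) /= -?dvdn_divisors // lerDl; exact: sumr_ge0.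
Qed.

(** * Lattice points on spheres *)

(** Coordinates in [-L, L] are indexed by an ordinal so that lattice spheres are finite sets. L is a
    free box size, which the users choose large enough for the box to contain the sphere. *)
Definition zcoord (L : nat) (a : 'I_(L.*2.+1)) : int := a%:Z - L%:Z.

Definition zord (L : nat) (x : int) : 'I_(L.*2.+1) := inord (absz (x + L%:Z)).

Lemma zordK L (x : int) : (absz x <= L)%N -> zcoord (zord L x) = x.
Proof. by move=> xL; rewrite /zcoord /zord inordK; lia. Qed.

Lemma zcoordK L : cancel (@zcoord L) (zord L).
Proof. by move=> a; apply/val_inj; rewrite /= inordK /zcoord; have := ltn_ord a; lia. Qed.

Lemma zcoord_le L (a : 'I_(L.*2.+1)) : (absz (zcoord a) <= L)%N.
Proof. by rewrite /zcoord; have := ltn_ord a; lia. Qed.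

Definition theta (L : nat) : {poly int} :=
  \sum_(a < L.*2.+1) 'X^(absz (zcoord a) ^ 2).

Definition lattice_sphere (d L n : nat) : {set {ffun 'I_d -> 'I_(L.*2.+1)}} :=
  [set k : {ffun 'I_d -> 'I_(L.*2.+1)} | (\sum_(j < d) absz (zcoord (k j)) ^ 2 == n)%N].

Lemma bump0 k : bump 0 k = k.+1.
Proof. by []. Qed.

Lemma sqr_absz (x : int) : (absz x ^ 2)%N%:Z = x ^+ 2.
Proof. by rewrite expnS expn1 PoszM abszE -expr2 real_normK ?num_real. Qed.

Lemma coef_sumXn_exp (I : finType) (e : I -> nat) (d n : nat) :
  ((\sum_(i : I) 'X^(e i)) ^+ d : {poly int})`_n =
  #|[set f : {ffun 'I_d -> I} | (\sum_(j < d) e (f j) == n)%N]|%:R.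
Proof.
rewrite -[d in _ ^+ d]card_ord -prodr_const bigA_distr_bigA /= coef_sum.
rewrite -sum1_card natr_sum big_mkcond [RHS]big_mkcond /=.
apply: eq_bigr => f _; rewrite inE prodrXr coefXn eq_sym.
by case: eqP.
Qed.

Lemma coef_theta_exp d L n : (theta L ^+ d)`_n = #|lattice_sphere d L n|%:R.
Proof. exact: coef_sumXn_exp. Qed.

(** Quadruples of positive odd numbers with square sum 4m inject into integer quadruples with square
    sum m: adjust the sign of the last entry, apply the Hadamard matrix of order 4, which multiplies
    square sums by 4, and divide by 4. The matrix is invertible, and the adjusted sign is recovered
    because the entry was positive. *)
Lemma card_lattice_sphere4_ge (L m : nat) : odd m -> (m <= L)%N ->
  (m <= #|lattice_sphere 4 L m|)%N.
Proof.
move=> om mL; have := coef_odd_theta4_ge om (ltnSn m).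
rewrite /odd_theta coef_sumXn_exp natz lez_nat => /leq_trans; apply.
set A := [set _ | _].
pose o (f : {ffun 'I_4 -> 'I_m.+1}) (j : nat) : int := ((f (inord j)).*2.+1)%:Z.
(* A sum of four odd numbers is even, and flipping the sign of the last one changes it by 2 modulo
   4; so one of the two signs makes the sum divisible by 4. *)
pose e' f : int := if ((o f 0%N + o f 1%N + o f 2%N + o f 3%N) %% 4)%Z == 0 then o f 3%N else - o f 3%N.
pose q f (j : nat) : int := nth 0 [:: o f 0%N + o f 1%N + o f 2%N + e' f; o f 0%N + o f 1%N - o f 2%N - e' f;
   o f 0%N - o f 1%N + o f 2%N - e' f; o f 0%N - o f 1%N - o f 2%N + e' f] j.
have q4 f j : exists z : int, q f j = 4 * z.
  suff [z Ez] : exists z : int, o f 0%N + o f 1%N + o f 2%N + e' f = 4 * z.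
    have oE i : o f i = 2 * (f (inord i))%:Z + 1 by rewrite /o; lia.
    have [z3 E3] : exists z3 : int, e' f = 2 * z3 + 1.
      rewrite /e'; case: ifP => _; rewrite oE; first by eexists.
      by exists (- (f (inord 3))%:Z - 1); ring.
    case: j => [|[|[|[|j]]]]; rewrite /q /=.
    - by exists z.
    - by exists (z - (f (inord 2))%:Z - z3 - 1); have := oE 2%N; lia.
    - by exists (z - (f (inord 1))%:Z - z3 - 1); have := oE 1%N; lia.
    - by exists (z - (f (inord 1))%:Z - (f (inord 2))%:Z - 1); have := oE 1%N; have := oE 2%N; lia.
    - by exists 0; rewrite nth_nil.
  rewrite /e'; case: ifP => [/eqP E|/eqP E].
    by exists ((o f 0%N + o f 1%N + o f 2%N + o f 3%N) %/ 4)%Z; lia.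
  by exists ((o f 0%N + o f 1%N + o f 2%N - o f 3%N) %/ 4)%Z; move: E; rewrite /o; lia.
pose z f j : int := (q f j %/ 4)%Z.
have zE f j : q f j = 4 * z f j by have [y E] := q4 f j; rewrite /z E; lia.
pose h f : {ffun 'I_4 -> 'I_(L.*2.+1)} := [ffun j : 'I_4 => zord L (z f j)].
have e2 f : e' f ^+ 2 = o f 3%N ^+ 2 by rewrite /e'; case: ifP => _; rewrite ?sqrrN.
have zm f : f \in A -> z f 0%N ^+ 2 + z f 1%N ^+ 2 + z f 2%N ^+ 2 + z f 3%N ^+ 2 = m%:Z.
  rewrite inE !big_ord_recl big_ord0 => /eqP E.
  have {}E : o f 0%N ^+ 2 + o f 1%N ^+ 2 + o f 2%N ^+ 2 + o f 3%N ^+ 2 = 4 * m%:Z.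
    have sqE a : (a ^ 2)%N%:Z = a%:Z ^+ 2 by rewrite expnS expn1 PoszM expr2.
    rewrite -[4%R]/(4%N%:Z) -PoszM -E /o !PoszD !sqE.
    rewrite (_ : inord 0 = ord0 :> 'I_4); last by apply/val_inj; rewrite /= inordK.
    rewrite (_ : inord 1 = lift ord0 ord0 :> 'I_4); last by apply/val_inj; rewrite /= inordK.
    rewrite (_ : inord 2 = lift ord0 (lift ord0 ord0) :> 'I_4); last by apply/val_inj; rewrite /= inordK.
    rewrite (_ : inord 3 = lift ord0 (lift ord0 (lift ord0 ord0)) :> 'I_4); last by apply/val_inj; rewrite /= inordK.
    by rewrite addr0 !addrA.
  have := zE f 0%N; have := zE f 1%N; have := zE f 2%N; have := zE f 3%N; rewrite /q /=.
  move: E (e2 f); move: (o f 0%N) (o f 1%N) (o f 2%N) (o f 3%N) (e' f) (z f 0%N) (z f 1%N) (z f 2%N) (z f 3%N).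
  move=> a b c e e1 A0 B0 C0 D0 E Ee E3 E2 E1 E0.
  have X : (4 * A0) ^+ 2 + (4 * B0) ^+ 2 + (4 * C0) ^+ 2 + (4 * D0) ^+ 2 = 16 * m%:Z.
    rewrite -E0 -E1 -E2 -E3.
    transitivity (4 * (a ^+ 2 + b ^+ 2 + c ^+ 2 + e1 ^+ 2)); first by ring.
    by rewrite Ee E; ring.
  by apply: (@mulfI _ 16) => //; rewrite -X; ring.
have zL f (j : 'I_4) : f \in A -> (absz (z f j) <= L)%N.
  move/zm => E; have : z f j ^+ 2 <= m%:Z.
    rewrite -E; have S i := sqr_ge0 (z f i).
    have := S 0%N; have := S 1%N; have := S 2%N; have := S 3%N.
    by case: j => -[|[|[|[|//]]]] /= _; lia.
  by nia.
rewrite -(card_in_imset (f := h)); last first.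
  move=> f g fA gA /ffunP hfg.
  have zfg (j : nat) : (j < 4)%N -> z f j = z g j.
    move=> j4; have := hfg (Ordinal j4); rewrite !ffunE /= => /(congr1 (@zcoord L)).
    by rewrite !zordK // (zL _ (Ordinal j4)).
  have ofg (j : nat) : (j < 4)%N -> o f j = o g j.
    have := zE f 0%N; have := zE f 1%N; have := zE f 2%N; have := zE f 3%N.
    have := zE g 0%N; have := zE g 1%N; have := zE g 2%N; have := zE g 3%N.
    rewrite !zfg // /q /= => G3 G2 G1 G0 F3 F2 F1 F0.
    have E3 : e' f = e' g by lia.
    have {}E3 : o f 3%N = o g 3%N.
      move: E3; rewrite /e'; have : 0 < o f 3%N by []; have : 0 < o g 3%N by [].
      by case: ifP; case: ifP; lia.
    case: j => [|[|[|[|//]]]] _ //; lia.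
  apply/ffunP => j; apply/val_inj; have := ofg j (ltn_ord j).
  by rewrite /o !inord_val /=; lia.
apply: subset_leq_card; apply/fintype.subsetP => k /imsetP[f fA ->].
rewrite inE -eqz_nat; apply/eqP; rewrite -(zm _ fA) !big_ord_recl big_ord0.
rewrite /h !ffunE !zordK ?zL //=.
rewrite addn0 !PoszD -!addrA !sqr_absz !bump0.
by [].
Qed.

(** Only the slices at chosen values [x t] of the first coordinate are kept, so that the size and
    the parity of what remains can be prescribed. *)
Lemma card_lattice_sphereS (d L n T : nat) (x : 'I_T -> nat) :
  injective x -> (forall t, (x t <= L)%N) -> (forall t, (x t ^ 2 <= n)%N) ->
  (\sum_(t < T) #|lattice_sphere d L (n - x t ^ 2)| <= #|lattice_sphere d.+1 L n|)%N.
Proof.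
move=> xI xL xn.
rewrite -lez_nat -[X in _ <= X]natz -coef_theta_exp exprS.
have E : theta L = \sum_(a < L.*2.+1) (1 : int) *: 'X^(absz (zcoord a) ^ 2).
  by apply: eq_bigr => a _; rewrite scale1r.
rewrite {1}E coef_sumXnM; under [X in _ <= X]eq_bigr do rewrite mul1r.
pose h t := zord L (x t).
have hK t : absz (zcoord (h t)) = x t by rewrite zordK /= ?xL.
have hI : injective h by move=> s t /(congr1 (fun a => absz (zcoord a))); rewrite !hK => /xI.
rewrite (bigID (fun a => a \in h @: 'I_T)) /=; apply: ler_wpDr.
  by apply: sumr_ge0 => a _; rewrite coef_theta_exp.
rewrite (eq_bigl (fun a => a \in h @: 'I_T)); last first.
  move=> a; apply: andb_idl => /imsetP[t _ ->]; by rewrite hK xn.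
rewrite big_imset /=; last by move=> s t _ _; apply: hI.
rewrite (eq_bigl xpredT) => [|t]; last by [].
rewrite -natz natr_sum; apply: ler_sum => t _.
by rewrite coef_theta_exp hK.
Qed.

(** With l = sqrt n, the first coordinate takes more than l/8 values x = 2t + eps, of the parity
    that makes n - x^2 odd and with x^2 <= n/2. Each slice then has at least l^2/2 points. *)
Lemma card_lattice_sphere5_ge (R : realType) (L n : nat) : (0 < n)%N -> (n <= L)%N ->
  Num.sqrt n%:R ^+ 3 / 16 <= (#|lattice_sphere 5 L n|%:R : R).
Proof.
move=> n0 nL; set l : R := Num.sqrt n%:R.
have l0 : 0 <= l by apply: sqrtr_ge0.
have l2 : l ^+ 2 = n%:R by rewrite sqr_sqrtr.
pose T := Num.truncn (l / 8).
have l8 : 0 <= l / 8 by apply: divr_ge0.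
have /andP[T1 T2] := truncn_itv l8; rewrite -/T in T1 T2.
pose eps : nat := ~~ odd n.
pose x (t : 'I_T.+1) : nat := (t * 2 + eps)%N.
have x2 t : (x t ^ 2 * 2 <= n)%N.
  (* For l < 8 the only value is x = eps, and eps = 1 requires n even, so n >= 2. *)
  have [l1|l1] := ltP l 8.
    have T0 : T = 0%N.
      by apply/eqP; rewrite -leqn0 -ltnS -(ltr_nat R); apply: le_lt_trans T1 _; lra.
    have t0 : t = 0%N :> nat by have := ltn_ord t; lia.
    by rewrite /x t0 /eps; case: n n0 {nL l l0 l2 T l8 T1 T2 x t l1 T0 t0 eps} => [|[|n]] //; case: odd.
  rewrite -(ler_nat R) natrM natrX -l2.
  have tT : (t : nat)%:R <= l / 8 by apply: (le_trans _ T1); rewrite ler_nat -ltnS.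
  have xE : (x t)%:R <= l / 4 + 1.
    rewrite /x natrD natrM; have : (eps%:R : R) <= 1 by rewrite lern1 /eps; case: odd.
    by lra.
  have x0 : 0 <= (x t)%:R :> R by [].
  nra.
have xI : injective x by move=> s t; rewrite /x => e; apply/val_inj => /=; lia.
have xn t : (x t ^ 2 <= n)%N by have := x2 t; lia.
have xL t : (x t <= L)%N by have := xn t; rewrite expnS expn1; nia.
have := card_lattice_sphereS 4 xI xL xn; rewrite -(ler_nat R) => /(le_trans _); apply.
rewrite natr_sum; apply: (@le_trans _ _ (\sum_(t < T.+1) (l ^+ 2 / 2))).
  rewrite sumr_const card_ord -mulr_natr; have : l / 8 < T.+1%:R by [].
  by move: (T.+1%:R) => S lS; nra.
apply: ler_sum => t _; apply: (@le_trans _ _ (n - x t ^ 2)%:R).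
  by rewrite natrB // -l2; have := x2 t; rewrite -(ler_nat R) natrM -l2; lra.
rewrite ler_nat; apply: card_lattice_sphere4_ge; last by apply: leq_trans nL; apply: leq_subr.
rewrite (oddB (xn t)) oddX /= /x oddD oddM andbF /= /eps; by case: odd.
Qed.

(** Passing from dimension d to d + 1 keeps the slices t <= l/2, whose remaining radius is at least
    l/2. This costs a factor 2^(d-1), which the growth 2d + 1 of the exponent d^2 absorbs. *)
Lemma card_lattice_sphere_ge (R : realType) (d L n : nat) : (5 <= d)%N -> (0 < n)%N -> (n <= L)%N ->
  Num.sqrt n%:R ^+ (d - 2) / (16 * 2 ^+ (d ^ 2)) <= (#|lattice_sphere d L n|%:R : R).
Proof.
elim: d n => // d IH n; rewrite leq_eqVlt => /predU1P[<-|d5] n0 nL.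
  apply: le_trans (card_lattice_sphere5_ge R n0 nL).
  rewrite ler_wpM2l ?exprn_ge0 ?sqrtr_ge0 // lef_pV2 ?posrE ?mulr_gt0 ?exprn_gt0 //.
  by rewrite ler_peMr // exprn_ege1 // ler1n.
set l : R := Num.sqrt n%:R.
have l0 : 0 <= l by apply: sqrtr_ge0.
have l2 : l ^+ 2 = n%:R by rewrite sqr_sqrtr.
pose T := Num.truncn (l / 2).
have lh : 0 <= l / 2 by apply: divr_ge0.
have /andP[T1 T2] := truncn_itv lh; rewrite -/T in T1 T2.
pose x (t : 'I_T.+1) : nat := t.
have x2 t : (x t ^ 2 * 4 <= n)%N.
  rewrite -(ler_nat R) natrM natrX -l2.
  have : (x t)%:R <= l / 2 by apply: (le_trans _ T1); rewrite ler_nat -ltnS /x.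
  have x0 : 0 <= (x t)%:R :> R by [].
  nra.
have xI : injective x by move=> s t e; apply/val_inj.
have xn t : (x t ^ 2 <= n)%N by have := x2 t; lia.
have xL t : (x t <= L)%N by have := xn t; rewrite expnS expn1; nia.
have := card_lattice_sphereS d xI xL xn; rewrite -(ler_nat R) => /(le_trans _); apply.
rewrite natr_sum.
apply: (@le_trans _ _ (\sum_(t < T.+1) ((l / 2) ^+ (d - 2) / (16 * 2 ^+ (d ^ 2))))).
  rewrite sumr_const card_ord -[X in _ <= X]mulr_natr.
  have c0 : 0 < (16 * 2 ^+ (d ^ 2) : R) by rewrite mulr_gt0 ?exprn_gt0.
  apply: (@le_trans _ _ ((l / 2) ^+ (d - 2) / (16 * 2 ^+ (d ^ 2)) * (l / 2))); last first.
    apply: ler_wpM2l; last exact: ltW.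
    by apply: divr_ge0; [exact: exprn_ge0|exact: ltW].
  have [k Ek] : exists k, d = k.+2 by exists (d - 2)%N; lia.
  have -> : (d.+1 - 2 = k.+1)%N by lia.
  have -> : (d - 2 = k)%N by lia.
  have AB : 2 ^+ k.+1 * 2 ^+ (d ^ 2) <= 2 ^+ (d.+1 ^ 2) :> R.
    by rewrite -exprD ler_eXn2l ?ltr1n // Ek -!mulnn; nia.
  have A0 : 0 < 2 ^+ (d ^ 2) :> R by rewrite exprn_gt0.
  have B0 : 0 < 2 ^+ (d.+1 ^ 2) :> R by rewrite exprn_gt0.
  move: (2 ^+ (d ^ 2)) (2 ^+ (d.+1 ^ 2)) A0 B0 AB => A B A0 B0 AB.
  have la : l = 2 * (l / 2) by field.
  rewrite ler_pdivrMr ?mulr_gt0 //.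
  have -> : (l / 2) ^+ k / (16 * A) * (l / 2) * (16 * B) = (l / 2) ^+ k.+1 * B / A.
    by rewrite exprSr; field; rewrite gt_eqF.
  rewrite ler_pdivlMr // {1}la exprMn mulrAC (mulrC _ ((l / 2) ^+ _)).
  by apply: ler_wpM2l => //; exact: exprn_ge0.
apply: ler_sum => t _; apply: le_trans (IH _ _ _ _) => //.
- rewrite ler_wpM2r ?invr_ge0 ?mulr_ge0 ?exprn_ge0 // lerXn2r ?nnegrE ?sqrtr_ge0 //.
  rewrite -(@ler_pXn2r _ 2) ?nnegrE ?sqrtr_ge0 // sqr_sqrtr // expr_div_n l2 -natrX ler_pdivrMr ?ltr0n //.
  rewrite -natrM ler_nat; have := x2 t; lia.
- by have := x2 t; lia.
by apply: leq_trans nL; apply: leq_subr.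
Qed.

(** For small n the preceding bound may fall below one point, whereas a combination with vanishing
    moments of order 0 and 1 is built from more than two. *)
Lemma card_lattice_sphere_ge_pred (d L n : nat) : (5 <= d)%N -> (0 < n)%N -> (n <= L)%N ->
  (n.-1 <= #|lattice_sphere d L n|)%N.
Proof.
elim: d => // d IH; rewrite leq_eqVlt => /predU1P[<-|d5] n0 nL.
  pose x (t : 'I_1) : nat := ~~ odd n.
  have xI : injective x by move=> s t _; rewrite !ord1.
  have xn t : (x t ^ 2 <= n)%N by rewrite /x; case: odd.
  have xL t : (x t <= L)%N by rewrite /x; case: odd => //; apply: leq_trans nL.
  apply: leq_trans (card_lattice_sphereS 4 xI xL xn); rewrite big_ord1.
  apply: leq_trans (card_lattice_sphere4_ge _ _).
  - by rewrite -subn1 leq_sub2l // /x; case: odd.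
  - by rewrite (oddB (xn _)) oddX /= /x; case: odd.
  by apply: leq_trans nL; apply: leq_subr.
pose x (t : 'I_1) : nat := 0%N.
have xI : injective x by move=> s t _; rewrite !ord1.
apply: leq_trans (card_lattice_sphereS d xI (fun=> leq0n _) (fun=> leq0n _)).
by rewrite big_ord1 subn0; apply: IH.
Qed.

(** * Sums of two squares *)

Lemma coprime_sum_squares_not_dvd4 (x y : nat) : coprime x y -> ~~ (4 %| x ^ 2 + y ^ 2)%N.
Proof.
move=> cxy; apply/negP => /dvdnP[k E].
have : ~~ (~~ odd x && ~~ odd y).
  apply/negP; rewrite -!dvdn2 => /andP[x2 y2].
  by have : (2 %| gcdn x y)%N; [rewrite dvdn_gcd x2 y2 | rewrite (eqP cxy)].
have := odd_double_half x; have := odd_double_half y; rewrite -!mulnn in E.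
by case: (odd x); case: (odd y) => //= ye xe _; move: E; rewrite -ye -xe; nia.
Qed.

Lemma coprime_sum_squares (x y r : nat) : coprime x y -> (x ^ 2 + y ^ 2 = r)%N ->
  coprime r x /\ coprime r y.
Proof.
move=> cxy <-; split.
  by rewrite coprime_sym /coprime -mulnn gcdnMDl -/(coprime _ _) coprimeXr.
by rewrite coprime_sym /coprime addnC -mulnn gcdnMDl -/(coprime _ _) coprimeXr // coprime_sym.
Qed.

(* With A = x y0 - x0 y and B = x y0 + x0 y one has r | A B, and the factors of r
   dividing A and B are coprime; so gcd(B, r) determines x / y modulo r. *)
Lemma primitive_two_squares_inj (r x0 y0 x y x' y' : nat) :
  coprime x0 y0 -> coprime x y -> coprime x' y' ->
  (x0 ^ 2 + y0 ^ 2 = r)%N -> (x ^ 2 + y ^ 2 = r)%N -> (x' ^ 2 + y' ^ 2 = r)%N ->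
  (0 < x)%N -> (0 < y)%N -> (0 < x')%N -> (0 < y')%N ->
  gcdn (x * y0 + x0 * y) r = gcdn (x' * y0 + x0 * y') r -> (x, y) = (x', y').
Proof.
move=> c0 c c' E0 E E' px py px' py'; set g := gcdn _ r => eg.
have r0 : (0 < r)%N by rewrite -E -!mulnn; nia.
have g0 : (0 < g)%N by rewrite gcdn_gt0 r0 orbT.
have [_ cy0] := coprime_sum_squares c0 E0.
have gr : (g %| r)%N by apply: dvdn_gcdr.
have [h Eh] := dvdnP gr.
have h0 : (0 < h)%N by move: r0; rewrite Eh muln_gt0 => /andP[].
have hA a b : (a ^ 2 + b ^ 2 = r)%N -> gcdn (a * y0 + x0 * b) r = g ->
    (h%:Z %| a%:Z * y0%:Z - x0%:Z * b%:Z)%Z /\ (g%:Z %| a%:Z * y0%:Z + x0%:Z * b%:Z)%Z.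
  move=> Eab egab; set A := _ - _.
  have gB : (g %| a * y0 + x0 * b)%N by rewrite -egab dvdn_gcdl.
  split; last by rewrite -!PoszM -PoszD.
  have [B' EB] := dvdnP gB.
  have cB : coprime h B'.
    rewrite /coprime -(eqn_pmul2r g0) mul1n muln_gcdl -EB -Eh gcdnC; exact/eqP.
  have : (r %| absz A * (a * y0 + x0 * b))%N.
    rewrite -[X in (_ %| _ * X)%N]absz_nat -abszM -[r]absz_nat -dvdzE.
    apply/dvdzP; exists (y0%:Z ^+ 2 - b%:Z ^+ 2).
    rewrite /A PoszD !PoszM.
    have sqE t : (t ^ 2)%N%:Z = t%:Z ^+ 2 by rewrite expnS expn1 PoszM expr2.
    have H1 : r%:Z = a%:Z ^+ 2 + b%:Z ^+ 2 by rewrite -Eab PoszD !sqE.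
    have H0 : x0%:Z ^+ 2 = r%:Z - y0%:Z ^+ 2 by rewrite -E0 PoszD !sqE addrK.
    transitivity (a%:Z ^+ 2 * y0%:Z ^+ 2 - x0%:Z ^+ 2 * b%:Z ^+ 2); first by ring.
    by rewrite H0 H1; ring.
  by rewrite EB Eh mulnA dvdn_pmul2r // Gauss_dvdl // dvdzE absz_nat.
have [hA1 gB1] := hA _ _ E (erefl g); have [hA2 gB2] := hA _ _ E' (esym eg).
pose D : int := x%:Z * y'%:Z - x'%:Z * y%:Z.
(* Since y0 is prime to r, it is enough to divide y0 D, which is a combination of the two sums x y0
   + x0 y and x' y0 + x0 y', and also of the two differences. *)
have dD (q : nat) : (q %| r)%N -> (q%:Z %| y0%:Z * D)%Z -> (q %| absz D)%N.
  move=> qr; rewrite dvdzE abszM absz_nat Gauss_dvdr //.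
  exact: coprime_dvdl cy0.
have gD : (g %| absz D)%N.
  apply: dD => //.
  have -> : y0%:Z * D = y'%:Z * (x%:Z * y0%:Z + x0%:Z * y%:Z) - y%:Z * (x'%:Z * y0%:Z + x0%:Z * y'%:Z).
    by rewrite /D; ring.
  by apply: rpredB; apply: dvdz_mull.
have hD : (h %| absz D)%N.
  apply: dD; first by rewrite Eh dvdn_mulr.
  have -> : y0%:Z * D = y'%:Z * (x%:Z * y0%:Z - x0%:Z * y%:Z) - y%:Z * (x'%:Z * y0%:Z - x0%:Z * y'%:Z).
    by rewrite /D; ring.
  by apply: rpredB; apply: dvdz_mull.
(* A common prime p of g and h divides 2 x y0, the sum of the two factors. As x and y0 are prime to
   r, p = 2, and then 4 divides r = x^2 + y^2 with x, y coprime, which is impossible. *)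
have cgh : coprime h g.
  apply/contraT => ncop.
  have [p pp] : exists2 p, prime p & (p %| gcdn h g)%N.
    exists (pdiv (gcdn h g)); last exact: pdiv_dvd.
    apply: pdiv_prime; have : (0 < gcdn h g)%N by rewrite gcdn_gt0 h0.
    by move: ncop; rewrite /coprime; lia.
  rewrite dvdn_gcd => /andP[ph pg].
  have [cx cy] := coprime_sum_squares c E.
  have pr : (p %| r)%N by apply: dvdn_trans gr.
  have : (p%:Z %| 2 * (x%:Z * y0%:Z))%Z.
    have -> : 2 * (x%:Z * y0%:Z) = (x%:Z * y0%:Z - x0%:Z * y%:Z) + (x%:Z * y0%:Z + x0%:Z * y%:Z) by ring.
    apply: rpredD; [apply: dvdz_trans hA1|apply: dvdz_trans gB1]; by rewrite dvdzE.
  rewrite dvdzE !abszM !absz_nat Gauss_dvdl; last first.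
    by rewrite coprimeMr (coprime_dvdl pr cx) (coprime_dvdl pr cy0).
  rewrite /= dvdn_prime2 // => /eqP p2; subst p.
  have : (4 %| r)%N by rewrite Eh (_ : 4 = 2 * 2)%N // dvdn_mul.
  by rewrite -E; apply/contraLR => _; apply: coprime_sum_squares_not_dvd4.
have rD : (r %| absz D)%N by rewrite Eh Gauss_dvd // hD gD.
(* By Brahmagupta's identity D^2 + (x x' + y y')^2 = r^2 with a positive second term, so |D| < r,
   while r divides D. *)
have D0 : absz D = 0%N.
  apply/eqP; rewrite -[_ == _]negbK -lt0n; apply/negP => /dvdn_leq /(_ rD) rleD.
  have H : D ^+ 2 + (x%:Z * x'%:Z + y%:Z * y'%:Z) ^+ 2 = r%:Z ^+ 2.
    have sqE t : (t ^ 2)%N%:Z = t%:Z ^+ 2 by rewrite expnS expn1 PoszM expr2.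
    transitivity ((x ^ 2 + y ^ 2)%N%:Z * (x' ^ 2 + y' ^ 2)%N%:Z); last by rewrite E E'.
    by rewrite !PoszD !sqE /D; ring.
  have S0 : 0 < x%:Z * x'%:Z + y%:Z * y'%:Z by rewrite addr_gt0 ?mulr_gt0.
  have : r%:Z ^+ 2 <= D ^+ 2.
    by rewrite -[D ^+ 2]real_normK ?num_real // lerXn2r ?nnegrE // -abszE lez_nat.
  by rewrite -H gerDl leNgt exprn_gt0.
have {}D0 : (x * y' = x' * y)%N by move/eqP: D0; rewrite absz_eq0 subr_eq0 -!PoszM eqz_nat => /eqP.
have cc := c; rewrite coprime_sym in cc; have cc' := c'; rewrite coprime_sym in cc'.
congr (_, _); apply/eqP; rewrite eqn_dvd; apply/andP; split.
- by rewrite -(Gauss_dvdl _ c) -D0 dvdn_mulr.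
- by rewrite -(Gauss_dvdl _ c') D0 dvdn_mulr.
- by rewrite -(Gauss_dvdr _ cc) D0 dvdn_mull.
- by rewrite -(Gauss_dvdr _ cc') -D0 dvdn_mull.
Qed.

Definition pos_two_squares (r : nat) : seq (nat * nat) :=
  [seq p <- [seq (x, y) | x <- iota 1 r, y <- iota 1 r] | (p.1 ^ 2 + p.2 ^ 2 == r)%N].

Lemma mem_pos_two_squares r x y :
  ((x, y) \in pos_two_squares r) = [&& 0 < x, 0 < y & x ^ 2 + y ^ 2 == r]%N.
Proof.
rewrite mem_filter /=.
apply/andP/and3P => [[E /allpairsPdep[a [b [ha hb [xa yb]]]]]|[x0 y0 E]].
  by move: ha hb; rewrite !mem_iota -xa -yb => /andP[-> _] /andP[-> _].
split=> //; apply: allpairs_f; rewrite mem_iota; move: E; rewrite -!mulnn; nia.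
Qed.

Lemma uniq_pos_two_squares r : uniq (pos_two_squares r).
Proof.
apply: filter_uniq; apply: allpairs_uniq; rewrite ?iota_uniq //.
by move=> [a b] [a' b'] _ _ [] /= -> ->.
Qed.

Lemma size_primitive_two_squares r :
  (size [seq p <- pos_two_squares r | coprime p.1 p.2] <= size (divisors r))%N.
Proof.
set s := [seq p <- _ | _].
case Es: s => [//|[x0 y0] s']; rewrite -Es.
have memP x y : (x, y) \in s -> [/\ coprime x y, 0 < x, 0 < y & x ^ 2 + y ^ 2 = r]%N.
  by rewrite mem_filter mem_pos_two_squares /= => /and4P[? ? ? /eqP].
have [c0 px0 py0 E0] : [/\ coprime x0 y0, 0 < x0, 0 < y0 & x0 ^ 2 + y0 ^ 2 = r]%N.
  by apply: memP; rewrite Es mem_head.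
have r0 : (0 < r)%N by rewrite -E0 -!mulnn; nia.
pose f (p : nat * nat) := gcdn (p.1 * y0 + x0 * p.2) r.
rewrite -(size_map f); apply: uniq_leq_size; last first.
  by move=> q /mapP[p _ ->]; rewrite -dvdn_divisors // dvdn_gcdr.
rewrite map_inj_in_uniq; first by apply: filter_uniq; apply: uniq_pos_two_squares.
move=> [x y] [x' y'] /memP[c px py E] /memP[c' px' py' E']; rewrite /f /= => e.
exact: primitive_two_squares_inj e.
Qed.

Lemma size_divisors_dvd (d n : nat) : (0 < n)%N -> (d %| n)%N ->
  (size (divisors d) <= size (divisors n))%N.
Proof.
move=> n0 dn; apply: uniq_leq_size; first exact: divisors_uniq.
by move=> e; rewrite -!dvdn_divisors // ?(dvdn_gt0 n0) // => /dvdn_trans; apply.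
Qed.

(* Dividing by the gcd reduces to primitive pairs, one divisor e with e^2 | r at a time. *)
Lemma size_pos_two_squares r : (0 < r)%N ->
  (size (pos_two_squares r) <= size (divisors r) ^ 2)%N.
Proof.
move=> r0.
pose t := [seq (e, p) | e <- divisors r,
   p <- if (e ^ 2 %| r)%N then [seq p <- pos_two_squares (r %/ e ^ 2) | coprime p.1 p.2] else [::]].
pose f (q : nat * (nat * nat)) := (q.1 * q.2.1, q.1 * q.2.2)%N.
apply: (@leq_trans (size (map f t))).
  apply: uniq_leq_size; first exact: uniq_pos_two_squares.
  case=> x y; rewrite mem_pos_two_squares => /and3P[x0 y0 /eqP E].
  set e := gcdn x y; have e0 : (0 < e)%N by rewrite gcdn_gt0 x0.
  have [x' Ex] := dvdnP (dvdn_gcdl x y); have [y' Ey] := dvdnP (dvdn_gcdr x y).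
  rewrite -/e in Ex Ey.
  have Er : (r = (x' ^ 2 + y' ^ 2) * e ^ 2)%N by rewrite -E Ex Ey mulnDl !expnMn.
  have e2r : (e ^ 2 %| r)%N by rewrite Er dvdn_mull.
  apply/mapP; exists (e, (x', y')); last by rewrite /f /= !(mulnC e) -Ex -Ey.
  apply/allpairsPdep; exists e, (x', y'); split=> //.
    by rewrite -dvdn_divisors //; apply: dvdn_trans e2r; rewrite -mulnn dvdn_mulr.
  rewrite e2r mem_filter mem_pos_two_squares /= Er mulnK ?expn_gt0 ?e0 // eqxx andbT.
  apply/and3P; split; last by move: y0; rewrite Ey muln_gt0 => /andP[].
    by rewrite /coprime -(eqn_pmul2r e0) muln_gcdl -Ex -Ey mul1n.
  by move: x0; rewrite Ex muln_gt0 => /andP[].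
rewrite size_map size_allpairs_dep -mulnn -[X in (X * _)%N]count_predT -sum1_count big_distrl /=.
rewrite sumnE big_map big_seq [X in (_ <= X)%N]big_seq; apply: leq_sum => e ed; rewrite mul1n.
case: ifP => // e2r; apply: leq_trans (size_primitive_two_squares _) _.
apply: size_divisors_dvd => //; exact: dvdn_div.
Qed.

Definition two_squares_abscissae (L r : nat) : seq int :=
  [seq v <- zball L | has (fun w => v ^+ 2 + w ^+ 2 == r%:Z) (zball L)].

(** The factor 2 accounts for signs; the three extra values are 0 and, when r is a square, its two
    roots. *)
Lemma size_two_squares_abscissae L r : (0 < r)%N ->
  (size (two_squares_abscissae L r) <= 2 * size (divisors r) ^ 2 + 3)%N.
Proof.
move=> r0; set S := two_squares_abscissae L r.
(* A square root of r if there is one in the list, and the default 0 otherwise. *)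
pose v0 : int := nth 0 [seq v <- S | v ^+ 2 == r%:Z] 0.
pose P := pos_two_squares r.
pose t := [seq p.1%:Z | p <- P] ++ [seq - p.1%:Z | p <- P] ++ [:: 0; v0; - v0].
apply: (@leq_trans (size t)); last first.
  rewrite /t !size_cat !size_map /=; have := size_pos_two_squares r0; rewrite -/P.
  lia.
apply: uniq_leq_size; first by apply: filter_uniq; apply: zball_uniq.
move=> v vS; move: (vS); rewrite mem_filter => /andP[/hasP[w _ /eqP E] _].
rewrite !mem_cat.
have [->|v_0] := eqVneq v 0; first by rewrite !inE eqxx !orbT.
have [w_0|w_0] := eqVneq w 0.
  have Ev : v ^+ 2 = r%:Z by rewrite -E w_0 expr0n addr0.
  have : v0 ^+ 2 == r%:Z.
    have : v \in [seq v <- S | v ^+ 2 == r%:Z] by rewrite mem_filter vS Ev eqxx.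
    rewrite /v0; case Es: [seq _ <- _ | _] => [//|a s] _ /=.
    have : a \in [seq v <- S | v ^+ 2 == r%:Z] by rewrite Es mem_head.
    by rewrite mem_filter => /andP[].
  by rewrite -Ev eqf_sqr !inE => /orP[] /eqP ->; rewrite ?opprK eqxx !orbT.
have : (absz v, absz w) \in P.
  rewrite mem_pos_two_squares !absz_gt0 v_0 w_0 /= -eqz_nat PoszD.
  by rewrite !expnS !expn0 !muln1 !PoszM !abszE -!expr2 !real_normK ?num_real // E.
move=> vP; case: (leP 0 v) => v0'.
  by apply/orP; left; apply/mapP; exists (absz v, absz w) => //=; lia.
by apply/orP; right; apply/orP; left; apply/mapP; exists (absz v, absz w) => //=; lia.
Qed.

(** * The divisor bound *)

Lemma size_add_divisors p e s : size (PrimeDecompAux.add_divisors (p, e) s) = (e.+1 * size s)%N.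
Proof.
rewrite /PrimeDecompAux.add_divisors; elim: e => [|e IH] /=; first by rewrite mul1n.
by rewrite size_merge size_cat size_map IH mulSn addnC.
Qed.

Lemma size_divisors n : size (divisors n) = (\prod_(f <- prime_decomp n) f.2.+1)%N.
Proof.
rewrite /divisors; elim: (prime_decomp n) => [|[p e] s IH]; first by rewrite big_nil.
by rewrite big_cons -IH; exact: size_add_divisors.
Qed.

(** From e^(-1/6) >= 5/6 one gets e <= (6/5)^6 < 3. This makes ln lambda > 1, hence ln ln lambda >
    0, on the whole range lambda >= 3. *)
Lemma expR1_lt3 (R : realType) : expR 1 < 3 :> R.
Proof.
have H : expR (6^-1) <= 6 / 5 :> R.
  have := expR_ge1Dx (- 6^-1 : R); rewrite expRN => h.
  have e0 := expR_gt0 (6^-1 : R).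
  have : (1 - 6^-1) * expR (6^-1) <= 1 :> R by rewrite -ler_pdivlMr // div1r.
  lra.
have -> : 1 = 6%:R * 6^-1 :> R by field.
rewrite expRM_natl; apply: (@le_lt_trans _ _ ((6 / 5) ^+ 6)); last by lra.
by rewrite lerXn2r ?nnegrE ?expR_ge0 ?divr_ge0.
Qed.

Section DivisorBound.
Variables (R : realType) (l : R).
Hypothesis l1 : 1 < l.

Let lnl0 : 0 < ln l. Proof. exact: ln_gt0. Qed.
Let l0 : 0 < l. Proof. exact: lt_trans ltr01 l1. Qed.

(** The threshold between small and large primes will be s^2 = sqrt l; the fourth root itself serves
    to bound ln l = 4 ln s by 4 s. *)
Let s := Num.sqrt (Num.sqrt l).
Let s1 : 1 <= s. Proof. by rewrite -sqrtr1 ler_sqrt // -sqrtr1 ler_sqrt // ltW. Qed.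
Let s4 : s ^+ 4 = l. 
Proof. by rewrite (exprM s 2 2) !sqr_sqrtr ?sqrtr_ge0 // ltW. Qed.
Let lns : ln l <= 4 * s.
Proof.
have s0 : 0 < s by exact: lt_le_trans ltr01 s1.
have [l1' s1' lnl0'] := And3 l1 s1 lnl0.
by rewrite -s4 lnXn // -[ln s *+ 4]mulr_natl ler_wpM2l // ltW // ln_sublinear.
Qed.

Let sqrt_ln_le : s ^+ 2 * ln (5 * l) <= 32 * (l / ln l).
Proof.
have s0 : 0 < s by exact: lt_le_trans ltr01 s1.
have [l1' s1' lnl0'] := And3 l1 s1 lnl0.
have H5 : ln (5 * l) <= 8 * s.
  rewrite lnM ?posrE //; have : ln 5 <= 4 :> R by have := le_ln1Dx (_ : -1 < 4 :> R); rewrite (_ : 1 + 4 = 5); [apply; lra|ring].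
  have := lns; lra.
rewrite mulrA ler_pdivlMr // -[X in _ <= _ * X]s4.
apply: (@le_trans _ _ (s ^+ 2 * (8 * s) * (4 * s))); last by rewrite le_eqVlt; apply/orP; left; apply/eqP; ring.
apply: ler_pM => //; last by rewrite ler_wpM2l // exprn_ge0 // ltW.
  by rewrite mulr_ge0 ?exprn_ge0 ?ltW // ln_gt0 //; lra.
exact: ltW.
Qed.

(** Wigert's argument on the product of the e + 1. If p >= sqrt l, then e + 1 <= 2^e <= p^(2e / ln
    l), and these factors contribute at most exp((2 / ln l) ln r) <= exp(4 l / ln l). If p < sqrt l,
    then e <= 4l, so e + 1 <= 5l; there are at most sqrt l such primes, contributing exp(32 l / ln
    l) by [sqrt_ln_le]. Together 36 = 4 + 32. *)
Lemma divisor_bound (r : nat) : (0 < r)%N -> ln r%:R <= 2 * l ->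
  (size (divisors r))%:R <= expR (36 * (l / ln l)).
Proof.
move=> r0 rl; rewrite size_divisors natr_prod.
have s0 : 0 < s by exact: lt_le_trans ltr01 s1.
have [l1' s1' lnl0'] := And3 l1 s1 lnl0.
have lnT : ln (s ^+ 2) = ln l / 2 by rewrite -s4 !lnXn // -[ln s *+ 4]mulr_natl -[ln s *+ 2]mulr_natl; field.
pose small (p : nat) := p%:R < s ^+ 2.
pose F (f : nat * nat) : R := f.2%:R * ln f.1%:R.
apply: (@le_trans _ _ (\prod_(f <- prime_decomp r)
    (expR (2 / ln l * F f) * (5 * l) ^+ small f.1))).
  rewrite big_seq [X in _ <= X]big_seq; apply: ler_prod => -[p e] /mem_prime_decomp[pp e0 per].
  rewrite ler0n /=.
  have p2 : (2 : R) <= p%:R by rewrite ler_nat prime_gt1.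
  have ln2 : ln 2 <= 1 :> R by have := le_ln1Dx (_ : -1 < 1 :> R); rewrite (_ : 1 + 1 = 2); [apply; lra|ring].
  have ln2' : 1 / 2 <= ln 2 :> R.
    have := le_ln1Dx (_ : -1 < - 2^-1 :> R); rewrite (_ : 1 - 2^-1 = 2^-1); last by field.
    rewrite lnV ?posrE // => /(_ _); have : -1 < - 2^-1 :> R by lra.
    by move=> h /(_ h); lra.
  have lnp : ln 2 <= ln p%:R :> R by rewrite ler_ln ?posrE ?ltr0n ?prime_gt0.
  have e2 : e.+1%:R <= 2 ^+ e :> R.
    by rewrite -natrX ler_nat; apply: ltn_expl.
  have E2 : 2 ^+ e = expR (e%:R * ln 2) :> R by rewrite expRM_natl lnK ?posrE.
  have Fl : e%:R * ln p%:R <= 2 * l :> R.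
    rewrite mulr_natl -lnXn ?ltr0n ?prime_gt0 // -natrX; apply: le_trans rl.
    have pe0 : (0 < p ^ e)%N by rewrite expn_gt0 prime_gt0.
    have pe : (p ^ e <= r)%N by apply: dvdn_leq.
    by rewrite ler_ln ?posrE ?ltr0n // ler_nat.
  have k0 : 0 <= 2 / ln l by rewrite divr_ge0 // ltW.
  have e0' : 0 <= e%:R :> R by [].
  case sp : (small p); rewrite /= ?expr1 ?expr0 ?mulr1.
    have H1 : 1 <= expR (2 / ln l * F (p, e)).
      by rewrite -expR0 ler_expR mulr_ge0 // mulr_ge0 //; lra.
    have : e.+1%:R <= 5 * l.
      rewrite -natr1; have : e%:R * (1 / 2) <= 2 * l by apply: le_trans Fl; rewrite ler_wpM2l //; lra.
      lra.
    by move/le_trans; apply; rewrite ler_peMl //; lra.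
  apply: le_trans e2 _; rewrite E2 ler_expR.
  have lnTp : ln l / 2 <= ln p%:R :> R.
    by rewrite -lnT ler_ln ?posrE ?exprn_gt0 ?ltr0n ?prime_gt0 // leNgt; apply/negP; rewrite -/(small p) sp.
  rewrite /F /= mulrCA ler_wpM2l //; apply: le_trans ln2 _.
  rewrite mulrAC ler_pdivlMr // mul1r; lra.
rewrite big_split /= -expR_sum -mulr_sumr -expr_sum.
have FE : \sum_(f <- prime_decomp r) F f = ln r%:R.
  apply: expR_inj; rewrite lnK ?posrE ?ltr0n // expR_sum [in RHS](prod_prime_decomp r0) natr_prod.
  rewrite big_seq [RHS]big_seq; apply: eq_bigr => -[p e] /mem_prime_decomp[pp e0 per].
  by rewrite /F /= expRM_natl lnK ?natrX // posrE ltr0n prime_gt0.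
have smallE : (\sum_(f <- prime_decomp r) small f.1)%:R <= s ^+ 2.
  have -> : (\sum_(f <- prime_decomp r) small f.1)%N = size [seq p <- primes r | small p].
    by rewrite size_filter -sum1_count big_map [RHS]big_mkcond; apply: eq_bigr => f _; case: small.
  apply: (@le_trans _ _ (Num.truncn (s ^+ 2))%:R); last by rewrite truncn_le ?exprn_ge0 // ltW.
  rewrite ler_nat -[X in (_ <= X)%N](size_iota 1); apply: uniq_leq_size.
    by apply: filter_uniq; apply: primes_uniq.
  move=> p; rewrite mem_filter mem_primes => /andP[sp /andP[pp _]].
  rewrite mem_iota prime_gt0 //= add1n ltnS truncn_ge_nat ?exprn_ge0 //; exact: ltW.
rewrite FE.
apply: (@le_trans _ _ (expR (2 / ln l * (2 * l)) * expR (s ^+ 2 * ln (5 * l)))).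
  apply: ler_pM; rewrite ?expR_ge0 ?exprn_ge0 //.
  - by lra.
  - by rewrite ler_expR ler_wpM2l // divr_ge0 // ltW.
  have -> : 5 * l = expR (ln (5 * l)) by rewrite lnK // posrE; lra.
  rewrite -expRM_natl ler_expR expRK ler_wpM2r // ln_ge0 //; lra.
rewrite -expRD ler_expR.
have -> : 36 * (l / ln l) = 2 / ln l * (2 * l) + 32 * (l / ln l).
  by field; rewrite gt_eqF.
by rewrite lerD2l.
Qed.
End DivisorBound.

Lemma ln_ge3_gt1 (R : realType) (x : R) : 3 <= x -> 1 < ln x.
Proof.
move=> x3; rewrite -ltr_expR lnK ?posrE; last by lra.
exact: lt_le_trans (expR1_lt3 R) x3.
Qed.

(** Here l = ln lambda, so r <= lambda^2 gives ln r <= 2l. With t divisors the count is at most 2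
    t^2 + 3 <= 5 t^2, and 5 <= e^2 <= exp(2 l / ln l); hence 74 = 2 + 2 * 36. *)
Lemma two_squares_abscissae_bound (R : realType) (lambda : R) (L r n : nat) :
  3 <= lambda -> lambda ^+ 2 = n%:R -> (r <= n)%N ->
  (size (two_squares_abscissae L r))%:R <= expR (74 * ln lambda / ln (ln lambda)).
Proof.
move=> l3 ln2 rn.
have l1 := ln_ge3_gt1 l3; set l := ln lambda in l1 *.
have lnl0 : 0 < ln l by apply: ln_gt0.
have l_lnl : 1 <= l / ln l by rewrite ler_pdivlMr // mul1r ltW // ln_sublinear //; lra.
have e5 : 5 <= expR (2 * (l / ln l)).
  apply: (@le_trans _ _ (expR 2)); last by rewrite ler_expR; lra.
  have -> : 2 = 4%:R * 2^-1 :> R by field.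
  rewrite expRM_natl; apply: (@le_trans _ _ ((3 / 2) ^+ 4)); first by lra.
  rewrite lerXn2r ?nnegrE ?expR_ge0 ?divr_ge0 //.
  by apply: le_trans (expR_ge1Dx _); lra.
(* The divisor count says nothing for r = 0, where the circle is a single point. *)
have [r0|r0] := posnP r.
  apply: (@le_trans _ _ 1).
    rewrite r0 lern1; apply: (@leq_trans (size [:: 0 : int])) => //; apply: uniq_leq_size.
      by apply: filter_uniq; apply: zball_uniq.
    move=> v; rewrite mem_filter mem_seq1 => /andP[/hasP[w _ /eqP E] _].
    have := sqr_ge0 v; have := sqr_ge0 w => w2 v2.
    have : v ^+ 2 = 0 by lia.
    by move/eqP; rewrite sqrf_eq0.
  rewrite -expR0 ler_expR divr_ge0 ?mulr_ge0 //; lra.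
have lnr : ln r%:R <= 2 * l.
  rewrite mulr_natl -lnXn; last by lra.
  by rewrite ln2 ler_ln ?posrE ?ltr0n ?ler_nat // (leq_trans r0).
have := divisor_bound l1 r0 lnr; set t := size (divisors r) => tE.
have t1 : (1 <= t)%N.
  by rewrite /t lt0n size_eq0; apply: contraTneq (divisors_id r0) => ->.
apply: (@le_trans _ _ (5 * t%:R ^+ 2)).
  rewrite -natrX -natrM ler_nat; apply: leq_trans (size_two_squares_abscissae L r0) _.
  by rewrite -/t; nia.
have -> : 74 * l / ln l = 2 * (l / ln l) + 2%:R * (36 * (l / ln l)).
  by field; rewrite gt_eqF.
rewrite expRD (expRM_natl 2 (36 * _)); apply: ler_pM => //.
by rewrite lerXn2r ?nnegrE ?expR_ge0.
Qed.

(** * Moments on lattice spheres *)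

Section Monomials.
Variables (R : realType) (d L : nat).
Local Notation K := {ffun 'I_d -> 'I_(L.*2.+1)}.

Definition freq (k : K) (j : 'I_d) : R := (zcoord (k j))%:~R.

Definition monomial (k : K) (alpha : 'I_d -> nat) : R := \prod_(j < d) freq k j ^+ alpha j.

Definition moment (E : {set K}) (b : K -> R) (alpha : 'I_d -> nat) : R :=
  \sum_(k in E) b k * monomial k alpha.

Lemma eq_monomial k alpha beta : alpha =1 beta -> monomial k alpha = monomial k beta.
Proof. by move=> e; apply: eq_bigr => j _; rewrite e. Qed.

Lemma eq_moment E b alpha beta : alpha =1 beta -> moment E b alpha = moment E b beta.
Proof. by move=> e; apply: eq_bigr => k _; rewrite (eq_monomial k e). Qed.

Lemma moment_horner E b (p : 'I_d -> {poly R}) (N : nat) :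
  (forall alpha, (\sum_j alpha j <= N)%N -> moment E b alpha = 0) ->
  (\sum_j (size (p j)).-1 <= N)%N ->
  \sum_(k in E) b k * \prod_j (p j).[freq k j] = 0.
Proof.
(* A common bound M on the sizes lets all the p_j be expanded over one index type; multi-indices
   beyond the degree of some p_j get the coefficient 0. *)
move=> bE pN; pose M := \max_j size (p j).
have -> : \sum_(k in E) b k * \prod_j (p j).[freq k j] =
    \sum_(a : {ffun 'I_d -> 'I_M}) (\prod_j (p j)`_(a j)) * moment E b (fun j => a j).
  under [RHS]eq_bigr do rewrite /moment mulr_sumr.
  rewrite exchange_big /=; apply: eq_bigr => k _.
  under [in LHS]eq_bigr => j _ do rewrite (@horner_coef_wide _ M) ?leq_bigmax //.
  rewrite bigA_distr_bigA /= mulr_sumr; apply: eq_bigr => a _.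
  by rewrite big_split /= mulrCA.
apply: big1 => a _.
have [/forallP aP|] := boolP [forall j, a j < size (p j)]%N.
  rewrite bE ?mulr0 //; apply: leq_trans pN; apply: leq_sum => j _.
  by rewrite -ltnS; apply: leq_trans (aP j) _; rewrite leqSpred.
rewrite negb_forall => /existsP[j]; rewrite -leqNgt => aj.
by rewrite (bigD1 j) //= nth_default // !mul0r.
Qed.

Lemma moment_isolate E b (p : 'I_d -> {poly R}) (N : nat) k0 :
  (forall alpha, (\sum_j alpha j <= N)%N -> moment E b alpha = 0) ->
  (\sum_j (size (p j)).-1 <= N)%N ->
  k0 \in E ->
  (forall j, (p j).[freq k0 j] != 0) ->
  (forall k, k \in E -> k != k0 -> exists j, (p j).[freq k j] = 0) ->
  b k0 = 0.
Proof.
move=> bE pN k0E p0 pk; have := moment_horner bE pN.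
rewrite (bigD1 k0) //= [X in _ + X]big1 ?addr0; last first.
  by move=> k /andP[kE kk]; have [j pj] := pk k kE kk; rewrite (bigD1 j) //= pj mul0r mulr0.
by move/eqP; rewrite mulf_eq0 => /orP[/eqP//|/prodf_eq0[j _]]; rewrite (negPf (p0 j)).
Qed.

(** The numerator of the Lagrange interpolation polynomial at the node x of s. *)
Definition avoid_poly (s : seq int) (x : int) : {poly R} :=
  \prod_(l <- rem x s) ('X - (l%:~R)%:P).

Lemma size_avoid_poly s x : (size (avoid_poly s x)).-1 = size (rem x s).
Proof. by rewrite /avoid_poly size_prod_XsubC. Qed.

Lemma avoid_poly_root (s : seq int) x y : y \in s -> y != x -> (avoid_poly s x).[y%:~R] = 0.
Proof.
move=> ys yx; rewrite /avoid_poly horner_prod (big_rem y) /=; last exact: rem_mem.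
by rewrite hornerXsubC subrr mul0r.
Qed.

Lemma avoid_poly_neq0 (s : seq int) x : uniq s -> (avoid_poly s x).[x%:~R] != 0.
Proof.
move=> us; rewrite /avoid_poly horner_prod prodf_seq_neq0; apply/allP => y.
rewrite mem_rem_uniq // inE => /andP[yx _].
by rewrite hornerXsubC subr_eq0 eqr_int eq_sym.
Qed.
End Monomials.

Section Moments.
Variables (R : realType) (d L : nat).
Local Notation K := {ffun 'I_d -> 'I_(L.*2.+1)}.

Lemma freq_zball (k : K) j : zcoord (k j) \in zball L.
Proof. by rewrite mem_zball zcoord_le. Qed.

(** This is what makes a wave sum with a nonzero coefficient a nonzero function. *)
Lemma moments_eq0 (E : {set K}) (b : K -> R) :
  (forall alpha, moment E b alpha = 0) -> forall k, k \in E -> b k = 0.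
Proof.
move=> bE k0 k0E; pose p j := avoid_poly R (zball L) (zcoord (k0 j)).
apply: (moment_isolate (p := p) (N := \sum_j (size (p j)).-1) (E := E)) => //.
  by move=> j; apply: avoid_poly_neq0; apply: zball_uniq.
move=> k kE kk; have /existsP[j jP] : [exists j, k j != k0 j].
  rewrite -negb_forall; apply: contra kk => /forallP e.
  by apply/eqP/ffunP => j; apply/eqP.
exists j; apply: avoid_poly_root; first exact: freq_zball.
by apply: contra jP => /eqP e; apply/eqP/(can_inj (@zcoordK L)).
Qed.
End Moments.

(* The first e coordinates are separated by products of degree 2L; for fixed values of
   these the last two lie on a circle, where it suffices to separate the abscissae and,
   by one more linear factor, the two signs of the ordinate. *)
Lemma moments_eq0_le (R : realType) (e L n N : nat) (b : {ffun 'I_e.+2 -> 'I_(L.*2.+1)} -> R) :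
  (forall r, (r <= n)%N -> (2 * e * L + size (two_squares_abscissae L r) <= N)%N) ->
  (forall alpha, (\sum_j alpha j <= N)%N -> moment (lattice_sphere e.+2 L n) b alpha = 0) ->
  forall k, k \in lattice_sphere e.+2 L n -> b k = 0.
Proof.
move=> NP bE k0 k0E; set E := lattice_sphere _ _ _ in bE k0E.
pose x0 : 'I_e.+2 := inord e; pose y0 : 'I_e.+2 := ord_max.
have x0E : x0 = e :> nat by rewrite /x0 inordK.
have neqxy : x0 != y0 by apply/eqP => /(congr1 val) /=; rewrite x0E; lia.
pose z (k : {ffun 'I_e.+2 -> 'I_(L.*2.+1)}) j := zcoord (k j).
pose s k := (\sum_(j < e.+2 | (j < e)%N) absz (z k j) ^ 2)%N.
have sumE (F : 'I_e.+2 -> nat) :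
    (\sum_j F j = \sum_(j < e.+2 | (j < e)%N) F j + (F x0 + F y0))%N.
  rewrite (bigID (fun j : 'I_e.+2 => (j < e)%N)) /=; congr (_ + _)%N.
  rewrite (bigD1 x0) ?x0E ?ltnn //= (bigD1 y0) /=; last first.
    by rewrite -leqNgt leqnSn eq_sym neqxy.
  rewrite big1 ?addn0 // => j /andP[/andP[je jx] jy].
  case/negP: jy; apply/eqP/val_inj => /=; have := ltn_ord j.
  have : j != e :> nat by apply: contra jx => /eqP je'; apply/eqP/val_inj; rewrite /= x0E.
  by lia.
have sn k : k \in E -> z k x0 ^+ 2 + z k y0 ^+ 2 = (n - s k)%N%:Z /\ (s k <= n)%N.
  rewrite inE sumE => /eqP <-; rewrite -/(s k) leq_addr addKn PoszD !sqr_absz.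
  by split.
set r := (n - s k0)%N; pose V := two_squares_abscissae L r.
(* The last factor separates the ordinate of k0 from its negative; if that ordinate is 0, nothing is
   left to separate. *)
pose p (j : 'I_e.+2) : {poly R} :=
  if (j < e)%N then avoid_poly R (zball L) (z k0 j) else
  if j == x0 then avoid_poly R V (z k0 x0) else
  if z k0 y0 == 0 then 1 else 'X + ((z k0 y0)%:~R)%:P.
have memV k : k \in E -> s k = s k0 -> z k x0 \in V.
  move=> kE sk; rewrite mem_filter freq_zball andbT; apply/hasP; exists (z k y0).
    exact: freq_zball.
  by have [-> _] := sn k kE; rewrite sk.
apply: (moment_isolate (p := p) (N := N) bE) => //.
(* Degree count: e factors of degree 2L, one of degree |V| - 1, and at most one linear factor. *)
- apply: leq_trans (NP r (leq_subr _ _)); rewrite sumE -/V.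
  have -> : (\sum_(j < e.+2 | (j < e)%N) (size (p j)).-1 = \sum_(j < e.+2 | (j < e)%N) L.*2)%N.
    apply: eq_bigr => j je; rewrite /p je size_avoid_poly size_rem ?freq_zball //.
    by rewrite size_map size_iota.
  have -> : (\sum_(j < e.+2 | (j < e)%N) L.*2 = 2 * e * L)%N.
    have := sumE (fun=> 1%N); rewrite sum_nat_const card_ord muln1 => E1.
    have -> : (\sum_(j < e.+2 | (j < e)%N) L.*2 = (\sum_(j < e.+2 | (j < e)%N) 1) * L.*2)%N.
      by rewrite big_distrl /=; apply: eq_bigr => j _; rewrite mul1n.
    by move: E1; rewrite addnA !addn1 => -[<-]; lia.
  rewrite leq_add2l /p x0E ltnn eqxx ltnNge leqnSn /= eq_sym (negPf neqxy).
  have kV : z k0 x0 \in V by apply: memV.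
  rewrite size_avoid_poly size_rem //.
  have V0 : (0 < size V)%N by case: (V) kV.
  case: ifP => _; first by rewrite size_poly1 addn0 leq_pred.
  by rewrite size_XaddC addn1 prednK.
- move=> j; rewrite /p; case: ifP => je; first by apply: avoid_poly_neq0; apply: zball_uniq.
  case: (j =P x0) => [->|jx].
    by apply: avoid_poly_neq0; apply: filter_uniq; apply: zball_uniq.
  have jy : j = y0.
    apply/val_inj => /=; have := ltn_ord j.
    have : j != e :> nat by apply/eqP => je'; apply: jx; apply/val_inj; rewrite /= x0E.
    by lia.
  case: ifP => [_|z0]; first by rewrite hornerE oner_neq0.
  rewrite jy !hornerE /freq -/(z k0 y0) -mulr2n mulrn_eq0 /=.
  by rewrite (eqr_int R _ 0) z0.
move=> k kE kk.
have [/existsP[j /andP[je kj]]|] := boolP [exists j : 'I_e.+2, (j < e)%N && (z k j != z k0 j)].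
  by exists j; rewrite /p je; apply: avoid_poly_root => //; apply: freq_zball.
rewrite negb_exists => /forallP small_eq.
have {}small_eq (j : 'I_e.+2) : (j < e)%N -> z k j = z k0 j.
  by move=> je; have := small_eq j; rewrite je negbK => /eqP.
have sk : s k = s k0 by apply: eq_bigr => j je; rewrite small_eq.
have kV := memV k kE sk.
have [kx|kx] := eqVneq (z k x0) (z k0 x0); last first.
  by exists x0; rewrite /p x0E ltnn eqxx; apply: avoid_poly_root.
have ky : z k y0 = - z k0 y0 /\ z k0 y0 != 0.
  have ky : z k y0 != z k0 y0.
    apply: contra kk => /eqP ky; apply/eqP/ffunP => j; apply: (can_inj (@zcoordK L)).
    rewrite -/(z k j) -/(z k0 j).
    have [je|je] := ltnP j e; first exact: small_eq.
    have [->//|jx] := eqVneq j x0.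
    have -> // : j = y0; apply/val_inj => /=; have := ltn_ord j.
    have : j != e :> nat by apply: contra jx => /eqP je'; apply/eqP/val_inj; rewrite /= x0E.
    by lia.
  have [E1 _] := sn k kE; have [E2 _] := sn k0 k0E.
  have : z k y0 ^+ 2 = z k0 y0 ^+ 2.
    by apply: (addrI (z k x0 ^+ 2)); rewrite E1 sk -E2 kx.
  move/eqP; rewrite eqf_sqr (negPf ky) /= => /eqP ky'; split=> //.
  by apply: contra ky => /eqP z0; rewrite ky' z0 oppr0.
have [ky1 ky2] := ky.
exists y0; rewrite /p ltnNge leqnSn /= eq_sym (negPf neqxy) (negPf ky2) !hornerE /freq -/(z k y0) ky1.
by rewrite mulrNz addNr.
Qed.

(** A homogeneous linear system with more unknowns than equations. The equations are those with last
    exponent 0 or 1, whence the factor 2, and with each other exponent at most N. *)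
Lemma exists_moments_eq0 (R : realType) (d L n N : nat) :
  (2 * N.+1 ^ d < #|lattice_sphere d.+1 L n|)%N ->
  exists2 c : {ffun 'I_d.+1 -> 'I_(L.*2.+1)} -> R,
    (exists2 k, k \in lattice_sphere d.+1 L n & c k != 0) &
    forall alpha, (\sum_j alpha j <= N)%N -> moment (lattice_sphere d.+1 L n) c alpha = 0.
Proof.
set E := lattice_sphere _ _ _ => NE.
pose T : finType := ({ffun 'I_d -> 'I_N.+1} * bool)%type.
pose al (t : T) (j : 'I_d.+1) : nat := if unlift ord_max j is Some i then t.1 i else t.2.
pose A : 'M[R]_(#|E|, #|T|) := \matrix_(i, t) monomial R (enum_val i) (al (enum_val t)).
have [v v0 vA] : exists2 v : 'rV[R]_#|E|, v != 0 & v *m A = 0.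
  have : kermx A != 0.
    rewrite kermx_eq0; apply: contraL NE => /eqP rA; rewrite -leqNgt -/E -rA.
    apply: leq_trans (rank_leq_col A) _.
    by rewrite card_prod card_ffun !card_ord card_bool mulnC.
  by move/rowV0Pn => [v /sub_kermxP vA v0]; exists v.
have /existsP[iv vi] : [exists i, v 0 i != 0].
  rewrite -negb_forall; apply: contra v0 => /forallP vi; apply/eqP/rowP => i.
  by rewrite mxE; apply/eqP.
pose c k : R := if pick [pred i | enum_val i == k] is Some i then v 0 i else 0.
have cE j : c (enum_val j) = v 0 j.
  rewrite /c; case: pickP => [j' /= /eqP /enum_val_inj -> //|/(_ j)]; by rewrite /= eqxx.
exists c; first by exists (enum_val iv); rewrite ?cE ?enum_valP.
have base (t : T) : moment E c (al t) = 0.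
  have /rowP/(_ (enum_rank t)) := vA; rewrite !mxE => <-.
  rewrite /moment big_enum_val /=; apply: eq_bigr => j _.
  by rewrite mxE enum_rankK cE.
suff H m alpha : (alpha ord_max <= m)%N -> (\sum_j alpha j <= N)%N -> moment E c alpha = 0.
  by move=> alpha; apply: (H (alpha ord_max)).
elim/ltn_ind: m alpha => m IH alpha am aN.
have aN' j : (alpha j <= N)%N by apply: leq_trans aN; rewrite (bigD1 j) //= leq_addr.
have [a1|a1] := leqP (alpha ord_max) 1.
  rewrite -(base ([ffun j => inord (alpha (lift ord_max j))], alpha ord_max == 1%N)).
  apply: eq_moment => j; rewrite /al; case: unliftP => [i0 ->|->] /=.
    by rewrite ffunE inordK // ltnS.
  by case: (alpha ord_max) a1 => [|[|]].
(* Trading the square of the last coordinate for n minus the other squares turns alpha into beta, of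
   degree two less, and the gamma i, of the same degree as alpha. So the reduction stays within
   degree N while the last exponent drops. *)
pose beta j := if j == ord_max then (alpha j - 2)%N else alpha j.
pose gamma (i : 'I_d) j := if j == lift ord_max i then (beta j + 2)%N else beta j.
have bmax : beta ord_max = (alpha ord_max - 2)%N by rewrite /beta eqxx.
have liftN i : (lift ord_max i == ord_max :> 'I_d.+1) = false.
  by apply/negP => /eqP e; have := neq_lift (ord_max : 'I_d.+1) i; rewrite e eqxx.
have bsum : (\sum_j beta j + 2 = \sum_j alpha j)%N.
  rewrite (bigD1 ord_max) //= [RHS](bigD1 ord_max) //= bmax.
  rewrite (eq_bigr alpha) => [|j /negPf jm]; last by rewrite /beta jm.
  by rewrite addnAC subnK.
have gsum i : (\sum_j gamma i j = \sum_j beta j + 2)%N.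
  rewrite (bigD1 (lift ord_max i)) //= [in RHS](bigD1 (lift ord_max i)) //= {1}/gamma eqxx.
  rewrite (eq_bigr beta) => [|j /negPf jm]; last by rewrite /gamma jm.
  by rewrite addnAC.
have gmax i : gamma i ord_max = beta ord_max by rewrite /gamma eq_sym liftN.
have Hb : moment E c beta = 0 by apply: (IH (m - 2)%N); [lia|rewrite bmax; lia|lia].
have Hg i : moment E c (gamma i) = 0.
  by apply: (IH (m - 2)%N); [lia|rewrite gmax bmax; lia|rewrite gsum; lia].
have mshift (k : {ffun 'I_d.+1 -> 'I_(L.*2.+1)}) (a a' : 'I_d.+1 -> nat) j0 : a' j0 = (a j0 + 2)%N -> (forall j, j != j0 -> a' j = a j) ->
    monomial R k a' = freq R k j0 ^+ 2 * monomial R k a.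
  move=> e1 e2; rewrite /monomial (bigD1 j0) //= [in RHS](bigD1 j0) //= e1 mulrA -exprD addnC.
  by congr (_ * _); apply: eq_bigr => j /e2 ->.
have -> : moment E c alpha = n%:R * moment E c beta - \sum_(i < d) moment E c (gamma i).
  rewrite exchange_big /= mulr_sumr -sumrB; apply: eq_bigr => k kE.
  rewrite -mulr_sumr mulrCA -mulrBr; congr (_ * _).
  rewrite (mshift k beta alpha ord_max); first last.
  - by move=> j /negPf jm; rewrite /beta jm.
  - by rewrite bmax; lia.
  under eq_bigr => i _.
    rewrite (mshift k beta (gamma i) (lift ord_max i)); first last.
    - by move=> j /negPf jm; rewrite /gamma jm.
    - by rewrite /gamma eqxx.
    over.
  rewrite -mulr_suml -mulrBl; congr (_ * _).
  have : \sum_j freq R k j ^+ 2 = n%:R.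
    move: kE; rewrite inE => /eqP <-; rewrite natr_sum; apply: eq_bigr => j _.
    by rewrite /freq -rmorphXn /= -sqr_absz.
  rewrite big_ord_recr /= => <-.
  rewrite (eq_bigr (fun i => freq R k (lift ord_max i) ^+ 2)) => [|j _].
    by rewrite addrAC subrr add0r.
  by congr (freq R k _ ^+ 2); apply/val_inj; rewrite /= /bump leqNgt ltn_ord.
by rewrite Hb mulr0 big1 ?subrr.
Qed.

(* The even combination of k, -k, l, -l with coefficients 1, 1, -1, -1. *)
Lemma exists_moments_eq0_1 (R : realType) (d L n : nat) :
  (2 < #|lattice_sphere d L n|)%N ->
  exists2 c : {ffun 'I_d -> 'I_(L.*2.+1)} -> R,
    (exists2 k, k \in lattice_sphere d L n & c k != 0) &
    forall alpha, (\sum_j alpha j <= 1)%N -> moment (lattice_sphere d L n) c alpha = 0.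
Proof.
set E := lattice_sphere _ _ _ => E2.
pose op (k : {ffun 'I_d -> 'I_(L.*2.+1)}) : {ffun 'I_d -> 'I_(L.*2.+1)} :=
  [ffun j => zord L (- zcoord (k j))].
have zop k j : zcoord (op k j) = - zcoord (k j).
  by rewrite ffunE zordK // abszN zcoord_le.
have opE k : k \in E -> op k \in E.
  by rewrite !inE => /eqP <-; apply/eqP/eq_bigr => j _; rewrite zop abszN.
have op2 k : op (op k) = k.
  by apply/ffunP => j; apply: (can_inj (@zcoordK L)); rewrite !zop opprK.
have /card_gt0P[k1 k1E] : (0 < #|E|)%N by lia.
have [k2 k2E] : exists2 k2, k2 \in E & k2 \notin [set k1; op k1]%SET.
  apply/exists_inP; rewrite -[[exists _ in _, _]]negbK negb_exists_in.
  apply/negP => /forall_inP H.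
  suff : (#|E| <= 2)%N by lia.
  apply: (@leq_trans #|[set k1; op k1]%SET|); last by rewrite cards2; case: (_ != _).
  by apply/subset_leq_card/fintype.subsetP => k /H; rewrite negbK.
rewrite !inE negb_or => /andP[k21 k2o1].
have monop k alpha : monomial R (op k) alpha = (-1) ^+ (\sum_j alpha j) * monomial R k alpha.
  rewrite /monomial -prodrXr -big_split /=; apply: eq_bigr => j _.
  rewrite /freq zop mulrNz; exact: exprNn.
pose c k : R := (k == k1)%:R + (k == op k1)%:R - (k == k2)%:R - (k == op k2)%:R.
exists c.
  exists k1 => //; rewrite /c eqxx (eq_sym k1 k2) (negPf k21).
  have -> : (k1 == op k2) = false.
    by apply/negP => /eqP e; move: k2o1; rewrite e op2 eqxx.
  by rewrite !subr0 -natrD pnatr_eq0.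
have pick a (f : _ -> R) : a \in E -> \sum_(k in E) (k == a)%:R * f k = f a.
  move=> aE; rewrite (bigD1 a) //= eqxx mul1r big1 ?addr0 // => k /andP[_ /negPf ->].
  by rewrite mul0r.
move=> alpha a1.
have -> : moment E c alpha = monomial R k1 alpha + monomial R (op k1) alpha
    - monomial R k2 alpha - monomial R (op k2) alpha.
  rewrite -(pick k1 (fun k => monomial R k alpha)) // -(pick (op k1) (fun k => monomial R k alpha)) ?opE // -(pick k2 (fun k => monomial R k alpha)) // -(pick (op k2) (fun k => monomial R k alpha)) ?opE //.
  rewrite -big_split -!sumrB /=; apply: eq_bigr => k _.
  by rewrite /c; ring.
rewrite !monop; have [a0|a0] := posnP (\sum_j alpha j)%N; last first.
  have -> : (\sum_j alpha j = 1)%N by lia.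
  by ring.
have m1 k : monomial R k alpha = 1.
  apply: big1 => j _; have -> : alpha j = 0%N; last by rewrite expr0.
  by apply/eqP; rewrite -leqn0 -a0 (bigD1 j) //= leq_addr.
by rewrite a0 !m1; ring.
Qed.

(** * Trigonometric sums and their derivatives *)

Section RealDerivatives.
Local Open Scope classical_set_scope.
Variables (R : realType) (d : nat).
Implicit Types (f g : 'rV[R]_d -> R) (x v : 'rV[R]_d) (i : 'I_d).

Definition real_partial i f : 'rV[R]_d -> R := fun x => 'D_(basis_vec i) f x.

Definition real_smooth f : Prop := forall s : seq 'I_d,
  continuous (foldr real_partial f s) /\
  forall i x, derivable (foldr real_partial f s) x (basis_vec i).

Lemma derive_lineE f x v : 'D_v f x = 'D_1 (fun h : R => f (h *: v + x)) 0.
Proof.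
rewrite /derive; congr (lim (_ @ 0^')); apply/funext => h /=.
by rewrite addr0 scale0r add0r -[h *: 1]/(h * 1) mulr1.
Qed.

Lemma is_derive_line f x v (a : R) :
  is_derive (0 : R) (1 : R) (fun h : R => f (h *: v + x)) a -> is_derive x v f a.
Proof.
move=> [h1 h2]; split; first exact/derivable1P.
by rewrite derive_lineE.
Qed.

(** This is sqrt 2 cos(t - pi/4). Differentiation shifts it by pi/2, so a product of such functions
    stays of the same shape when [phi] records the number of quarter-period shifts in each
    coordinate. *)
Definition cas (t : R) : R := cos t + sin t.

Lemma casDpihalf t : cas (t + pi / 2) = cos t - sin t.
Proof. by rewrite /cas cosDpihalf sinDpihalf addrC. Qed.

Global Instance is_derive_cas t : is_derive (t : R) (1 : R) cas (cas (t + pi / 2)).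
Proof. by rewrite casDpihalf addrC; rewrite /cas; apply: is_deriveD. Qed.

Definition wave (w : 'I_d -> R) (phi : 'I_d -> nat) : 'rV[R]_d -> R :=
  fun x => \prod_j cas (w j * x 0 j + (phi j)%:R * (pi / 2)).

Definition incr (phi : 'I_d -> nat) i : 'I_d -> nat := fun j => (phi j + (j == i))%N.

Lemma is_derive_wave w phi i x :
  is_derive x (basis_vec i) (wave w phi) (w i * wave w (incr phi i) x).
Proof.
apply: is_derive_line.
pose P := \prod_(j | j != i) cas (w j * x 0 j + (phi j)%:R * (pi / 2)).
pose t0 := w i * x 0 i + (phi i)%:R * (pi / 2).
have -> : (fun h : R => wave w phi (h *: basis_vec i + x)) = (fun h => P * cas (w i * h + t0)).
  apply/funext => h; rewrite /wave (bigD1 i) //= mulrC; congr (_ * _); rewrite ?/P.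
    by apply: eq_bigr => j ji; rewrite !mxE (negPf ji) mulr0 add0r.
  by rewrite !mxE !eqxx mulr1 mulrDr addrA.
have -> : w i * wave w (incr phi i) x = P * (w i * cas (w i * 0 + t0 + pi / 2)).
  rewrite [RHS]mulrCA [in RHS](mulrC P) /wave (bigD1 i) //=; congr (w i * (_ * _)); last first.
    by apply: eq_bigr => j /negPf ji; rewrite /incr ji addn0.
  rewrite /incr eqxx mulr0 add0r /t0 addn1 -natr1 mulrDl mul1r.
  by rewrite addrA.
have H : is_derive (0 : R) (1 : R) (fun h => cas (w i * h + t0)) (w i * cas (w i * 0 + t0 + pi / 2)).
  rewrite mulrC.
  apply: (@is_derive1_comp _ cas (fun h => w i * h + t0)).
  have -> : (fun h => w i * h + t0) = (w i *: id + cst t0) by [].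
  apply: is_derive_eq.
  by rewrite addr0 -[w i *: 1]/(w i * 1) mulr1.
have := is_deriveZ P H; exact.
Qed.

Lemma continuous_sumr (I : Type) (r : seq I) (P : pred I) (F : I -> 'rV[R]_d -> R) :
  (forall a, P a -> continuous (F a)) -> continuous (fun x => \sum_(a <- r | P a) F a x).
Proof.
move=> cF; elim: r => [|a r IH].
  have -> : (fun x => \sum_(a <- [::] | P a) F a x) = cst 0 by apply/funext => x; rewrite big_nil.
  exact: cst_continuous.
have -> : (fun x => \sum_(b <- a :: r | P b) F b x) =
    (fun x => if P a then F a x + \sum_(b <- r | P b) F b x else \sum_(b <- r | P b) F b x).
  by apply/funext => x; rewrite big_cons.
case Pa: (P a) => // x.
exact: (cvgD (cF a Pa x) (IH x)).
Qed.

Lemma continuous_prodr (I : Type) (r : seq I) (P : pred I) (F : I -> 'rV[R]_d -> R) :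
  (forall a, P a -> continuous (F a)) -> continuous (fun x => \prod_(a <- r | P a) F a x).
Proof.
move=> cF; elim: r => [|a r IH].
  have -> : (fun x => \prod_(a <- [::] | P a) F a x) = cst 1 by apply/funext => x; rewrite big_nil.
  exact: cst_continuous.
have -> : (fun x => \prod_(b <- a :: r | P b) F b x) =
    (fun x => if P a then F a x * \prod_(b <- r | P b) F b x else \prod_(b <- r | P b) F b x).
  by apply/funext => x; rewrite big_cons.
case Pa: (P a) => // x.
exact: (cvgM (cF a Pa x) (IH x)).
Qed.

Lemma continuous_cas : continuous cas.
Proof. by move=> t; apply: (cvgD (@continuous_cos _ t) (@continuous_sin _ t)). Qed.

Lemma continuous_wave w phi : continuous (wave w phi).
Proof.
apply: continuous_prodr => j _ x.
apply: (@continuous_comp _ _ _ (fun x : 'rV[R]_d => w j * x 0 j + (phi j)%:R * (pi / 2)) cas).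
  exact: (cvgD (cvgM (cvg_cst (w j)) (@coord_continuous _ _ _ 0 j x)) (cvg_cst _)).
exact: continuous_cas.
Qed.

Lemma is_derive_sumr (I : Type) (r : seq I) (P : pred I) (F : I -> 'rV[R]_d -> R) (D : I -> R) x v :
  (forall a, P a -> is_derive x v (F a) (D a)) ->
  is_derive x v (fun y => \sum_(a <- r | P a) F a y) (\sum_(a <- r | P a) D a).
Proof.
move=> FD; elim: r => [|a r IH].
  have -> : (fun x => \sum_(a <- [::] | P a) F a x) = cst 0 by apply/funext => y; rewrite big_nil.
  by rewrite big_nil; apply: is_derive_cst.
have -> : (fun x => \sum_(b <- a :: r | P b) F b x) =
    (fun x => if P a then F a x + \sum_(b <- r | P b) F b x else \sum_(b <- r | P b) F b x).
  by apply/funext => y; rewrite big_cons.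
rewrite big_cons; case Pa: (P a) => //.
by apply: is_deriveD => //; apply: FD.
Qed.
End RealDerivatives.

(** * Finite sums of waves over a set of lattice points *)

Section WaveSums.
Local Open Scope classical_set_scope.
Variables (R : realType) (d L : nat) (E : {set {ffun 'I_d -> 'I_(L.*2.+1)}}).
Implicit Types (c : {ffun 'I_d -> 'I_(L.*2.+1)} -> R) (phi : 'I_d -> nat) (i : 'I_d).

Definition wave_sum c phi : 'rV[R]_d -> R :=
  fun x => \sum_(k in E) c k * wave (freq R k) phi x.

Lemma is_derive_wave_sum c phi i x : is_derive x (basis_vec i) (wave_sum c phi)
  (wave_sum (fun k => c k * freq R k i) (incr phi i) x).
Proof.
apply: is_derive_sumr => k _; rewrite -mulrA.
by apply: is_deriveZ; apply: is_derive_wave.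
Qed.

Lemma real_partial_wave_sum c phi i :
  real_partial i (wave_sum c phi) = wave_sum (fun k => c k * freq R k i) (incr phi i).
Proof. by apply/funext => x; apply: derive_val; apply: is_derive_wave_sum. Qed.

Lemma foldr_real_partial_wave_sum c phi s : exists c' phi',
  foldr (@real_partial R d) (wave_sum c phi) s = wave_sum c' phi'.
Proof.
elim: s => [|i s [c' [phi' IH]]] /=; first by exists c, phi.
by rewrite IH real_partial_wave_sum; do 2!eexists.
Qed.

Lemma continuous_wave_sum c phi : continuous (wave_sum c phi).
Proof.
apply: continuous_sumr => k _ x.
exact: (cvgM (cvg_cst (c k)) (@continuous_wave _ _ _ _ x)).
Qed.

Lemma real_smooth_wave_sum c phi : real_smooth (wave_sum c phi).
Proof.
move=> s; have [c' [phi' ->]] := foldr_real_partial_wave_sum c phi s.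
split; first exact: continuous_wave_sum.
by move=> i x; apply: ex_derive; apply: is_derive_wave_sum.
Qed.

Definition multi_real_partial (alpha : 'I_d -> nat) (f : 'rV[R]_d -> R) : 'rV[R]_d -> R :=
  foldr (fun i w => iter (alpha i) (real_partial i) w) f (enum 'I_d).

Lemma multi_real_partial_wave_sum c alpha :
  multi_real_partial alpha (wave_sum c (fun=> 0%N)) =
  wave_sum (fun k => c k * monomial R k alpha) alpha.
Proof.
have iterE n i c' phi : iter n (real_partial i) (wave_sum c' phi) =
    wave_sum (fun k => c' k * freq R k i ^+ n) (fun j => (phi j + n * (j == i))%N).
  elim: n => [|n IH] /=.
    congr wave_sum; first by apply/funext => k; rewrite mulr1.
    by apply/funext => j; rewrite addn0.
  rewrite IH real_partial_wave_sum; congr wave_sum.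
    by apply/funext => k; rewrite exprSr mulrA.
  by apply/funext => j; rewrite /incr mulSn; lia.
have H s : foldr (fun i w => iter (alpha i) (real_partial i) w) (wave_sum c (fun=> 0%N)) s =
   wave_sum (fun k => c k * \prod_(i <- s) freq R k i ^+ alpha i)
            (fun j => \sum_(i <- s) alpha i * (j == i))%N.
  elim: s => [|i s IH] /=.
    congr wave_sum; first by apply/funext => k; rewrite big_nil mulr1.
    by apply/funext => j; rewrite big_nil.
  rewrite IH iterE; congr wave_sum.
    by apply/funext => k; rewrite big_cons mulrAC mulrA.
  by apply/funext => j; rewrite big_cons addnC.
rewrite /multi_real_partial H; congr wave_sum.
  by apply/funext => k; rewrite /monomial big_enum.
apply/funext => j; rewrite big_enum (bigD1 j) //= eqxx muln1 big1 ?addn0 //.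
by move=> i /negPf ij; rewrite eq_sym ij muln0.
Qed.

(** The difference cos - sin is carried along because a shift by pi/2 exchanges it with cas up to
    sign. *)
Lemma cas_sqr_mulpihalf n : cas (n%:R * (pi / 2) : R) ^+ 2 = 1.
Proof.
suff : cas (n%:R * (pi / 2) : R) ^+ 2 = 1 /\ (cos (n%:R * (pi / 2)) - sin (n%:R * (pi / 2)) : R) ^+ 2 = 1.
  by case.
elim: n => [|n [IH1 IH2]]; first by rewrite mul0r /cas cos0 sin0 addr0 subr0 expr1n.
rewrite -natr1 mulrDl mul1r casDpihalf IH2 cosDpihalf sinDpihalf; split=> //.
by rewrite -opprD sqrrN addrC.
Qed.

Lemma wave0_neq0 (w : 'I_d -> R) phi : wave w phi 0 != 0.
Proof.
apply/prodf_neq0 => j _; rewrite mxE mulr0 add0r.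
by rewrite -sqrf_eq0 cas_sqr_mulpihalf oner_neq0.
Qed.

(** At the origin the frequencies disappear: all waves with phases alpha take one common nonzero
    value, which factors out. *)
Lemma multi_real_partial_wave_sum0 c alpha : 
  (multi_real_partial alpha (wave_sum c (fun=> 0%N)) 0 == 0) = (moment E c alpha == 0).
Proof.
rewrite multi_real_partial_wave_sum /wave_sum.
under eq_bigr => k _.
  have -> : wave (freq R k) alpha 0 = wave (fun=> 0) alpha 0.
    by apply: eq_bigr => j _; rewrite mxE !mulr0.
  over.
by rewrite -mulr_suml mulf_eq0 (negPf (wave0_neq0 _ _)) orbF.
Qed.

Lemma trig_periodic (t : R) (z : int) :
  sin (t + z%:~R * (2 * pi)) = sin t /\ cos (t + z%:~R * (2 * pi)) = cos t.
Proof.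
have per (s : R) (n : nat) :
    sin (s + n%:R * (2 * pi)) = sin s /\ cos (s + n%:R * (2 * pi)) = cos s.
  have -> : n%:R * (2 * pi) = pi *+ 2 *+ n :> R by rewrite !mulr_natl.
  by rewrite (periodicn (@cosD2pi R)) (periodicn (@sinD2pi R)).
case: z => n; first exact: per.
have [<- <-] := per (t + (Negz n)%:~R * (2 * pi)) n.+1.
by rewrite NegzE mulrNz mulNr -pmulrn subrK.
Qed.

Lemma cas_periodic (t : R) (z : int) : cas (t + z%:~R * (2 * pi)) = cas t.
Proof. by rewrite /cas; have [-> ->] := trig_periodic t z. Qed.

Lemma wave_sum_periodic c phi i x :
  wave_sum c phi (x + (2 * pi) *: basis_vec i) = wave_sum c phi x.
Proof.
apply: eq_bigr => k _; congr (_ * _); apply: eq_bigr => j _.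
rewrite !mxE eqxx /=; case: eqP => _; last by rewrite mulr0 addr0.
rewrite mulr1 mulrDr addrAC; set t := _ + _.
exact: cas_periodic.
Qed.
End WaveSums.

Lemma sum_real_partial2_wave_sum (R : realType) (d L n : nat) c x :
  \sum_(i < d) real_partial i (real_partial i (wave_sum (lattice_sphere d L n) c (fun=> 0%N))) x
  = - n%:R * wave_sum (lattice_sphere d L n) c (fun=> 0%N) x :> R.
Proof.
under eq_bigr do rewrite !real_partial_wave_sum.
rewrite /wave_sum exchange_big mulr_sumr /=; apply: eq_bigr => k.
rewrite inE => /eqP <-; rewrite natr_sum -sumrN mulr_suml; apply: eq_bigr => i _.
have -> : ((absz (zcoord (k i)) ^ 2)%:R : R) = freq R k i ^+ 2.
  by rewrite /freq -rmorphXn /= -sqr_absz.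
have -> : wave (freq R k) (incr (incr (fun=> 0%N) i) i) x = - wave (freq R k) (fun=> 0%N) x.
  rewrite /wave (bigD1 i) //= [in RHS](bigD1 i) //= -mulNr; congr (_ * _); last first.
    by apply: eq_bigr => j /negPf ji; rewrite /incr ji.
  rewrite /incr eqxx mul0r addr0 (_ : (0 + 1 + 1)%N%:R * (pi / 2) = pi); last by field.
  by rewrite /cas cosDpi sinDpi opprD.
by ring.
Qed.

(** * Fourier series in one variable *)

Section PeriodIntegral.
Local Open Scope classical_set_scope.
Variable R : realType.
Implicit Types (f g : R -> R).
Local Notation mu := (@lebesgue_measure R).

Definition period_int f : R := \int[mu]_(t in `[0, 2 * pi]) f t.

Let pi2_gt0 : 0 < 2 * pi :> R. Proof. by rewrite mulr_gt0 ?pi_gt0. Qed.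

Lemma period_integrable f : continuous f -> mu.-integrable `[0, 2 * pi] (EFin \o f).
Proof.
move=> cf; apply: continuous_compact_integrable; first exact: segment_compact.
exact: continuous_subspaceT.
Qed.

Lemma period_intD f g : continuous f -> continuous g ->
  period_int (fun t => f t + g t) = period_int f + period_int g.
Proof. by move=> cf cg; apply: RintegralD; rewrite //; exact: period_integrable. Qed.

Lemma period_intZ a f : continuous f -> period_int (fun t => a * f t) = a * period_int f.
Proof. by move=> cf; apply: RintegralZl; rewrite //; exact: period_integrable. Qed.

Lemma period_int_cst a : period_int (fun=> a) = 2 * pi * a.
Proof.
rewrite /period_int Rintegral_cst //= lebesgue_measure_itv /= lte_fin pi2_gt0 /=.
by rewrite oppr0 addr0 mulrC.
Qed.

Lemma le_period_int f g : continuous f -> continuous g ->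
  (forall t, f t <= g t) -> period_int f <= period_int g.
Proof. by move=> cf cg fg; apply: le_Rintegral; rewrite //; exact: period_integrable. Qed.

Lemma normr_period_int f M : continuous f -> (forall t, `|f t| <= M) ->
  `|period_int f| <= 2 * pi * M.
Proof.
move=> cf fM; have cc (a : R) : continuous (fun _ : R => a) by exact: cst_continuous.
rewrite ler_norml -mulrN -!period_int_cst.
by apply/andP; split; apply: le_period_int; rewrite //; move=> t; have := fM t; rewrite ler_norml => /andP[].
Qed.

Lemma period_int_derive f g : (forall t : R, is_derive t (1 : R) f (g t)) -> continuous g ->
  period_int g = f (2 * pi) - f 0.
Proof.
move=> fg cg; have cf : continuous f.
  by move=> t; apply/differentiable_continuous/derivable1_diffP; apply: ex_derive.
rewrite /period_int /Rintegral (continuous_FTC2 pi2_gt0 (F := f)) //.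
- exact: continuous_subspaceT.
- split; first by move=> t _; apply: ex_derive.
  + by apply: cvg_at_right_filter; apply: cf.
  + by apply: cvg_at_left_filter; apply: cf.
- by move=> t _; rewrite derive1E; apply: derive_val.
Qed.
End PeriodIntegral.

(** * Orthogonality and completeness of the functions cas(k t) *)

Section CasFourier.
Local Open Scope classical_set_scope.
Variable R : realType.
Implicit Types (f g : R -> R) (k l : int) (t : R).

Definition casz k t : R := cas (k%:~R * t).

Lemma continuous_affine (w c : R) : continuous (fun t : R => w * t + c).
Proof. by move=> t; exact: (cvgD (cvgM (cvg_cst w) cvg_id) (cvg_cst c)). Qed.

Lemma continuous_compR f g : continuous f -> continuous g -> continuous (fun t => g (f t)).
Proof. by move=> cf cg t; apply: (@continuous_comp _ _ _ f g); [apply: cf|apply: cg]. Qed.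

Lemma continuous_mulR f g : continuous f -> continuous g -> continuous (fun t => f t * g t).
Proof. by move=> cf cg t; exact: (cvgM (cf t) (cg t)). Qed.

Lemma continuous_addR f g : continuous f -> continuous g -> continuous (fun t => f t + g t).
Proof. by move=> cf cg t; exact: (cvgD (cf t) (cg t)). Qed.

Lemma continuous_casz k : continuous (casz k).
Proof.
have -> : casz k = (fun t => cas (k%:~R * t + 0)) by apply/funext => t; rewrite addr0.
by apply: continuous_compR; [exact: continuous_affine|exact: continuous_cas].
Qed.

Lemma is_derive_comp_affine f (df : R -> R) w c t :
  (forall s : R, is_derive s (1 : R) f (df s)) ->
  is_derive t (1 : R) (fun s => f (w * s + c)) (w * df (w * t + c)).
Proof.
move=> fd; rewrite mulrC.
apply: (@is_derive1_comp _ f (fun s => w * s + c)).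
have -> : (fun s => w * s + c) = (w *: id + cst c) by [].
apply: is_derive_eq.
by rewrite addr0 -[w *: 1]/(w * 1) mulr1.
Qed.

Lemma cas_mul (a b : R) : cas a * cas b = cos (a - b) + sin (a + b).
Proof. by rewrite /cas cosB sinD; ring. Qed.

Lemma norm_cas_le2 (a : R) : `|cas a| <= 2.
Proof.
by apply: le_trans (ler_normD _ _) _; have := cos_max a; have := sin_max a; lra.
Qed.

Lemma period_int_casz k l :
  period_int (fun t => casz k t * casz l t) = if k == l then 2 * pi else 0.
Proof.
pose m : R := (k - l)%:~R; pose p : R := (k + l)%:~R.
have -> : (fun t => casz k t * casz l t) = (fun t => cos (m * t + 0) + sin (p * t + 0)).
  by apply/funext => t; rewrite /casz cas_mul !addr0 -mulrBl -mulrDl -intrB -intrD.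
pose F t := m^-1 * sin (m * t + 0) - p^-1 * cos (p * t + 0).
have FG t : is_derive t (1 : R) F (m^-1 * (m * cos (m * t + 0)) - p^-1 * (p * - sin (p * t + 0))).
  apply: is_deriveB; apply: is_deriveZ; apply: is_derive_comp_affine.
have E z t : sin (z%:~R * (2 * pi) + t) = sin t /\ cos (z%:~R * (2 * pi) + t) = cos t.
  by rewrite addrC; apply: trig_periodic.
have F0 : F (2 * pi) - F 0 = 0.
  by rewrite /F (E (k - l) 0).1 (E (k + l) 0).2 !mulr0 !addr0 subrr.
(* For p = 0 both sides vanish, since 0^-1 = 0; the primitive of sin(p t) thus needs no case
   distinction on k + l. *)
have sinp t : p^-1 * (p * - sin (p * t + 0)) = - sin (p * t + 0).
  have [->|p0] := eqVneq p 0; first by rewrite !mul0r mulr0 addr0 sin0 oppr0.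
  by rewrite mulrA mulVf // mul1r.
have cG (w c : R) : continuous (fun t => sin (w * t + c)) /\ continuous (fun t => cos (w * t + c)).
  by split; apply: continuous_compR; [exact: continuous_affine|exact: continuous_sin
    |exact: continuous_affine|exact: continuous_cos].
case: eqP => [kl|/eqP kl].
  have m0 : m = 0 by rewrite /m kl subrr.
  pose H t := t - p^-1 * cos (p * t + 0).
  have HG t : is_derive t (1 : R) H (cos (m * t + 0) + sin (p * t + 0)).
    rewrite m0 mul0r add0r cos0 -[sin _]opprK -sinp.
    exact: (is_deriveB (is_derive_id t (1 : R))
      (is_deriveZ p^-1 (is_derive_comp_affine p 0 t (@is_derive_cos R)))).
  have cGp : continuous (fun t => cos (m * t + 0) + sin (p * t + 0)).
    by apply: continuous_addR; [exact: (cG m 0).2|exact: (cG p 0).1].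
  transitivity (H (2 * pi) - H 0); first exact: (period_int_derive HG cGp).
  by rewrite /H (E (k + l) 0).2 mulr0 addr0; ring.
have HF t : is_derive t (1 : R) F (cos (m * t + 0) + sin (p * t + 0)).
   rewrite -[sin _]opprK -sinp.
  have -> : cos (m * t + 0) = m^-1 * (m * cos (m * t + 0)); last exact: FG.
  by rewrite mulrA mulVf ?mul1r // intr_eq0 subr_eq0.
have cGp : continuous (fun t => cos (m * t + 0) + sin (p * t + 0)).
  by apply: continuous_addR; [exact: (cG m 0).2|exact: (cG p 0).1].
by rewrite -[RHS]F0; exact: (period_int_derive HF cGp).
Qed.

(** Two integrations by parts at once: the primitive [G] collects both boundary terms, and
    periodicity gives it the same value at both ends. *)
Lemma period_int_casz_derive2 f f' f'' k :
  (forall t, is_derive t (1 : R) f (f' t)) -> (forall t, is_derive t (1 : R) f' (f'' t)) ->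
  continuous f'' -> f (2 * pi) = f 0 -> f' (2 * pi) = f' 0 ->
  period_int (fun t => f'' t * casz k t) = - k%:~R ^+ 2 * period_int (fun t => f t * casz k t).
Proof.
move=> ff' ff'' cf'' f0 f'0.
have cf : continuous f.
  by move=> t; apply/differentiable_continuous/derivable1_diffP; apply: ex_derive.
set w : R := k%:~R.
pose G t := f' t * cas (w * t + 0) - f t * (w * cas (w * t + pi / 2)).
have GG t : is_derive t (1 : R) G (f'' t * casz k t + w ^+ 2 * (f t * casz k t)).
  have D1 := is_deriveM (ff'' t) (is_derive_comp_affine w 0 t (@is_derive_cas R)).
  have D2 := is_deriveM (ff' t) (is_deriveZ w (is_derive_comp_affine w (pi / 2) t (@is_derive_cas R))).
  refine (is_derive_eq (is_deriveB D1 D2) _).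
  rewrite /casz -/w.
  have -> : cas (w * t + pi / 2 + pi / 2) = - cas (w * t).
    by rewrite (_ : w * t + pi / 2 + pi / 2 = w * t + pi) /cas ?cosDpi ?sinDpi ?opprD //; field.
  by rewrite addr0 /GRing.scale /= /GRing.scale /=; ring.
have cg1 : continuous (fun t => f'' t * casz k t).
  by apply: continuous_mulR => //; exact: continuous_casz.
have cg2 : continuous (fun t => f t * casz k t).
  by apply: continuous_mulR => //; exact: continuous_casz.
have cg3 : continuous (fun t => w ^+ 2 * (f t * casz k t)).
  by apply: continuous_mulR => //; exact: cst_continuous.
have := period_int_derive GG (continuous_addR cg1 cg3).
rewrite (period_intD cg1 cg3) (period_intZ _ cg2).
have E c : cas (w * (2 * pi) + c) = cas (w * 0 + c).
  by rewrite addrC cas_periodic mulr0 add0r.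
by rewrite /G f0 f'0 !E subrr mulNr => /eqP; rewrite addr_eq0 => /eqP.
Qed.

(** Multiplication by cos(t - t0) stays in the span of the family, so orthogonality to the family
    survives multiplication by powers of the kernel. *)
Lemma cos_mul_casz t0 k t : cos (t - t0) * casz k t =
  cos t0 / 2 * casz (k + 1) t + cos t0 / 2 * casz (k - 1) t +
  (sin t0 / 2 * casz (1 - k) t - sin t0 / 2 * casz (- 1 - k) t).
Proof.
rewrite /casz !intrD !mulrDl !mulrNz !mulNr !mul1r /cas cosB !cosD !sinD !cosN !sinN.
by field.
Qed.

Definition kernel t0 t : R := 1 + cos (t - t0).

Lemma continuous_kernelX t0 N : continuous (fun t => kernel t0 t ^+ N).
Proof.
have cK : continuous (kernel t0).
  apply: continuous_addR; first exact: cst_continuous.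
  have -> : (fun t => cos (t - t0)) = (fun t => cos (1 * t + - t0)) by apply/funext => t; rewrite mul1r.
  by apply: continuous_compR; [exact: continuous_affine|exact: continuous_cos].
elim: N => [|N IH].
  by under eq_fun do rewrite expr0; exact: cst_continuous.
by under eq_fun do rewrite exprS; exact: continuous_mulR.
Qed.

Lemma period_int_kernel_orthogonal f t0 N : continuous f ->
  (forall k, period_int (fun t => f t * casz k t) = 0) ->
  forall k, period_int (fun t => f t * kernel t0 t ^+ N * casz k t) = 0.
Proof.
move=> cf f0; elim: N => [|N IH] k.
  by under [X in period_int X]eq_fun do rewrite expr0 mulr1.
pose F l t := f t * kernel t0 t ^+ N * casz l t.
have cF l : continuous (F l).
  apply: continuous_mulR; last exact: continuous_casz.
  by apply: continuous_mulR => //; exact: continuous_kernelX.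
have cZ a l : continuous (fun t => a * F l t).
  by apply: continuous_mulR => //; exact: cst_continuous.
have -> : (fun t => f t * kernel t0 t ^+ N.+1 * casz k t) =
  (fun t => F k t + ((cos t0 / 2 * F (k + 1) t + cos t0 / 2 * F (k - 1) t) +
    (sin t0 / 2 * F (1 - k) t + - (sin t0 / 2) * F (- 1 - k) t))).
  apply/funext => t; rewrite /F exprS.
  transitivity (f t * kernel t0 t ^+ N * (casz k t + cos (t - t0) * casz k t)).
    by rewrite {1}/kernel; ring.
  by rewrite cos_mul_casz; ring.
rewrite period_intD //; last by do 2?apply: continuous_addR; apply: cZ.
rewrite period_intD; try by apply: continuous_addR; apply: cZ.
rewrite !period_intD //; try exact: cZ.
by rewrite !period_intZ // !IH !mulr0 !addr0.
Qed.

(** Integrate the derivative of sin(t - t0) K^N over a period, using sin^2 = (2 - K) K. *)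
Lemma period_int_kernelS t0 N :
  N.+1%:R * period_int (fun t => kernel t0 t ^+ N.+1) =
  (2 * N%:R + 1) * period_int (fun t => kernel t0 t ^+ N).
Proof.
pose K t : R := 1 + cos (1 * t + - t0).
have KE : kernel t0 = K by apply/funext => t; rewrite /kernel /K mul1r.
have cK n : continuous (fun t => K t ^+ n) by rewrite -KE; exact: continuous_kernelX.
rewrite KE; pose G t := sin (1 * t + - t0) * K t ^+ N.
have DK t : is_derive t (1 : R) K (- sin (1 * t + - t0)).
  refine (is_derive_eq (is_deriveD (is_derive_cst (1 : R) t (1 : R))
    (is_derive_comp_affine 1 (- t0) t (@is_derive_cos R))) _).
  by rewrite add0r mul1r.
have DKN t : is_derive t (1 : R) (fun t => K t ^+ N) (N%:R * K t ^+ N.-1 * - sin (1 * t + - t0)).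
  have -> : (fun t => K t ^+ N) = K ^+ N by apply/funext => s; rewrite exprfctE.
  refine (is_derive_eq (is_deriveX N (DK t)) _).
  by rewrite /GRing.scale /=.
have GG t : is_derive t (1 : R) G (N.+1%:R * K t ^+ N.+1 + - (2 * N%:R + 1) * K t ^+ N).
  refine (is_derive_eq (is_deriveM (is_derive_comp_affine 1 (- t0) t (@is_derive_sin R)) (DKN t)) _).
  have sc : sin (1 * t + - t0) * sin (1 * t + - t0) = (2 - K t) * K t.
    by rewrite -expr2 sin2cos2 /K; ring.
  have -> : cos (1 * t + - t0) = K t - 1 by rewrite /K; ring.
  rewrite /GRing.scale /= exprS -[N.+1%:R]natr1.
  have -> : sin (1 * t + - t0) * (N%:R * K t ^+ N.-1 * - sin (1 * t + - t0)) =
    - (N%:R * K t ^+ N.-1 * ((2 - K t) * K t)) by rewrite -sc; ring.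
  by case: (N) => [|n]; rewrite /= ?exprS; ring.
have cZ a n : continuous (fun t => a * K t ^+ n).
  by apply: continuous_mulR => //; exact: cst_continuous.
have := period_int_derive GG (continuous_addR (cZ _ _) (cZ _ _)).
rewrite period_intD // !period_intZ // mulNr.
have -> : G (2 * pi) - G 0 = 0; last by move/eqP; rewrite subr_eq0 => /eqP.
have [E1 E2] := trig_periodic (1 * 0 + - t0) 1.
rewrite /G /K (_ : 1 * (2 * pi) + - t0 = 1 * 0 + - t0 + 1%:~R * (2 * pi)) ?E1 ?E2 ?subrr //.
by ring.
Qed.

Lemma period_int_kernel_gt0 t0 N : 0 < period_int (fun t => kernel t0 t ^+ N).
Proof.
elim: N => [|N IH].
  under [X in period_int X]eq_fun do rewrite expr0.
  by rewrite period_int_cst mulr1 mulr_gt0 ?pi_gt0.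
have := period_int_kernelS t0 N => E.
by rewrite -(pmulr_rgt0 _ (ltr0Sn R N)) E mulr_gt0.
Qed.

(** The ratio (2N + 1)/(N + 1) of consecutive integrals tends to 2. It eventually exceeds the
    midpoint r of q and 2, and r^N outgrows every multiple of q^N. *)
Lemma period_int_kernel_growth t0 q : 0 < q < 2 ->
  forall C, exists N, C * q ^+ N < period_int (fun t => kernel t0 t ^+ N).
Proof.
move=> /andP[q0 q2] C; pose J N := period_int (fun t => kernel t0 t ^+ N).
pose r := (q + 2) / 2.
have r_q : 1 < r / q by rewrite ltr_pdivlMr // mul1r /r; lra.
have [N0 N0P] : exists N0 : nat, forall n, (N0 <= n)%N -> r * J n <= J n.+1.
  exists (Num.truncn (2 / (2 - q))).+1 => n nN.
  have n2 : 2 / (2 - q) <= n%:R.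
    by apply: ltW; apply: lt_le_trans (truncnS_gt _) _; rewrite ler_nat.
  have J0 := period_int_kernel_gt0 t0 n; rewrite -/(J n) in J0.
  have E := period_int_kernelS t0 n; rewrite -/(J n) -/(J n.+1) in E.
  rewrite -(ler_pM2l (ltr0Sn R n)) E mulrA ler_pM2r // -natr1.
  have : 2 <= n%:R * (2 - q) by rewrite -ler_pdivrMr //; lra.
  by rewrite /r; lra.
have J0 := period_int_kernel_gt0 t0 N0; rewrite -/(J N0) in J0.
have Jm m : r ^+ m * J N0 <= J (N0 + m)%N.
  elim: m => [|m IH]; first by rewrite expr0 mul1r addn0.
  rewrite addnS exprS -mulrA; apply: le_trans (N0P _ (leq_addr _ _)).
  by rewrite ler_pM2l //; rewrite /r; lra.
pose B := C * q ^+ N0 / J N0.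
have [m mP] : exists m : nat, B < (r / q) ^+ m.
  exists (Num.truncn (`|B| / (r / q - 1))).+1.
  have H : `|B| < (Num.truncn (`|B| / (r / q - 1))).+1%:R * (r / q - 1).
    by rewrite -ltr_pdivrMr ?subr_gt0 // truncnS_gt.
  apply: le_lt_trans (ler_norm _) _; apply: lt_le_trans H _.
  have bern n (x : R) : 0 <= x -> n%:R * x <= (1 + x) ^+ n.
    move=> x0; elim: n => [|n IH]; first by rewrite mul0r.
    have h1 : 1 <= (1 + x) ^+ n by rewrite exprn_ege1 // lerDl.
    by rewrite exprS -natr1 mulrDl mul1r mulrDl mul1r lerD // ler_peMr.
  have := bern (Num.truncn (`|B| / (r / q - 1))).+1 (r / q - 1).
  by rewrite (addrC 1) subrK; apply; lra.
exists (N0 + m)%N; rewrite -/(J _); apply: lt_le_trans (Jm m).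
move: mP; rewrite /B ltr_pdivrMr // expr_div_n mulrAC ltr_pdivlMr ?exprn_gt0 //.
by rewrite exprD mulrA.
Qed.

(* Testing a function orthogonal to every cas(k t) against (1 + cos(t - t0))^N, which
   concentrates at t0, shows that it vanishes at t0. *)
Lemma cas_complete f : continuous f -> (forall t, f (t + 2 * pi) = f t) ->
  (exists M, forall t, `|f t| <= M) ->
  (forall k, period_int (fun t => f t * casz k t) = 0) -> forall t, f t = 0.
Proof.
wlog suff pos : f / forall t0, continuous f -> (forall t, f (t + 2 * pi) = f t) ->
    (exists M, forall t, `|f t| <= M) ->
    (forall k, period_int (fun t => f t * casz k t) = 0) -> ~ (0 < f t0).
  move=> cf pf [M fM] f0 t; apply/eqP; rewrite -[_ == _]negbK neq_lt; apply/negP => /orP[ft|ft].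
    apply: (pos (fun t => - f t) t).
    - by move=> s; exact: (cvgN (cf s)).
    - by move=> s; rewrite pf.
    - by exists M => s; rewrite normrN.
    - move=> k; have -> : (fun t => - f t * casz k t) = (fun t => -1 * (f t * casz k t)).
        by apply/funext => s; ring.
      rewrite period_intZ ?f0 ?mulr0 //; apply: continuous_mulR => //; exact: continuous_casz.
    by rewrite oppr_gt0.
  by apply: (pos f t) => //; exists M.
move=> t0 cf pf [M fM] f0 ft0; set a := f t0 in ft0.
have perz t (z : int) : f (t + z%:~R * (2 * pi)) = f t.
  have per (s : R) (n : nat) : f (s + n%:R * (2 * pi)) = f s.
    elim: n => [|n IH]; first by rewrite mul0r addr0.
    by rewrite -natr1 mulrDl mul1r addrA pf.
  case: z => n; first exact: per.
  by rewrite -[RHS](per _ 0%N) -(per (t + _) n.+1) NegzE mulrNz mulNr -pmulrn subrK mul0r addr0.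
have [delta [d0 d1 dP]] : exists delta : R, [/\ 0 < delta, delta <= 1 / 2 &
    forall t, `|t - t0| < delta -> a / 2 <= f t].
  have a2 : 0 < a / 2 by rewrite divr_gt0.
  have /cvgrPdist_lt/(_ (a / 2) a2)/nbhs_ballP[e /= e0 eP] := cf t0.
  exists (Num.min e (1 / 2)); split; rewrite ?lt_min ?ge_min ?e0 ?lexx ?orbT //=.
  move=> t; rewrite lt_min => /andP[te _].
  have := eP t; rewrite /ball /= distrC => /(_ te).
  by rewrite -/a ltr_norml => /andP[_]; lra.
have pih := pihalf_ge1 R.
(* The maximum of the kernel at distance at least delta from t0 modulo 2 pi. *)
pose q := 1 + cos delta.
have q02 : 0 < q < 2.
  have c0 : 0 < cos delta by apply: cos_gt0_pihalf; apply/andP; split; lra.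
  have c1 : cos delta < 1.
    by rewrite -(cos0 R) ltr_cos ?in_itv /=; [exact: d0|lra|lra].
  by apply/andP; split; rewrite /q; lra.
have K0 t : 0 <= kernel t0 t by rewrite /kernel; have := cos_geN1 (t - t0); lra.
have M0 : 0 <= M by apply: le_trans (fM 0).
(* Near t0 one has f >= a/2; elsewhere f >= -M and the kernel is at most q. One inequality covers
   both cases, and its integral becomes positive for large N. *)
have near_or t N : a / 2 * kernel t0 t ^+ N + - ((M + a / 2) * q ^+ N) <= f t * kernel t0 t ^+ N.
  have KN0 : 0 <= kernel t0 t ^+ N by rewrite exprn_ge0.
  have qN0 : 0 <= q ^+ N by rewrite exprn_ge0 //; lra.
  (* Subtracting the nearest multiple of 2 pi from t - t0 leaves s in [-pi, pi], where the cosine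
     decreases in |s|. *)
  pose z := - Num.floor ((t - t0) / (2 * pi) + 1 / 2); pose s := t - t0 + z%:~R * (2 * pi).
  have p0 := pi_gt0 R.
  have sP : `|s| <= pi.
    have /andP[h1 h2] := floor_itv ((t - t0) / (2 * pi) + 1 / 2).
    have E : s = ((t - t0) / (2 * pi) + z%:~R) * (2 * pi).
      by rewrite /s; move: (pi : R) p0 => P p0; field; rewrite gt_eqF.
    have E2 : (Num.floor ((t - t0) / (2 * pi) + 1 / 2))%:~R = - z%:~R :> R.
      by rewrite /z mulrNz opprK.
    have {h2} : (t - t0) / (2 * pi) + 1 / 2 < 1 - z%:~R by move: h2; rewrite intrD E2 [X in _ < X]addrC.
    move: h1; rewrite E2 E; move: ((t - t0) / (2 * pi)) (z%:~R : R) => y w h1 h2.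
    by rewrite ler_norml; apply/andP; split; nra.
  have Kz : kernel t0 t = 1 + cos `|s|.
    by rewrite cos_norm /s (trig_periodic _ z).2.
  have fz : f t = f (t0 + s).
    by rewrite -(perz t z); congr f; rewrite /s; ring.
  have [sd|sd] := ltP `|s| delta.
    have : a / 2 <= f t by rewrite fz; apply: dP; rewrite addrAC subrr add0r.
    move=> fa; have C0 : 0 <= (M + a / 2) * q ^+ N by rewrite mulr_ge0 //; lra.
    by have : 0 <= (f t - a / 2) * kernel t0 t ^+ N; [rewrite mulr_ge0 //; lra|lra].
  have Kq : kernel t0 t <= q.
    rewrite Kz lerD2l; move: sd; rewrite le_eqVlt => /predU1P[->//|sd].
    by apply: ltW; rewrite ltr_cos ?in_itv /= ?normr_ge0 ?sP //; lra.
  have KqN : kernel t0 t ^+ N <= q ^+ N by rewrite lerXn2r ?nnegrE //; lra.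
  have fM' : - M <= f t by have := fM t; rewrite ler_norml => /andP[].
  by nra.
have [N NP] := period_int_kernel_growth t0 q02 ((M + a / 2) * (2 * pi) / (a / 2)).
have cK := @continuous_kernelX t0 N.
have c1 : continuous (fun t => a / 2 * kernel t0 t ^+ N).
  by apply: continuous_mulR => //; exact: cst_continuous.
have c2 : continuous (fun _ : R => - ((M + a / 2) * q ^+ N)) by exact: cst_continuous.
have := le_period_int (continuous_addR c1 c2) (continuous_mulR cf cK) (fun t => near_or t N).
rewrite period_intD // period_intZ // period_int_cst.
have -> : period_int (fun t => f t * kernel t0 t ^+ N) = 0.
  have := period_int_kernel_orthogonal t0 N cf f0 0.
  by under [X in period_int X]eq_fun do rewrite /casz mul0r /cas cos0 sin0 addr0 mulr1.
apply/negP; rewrite -ltNge mulrN subr_gt0.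
by move: NP; rewrite mulrAC ltr_pdivrMr; [rewrite mulrC [X in _ < X]mulrC; lra|lra].
Qed.
End CasFourier.

(** * Fourier coefficients on the torus *)

Section TorusCoefficients.
Local Open Scope classical_set_scope.
Variables (R : realType) (d : nat).
Implicit Types (f g : 'rV[R]_d -> R) (x y : 'rV[R]_d) (i j : 'I_d) (k l : int) (t h : R).

Definition upd x i t : 'rV[R]_d := \row_j (if j == i then t else x 0 j).

Lemma upd_id x i : upd x i (x 0 i) = x.
Proof. by apply/rowP => j; rewrite mxE; case: (j =P i) => // ->. Qed.

Lemma updD x i t h : upd x i (t + h) = upd x i t + h *: basis_vec i.
Proof.
apply/rowP => j; rewrite !mxE eqxx /=; case: (j =P i) => _; first by rewrite mulr1.
by rewrite mulr0 addr0.
Qed.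

Lemma upd_shift x i j h t : i != j ->
  upd (x + h *: basis_vec j) i t = upd x i t + h *: basis_vec j.
Proof.
move=> ij; apply/rowP => a; rewrite !mxE eqxx /=; case: (a =P i) => // ->.
by rewrite (negPf ij) mulr0 addr0.
Qed.

Lemma upd_shift_same x i h t : upd (x + h *: basis_vec i) i t = upd x i t.
Proof.
apply/rowP => a; rewrite !mxE eqxx /=; case: (a =P i) => // _.
by rewrite mulr0 addr0.
Qed.

(** A class stable under integration in one coordinate, the modulus of continuity being uniform on
    the whole space. *)
Definition regular f : Prop := [/\ exists M, forall x, `|f x| <= M,
  forall e, 0 < e -> exists2 delta, 0 < delta &
    forall x y, (forall j, `|x 0 j - y 0 j| < delta) -> `|f x - f y| <= e &
  forall j x, f (x + (2 * pi) *: basis_vec j) = f x].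

Lemma regular_line f x i : regular f -> continuous (fun t => f (upd x i t)).
Proof.
move=> [_ uf _] t; apply/cvgrPdist_le => e e0.
have [delta d0 dP] := uf e e0; near=> s.
apply: dP => j; rewrite !mxE; case: (j =P i) => _; last by rewrite subrr normr0.
near: s; exact: cvgr_dist_lt.
Unshelve. all: by end_near. Qed.

(** The coefficient is kept as a function on the whole space, constant in coordinate i, so that the
    operators for different coordinates compose. *)
Definition coef_op i k f : 'rV[R]_d -> R :=
  fun x => period_int (fun t => f (upd x i t) * casz k t).

Lemma continuous_coef_integrand f x i k : regular f ->
  continuous (fun t => f (upd x i t) * casz k t).
Proof.
by move=> rf; apply: continuous_mulR; [exact: regular_line|exact: continuous_casz].
Qed.

Lemma coef_opD i k f g : regular f -> regular g ->
  coef_op i k (fun x => f x + g x) = (fun x => coef_op i k f x + coef_op i k g x).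
Proof.
move=> rf rg; apply/funext => x; rewrite /coef_op -period_intD; try exact: continuous_coef_integrand.
by congr period_int; apply/funext => t; rewrite mulrDl.
Qed.

Lemma coef_opZ i k a f : regular f ->
  coef_op i k (fun x => a * f x) = (fun x => a * coef_op i k f x).
Proof.
move=> rf; apply/funext => x; rewrite /coef_op -period_intZ; last exact: continuous_coef_integrand.
by congr period_int; apply/funext => t; rewrite mulrA.
Qed.

Lemma norm_casz_le2 k t : `|casz k t| <= 2.
Proof. exact: norm_cas_le2. Qed.

Lemma coef_op_le i k f x M : regular f -> (forall t, `|f (upd x i t)| <= M) ->
  `|coef_op i k f x| <= 4 * pi * M.
Proof.
move=> rf fM; apply: le_trans (normr_period_int (M := M * 2) _ _) _.
- exact: continuous_coef_integrand.
- by move=> t; rewrite normrM ler_pM // norm_casz_le2.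
by rewrite le_eqVlt; apply/orP; left; apply/eqP; ring.
Qed.

Lemma coef_opB_le i k f x y M : regular f ->
  (forall t, `|f (upd x i t) - f (upd y i t)| <= M) ->
  `|coef_op i k f x - coef_op i k f y| <= 4 * pi * M.
Proof.
move=> rf fM; rewrite /coef_op -mulN1r -period_intZ; last exact: continuous_coef_integrand.
have c1 := @continuous_coef_integrand f x i k rf.
have c2 : continuous (fun t => -1 * (f (upd y i t) * casz k t)).
  by apply: continuous_mulR; [exact: cst_continuous|exact: continuous_coef_integrand].
rewrite -period_intD //.
apply: le_trans (normr_period_int (M := M * 2) (continuous_addR c1 c2) _) _.
  move=> t; have -> : f (upd x i t) * casz k t + -1 * (f (upd y i t) * casz k t) =
    (f (upd x i t) - f (upd y i t)) * casz k t by ring.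
  by rewrite normrM ler_pM // norm_casz_le2.
by rewrite le_eqVlt; apply/orP; left; apply/eqP; ring.
Qed.

Lemma regular_coef_op i k f : regular f -> regular (coef_op i k f).
Proof.
move=> rf; have [[M fM] uf pf] := rf; have p0 := pi_gt0 R; split.
- by exists (4 * pi * M) => x; apply: coef_op_le => // t; apply: fM.
- move=> e e0; have [|delta d0 dP] := uf (e / (4 * pi)); first by rewrite divr_gt0 // mulr_gt0.
  exists delta => // x y xy.
  have -> : e = 4 * pi * (e / (4 * pi)).
    by move: (pi : R) p0 => P p0; field; rewrite gt_eqF.
  apply: coef_opB_le => // t; apply: dP => j; rewrite !mxE.
  by case: (j =P i) => _; [rewrite subrr normr0|exact: xy].
move=> j x; rewrite /coef_op; congr period_int; apply/funext => t; congr (_ * _).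
by have [->|ij] := eqVneq i j; [rewrite upd_shift_same|rewrite upd_shift // pf].
Qed.

(** The remainder is uniform in x, so the relation passes through an integral in another coordinate
    by a mere bound on the integrand. *)
Definition unif_derive j f g : Prop := forall e, 0 < e -> exists2 delta, 0 < delta &
  forall x h, `|h| < delta -> `|f (x + h *: basis_vec j) - f x - h * g x| <= e * `|h|.

Lemma regular_shift f v : regular f -> regular (fun x => f (x + v)).
Proof.
move=> [[M fM] uf pf]; split; first by exists M.
  move=> e e0; have [delta d0 dP] := uf e e0; exists delta => // x y xy.
  by apply: dP => j; rewrite !mxE opprD addrACA subrr addr0.
by move=> j x; rewrite addrAC pf.
Qed.

Lemma regularZ f a : regular f -> regular (fun x => a * f x).
Proof.
move=> [[M fM] uf pf]; split.
- by exists (`|a| * M) => x; rewrite normrM ler_wpM2l.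
- move=> e e0; have a1 : 0 < `|a| + 1 by rewrite ltr_wpDl.
  have [|delta d0 dP] := uf (e / (`|a| + 1)); first exact: divr_gt0.
  exists delta => // x y xy; rewrite -mulrBr normrM.
  apply: (@le_trans _ _ ((`|a| + 1) * (e / (`|a| + 1)))).
    by apply: ler_pM; rewrite ?lerDl //; apply: dP.
  by rewrite mulrCA divff ?mulr1 // gt_eqF.
by move=> j x; rewrite pf.
Qed.

Lemma regularD f g : regular f -> regular g -> regular (fun x => f x + g x).
Proof.
move=> [[M fM] uf pf] [[N gN] ug pg]; split.
- by exists (M + N) => x; apply: le_trans (ler_normD _ _) _; apply: lerD.
- move=> e e0; have e2 : 0 < e / 2 by rewrite divr_gt0.
  have [d1 d10 d1P] := uf _ e2; have [d2 d20 d2P] := ug _ e2.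
  exists (Num.min d1 d2); first by rewrite lt_min d10.
  move=> x y xy; rewrite opprD addrACA; apply: le_trans (ler_normD _ _) _.
  rewrite [e]splitr; apply: lerD; [apply: d1P|apply: d2P] => j;
    by have := xy j; rewrite lt_min => /andP[].
by move=> j x; rewrite pf pg.
Qed.

Lemma regular_cst a : regular (fun=> a).
Proof.
split=> [||//]; first by exists `|a| .
by move=> e e0; exists 1 => // x y _; rewrite subrr normr0 ltW.
Qed.

Lemma regular_sum (I : Type) (s : seq I) (P : pred I) (F : I -> 'rV[R]_d -> R) :
  (forall a, P a -> regular (F a)) -> regular (fun x => \sum_(a <- s | P a) F a x).
Proof.
move=> rF; elim: s => [|a s IH].
  have -> : (fun x => \sum_(a <- [::] | P a) F a x) = (fun=> 0) by apply/funext => x; rewrite big_nil.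
  exact: regular_cst.
have -> : (fun x => \sum_(b <- a :: s | P b) F b x) =
    (fun x => if P a then F a x + \sum_(b <- s | P b) F b x else \sum_(b <- s | P b) F b x).
  by apply/funext => x; rewrite big_cons.
by case Pa: (P a) => //; apply: regularD => //; apply: rF.
Qed.

Lemma coef_op_sum (I : Type) (s : seq I) (P : pred I) (F : I -> 'rV[R]_d -> R) i k :
  (forall a, P a -> regular (F a)) ->
  coef_op i k (fun x => \sum_(a <- s | P a) F a x) =
  (fun x => \sum_(a <- s | P a) coef_op i k (F a) x).
Proof.
move=> rF; elim: s => [|a s IH].
  have -> : (fun x => \sum_(a <- [::] | P a) F a x) = (fun x => 0 * 0) by apply/funext => x; rewrite big_nil mul0r.
  rewrite (coef_opZ i k 0 (regular_cst 0)); apply/funext => x; by rewrite big_nil mul0r.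
have -> : (fun x => \sum_(b <- a :: s | P b) F b x) =
    (fun x => if P a then F a x + \sum_(b <- s | P b) F b x else \sum_(b <- s | P b) F b x).
  by apply/funext => x; rewrite big_cons.
case Pa: (P a); last first.
  by rewrite IH; apply/funext => x; rewrite big_cons Pa.
rewrite coef_opD ?IH; [|exact: rF|exact: regular_sum].
by apply/funext => x; rewrite big_cons Pa.
Qed.

Lemma unif_derive_coef_op i j k f g : i != j -> regular f -> regular g ->
  unif_derive j f g -> unif_derive j (coef_op i k f) (coef_op i k g).
Proof.
move=> ij rf rg fg e e0; have p0 := pi_gt0 R.
have [|delta d0 dP] := fg (e / (4 * pi)); first by rewrite divr_gt0 // mulr_gt0.
exists delta => // x h hd.
pose F y := f (y + h *: basis_vec j) + (-1 * f y + - h * g y).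
have rsf := regular_shift (h *: basis_vec j) rf.
have rF : regular F by apply: regularD => //; apply: regularD; apply: regularZ.
have -> : coef_op i k f (x + h *: basis_vec j) - coef_op i k f x - h * coef_op i k g x = coef_op i k F x.
  rewrite /F coef_opD //; last by apply: regularD; apply: regularZ.
  rewrite coef_opD; try exact: regularZ.
  rewrite !coef_opZ // mulN1r mulNr addrA; congr (_ - _ - _).
  by rewrite /coef_op; congr period_int; apply/funext => t; rewrite upd_shift.
have -> : e * `|h| = 4 * pi * (e / (4 * pi) * `|h|).
  by move: (pi : R) p0 => P p0; field; rewrite gt_eqF.
apply: coef_op_le => // t.
by have := dP (upd x i t) h hd; rewrite /F mulN1r mulNr addrA.
Qed.

Lemma unif_derive_line i f g x t : unif_derive i f g ->
  is_derive t (1 : R) (fun s => f (upd x i s)) (g (upd x i t)).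
Proof.
move=> fg.
have H : (fun h => h^-1 *: (((fun s => f (upd x i s)) \o shift t) (h *: (1 : R)) - f (upd x i t))) @ 0^' -->
    g (upd x i t).
  apply/cvgrPdist_le => e e0; have [delta d0 dP] := fg e e0.
  near=> h.
  have h0 : h != 0 by near: h; exact: nbhs_dnbhs_neq.
  have hd : `|h| < delta by near: h; exact: dnbhs0_lt.
  have := dP (upd x i t) h hd; rewrite -updD /=.
  rewrite -[h *: 1]/(h * 1) mulr1 (addrC h t) => E.
  rewrite distrC -[_ *: _]/(h^-1 * _) -(ler_pM2r (_ : 0 < `|h|)) ?normr_gt0 // -normrM.
  by rewrite mulrBl mulrAC mulVf // mul1r [g _ * h]mulrC.
by split; [apply/cvg_ex; exists (g (upd x i t))|exact: cvg_lim].
Unshelve. all: by end_near. Qed.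

Lemma coef_op_derive2 i k f f' f'' : regular f -> regular f' -> regular f'' ->
  unif_derive i f f' -> unif_derive i f' f'' ->
  coef_op i k f'' = (fun x => - k%:~R ^+ 2 * coef_op i k f x).
Proof.
move=> rf rf' rf'' ff' ff''; apply/funext => x; rewrite /coef_op.
have per g : regular g -> g (upd x i (2 * pi)) = g (upd x i 0).
  by move=> [_ _ pg]; rewrite -[2 * pi]add0r updD pg.
apply: (period_int_casz_derive2 (f' := fun t => f' (upd x i t))).
- by move=> t; apply: unif_derive_line.
- by move=> t; apply: unif_derive_line.
- exact: regular_line.
- exact: per.
- exact: per.
Qed.

Lemma coef_op_complete i f : regular f -> (forall k, coef_op i k f = (fun=> 0)) -> f = (fun=> 0).
Proof.
move=> rf f0; apply/funext => x; rewrite -(upd_id x i).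
have [[M fM] _ pf] := rf.
apply: (@cas_complete R (fun t => f (upd x i t))) => //.
- exact: regular_line.
- by move=> t; rewrite updD pf.
- by exists M.
by move=> k; have := congr1 (@^~ x) (f0 k).
Qed.
End TorusCoefficients.

(** * Uniform continuity and uniform differentiability of smooth periodic functions *)

Section SmoothPeriodic.
Local Open Scope classical_set_scope.
Variables (R : realType) (d : nat).
Implicit Types (f g : 'rV[R]_d -> R) (x y : 'rV[R]_d) (i j : 'I_d).

Definition real_periodic f : Prop :=
  forall i x, f (x + (2 * pi) *: basis_vec i) = f x.

Lemma real_periodic_int f : real_periodic f -> forall (z : int) i x,
  f (x + (z%:~R * (2 * pi)) *: basis_vec i) = f x.
Proof.
move=> pf z i x; have per y (n : nat) : f (y + (n%:R * (2 * pi)) *: basis_vec i) = f y.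
  elim: n => [|n IH]; first by rewrite mul0r scale0r addr0.
  by rewrite -natr1 mulrDl mul1r scalerDl addrA pf.
case: z => n; first exact: per.
by rewrite -[LHS](per _ n.+1) NegzE mulrNz mulNr scaleNr -pmulrn subrK.
Qed.

Lemma real_periodic_row f : real_periodic f -> forall (z : 'I_d -> int) x,
  f (x + \row_j ((z j)%:~R * (2 * pi))) = f x.
Proof.
move=> pf z x.
have -> : \row_j ((z j)%:~R * (2 * pi)) = \sum_j ((z j)%:~R * (2 * pi)) *: basis_vec j :> 'rV[R]_d.
  by rewrite [LHS]row_sum_delta; apply: eq_bigr => j _; rewrite mxE.
elim: (index_enum _) x => [|j s IH] x; first by rewrite big_nil addr0.
by rewrite big_cons addrA IH real_periodic_int.
Qed.

Lemma ball_row x y (e : R) : 0 < e -> (forall j, `|x 0 j - y 0 j| < e) -> ball x e y.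
Proof. by move=> e0 xy; split=> // i j; rewrite (ord1 i); exact: xy. Qed.

(** Compactness of a period cube. Of two close points only the first is translated into the cube, so
    the covering argument compares points of the cube with arbitrary neighbours. *)
Lemma regular_continuous f : continuous f -> real_periodic f -> regular f.
Proof.
move=> cf pf; pose K := [set x : 'rV[R]_d | forall i, `[0, 2 * pi] (x 0 i)].
have /compact_near_coveringP cK : compact K.
  exact (@rV_compact R d (fun=> `[0, 2 * pi]) (fun=> @segment_compact R 0 (2 * pi))).
have p0 : 0 < 2 * pi :> R by rewrite mulr_gt0 ?pi_gt0.
have redK x : exists v : 'rV[R]_d, K (x + v) /\ forall y, f (y + v) = f y.
  pose z j : int := - Num.floor (x 0 j / (2 * pi)).
  exists (\row_j ((z j)%:~R * (2 * pi))); split; last by move=> y; exact: real_periodic_row.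
  move=> j; rewrite /= in_itv /= !mxE /z mulrNz mulNr.
  have /andP[h1 h2] := floor_itv (x 0 j / (2 * pi)).
  rewrite intrD in h2; rewrite ler_pdivlMr // in h1; rewrite ltr_pdivrMr // mulrDl mul1r in h2.
  by apply/andP; split; [rewrite subr_ge0|rewrite lerBlDl ltW].
have nearf x (e : R) : 0 < e -> exists2 r, 0 < r & forall y, ball x r y -> `|f x - f y| < e.
  by move=> e0; have /cvgrPdist_lt/(_ e e0)/nbhs_ballP[r /= r0 rP] := cf x; exists r.
split=> //.
- have [M MP] : exists M : R, K `<=` (fun x => `|f x| <= M).
    suff H : \forall M \near +oo, K `<=` (fun x => `|f x| <= M) by exact: (filter_ex H).
    apply: (cK R (pinfty_nbhs R) (fun M x => `|f x| <= M)) => x _.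
    have [r r0 rP] := nearf x 1 ltr01.
    exists (ball x r, [set M | `|f x| + 1 <= M]); first split => /=.
    + exact: nbhsx_ballx.
    + by apply: nbhs_pinfty_ge; exact: num_real.
    move=> [y M] [/= xy xM]; apply: le_trans xM.
    have := rP y xy; rewrite distrC => /ltW; have := ler_normD (f y - f x) (f x).
    by rewrite subrK; lra.
  by exists M => x; have [v [/MP vK <-]] := redK x.
move=> e e0.
pose P (delta : R) x := forall y, (forall j, `|x 0 j - y 0 j| < delta) -> `|f x - f y| <= e.
have [delta [d0 dP]] : exists delta : R, 0 < delta /\ K `<=` P delta.
  suff H : \forall delta \near 0^'+, 0 < delta /\ K `<=` P delta by exact: (filter_ex H).
  apply: filterI; first exact: nbhs_right_gt.
  apply: (cK R (at_right (0 : R)) P) => x _.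
  have e2 : 0 < e / 2 by rewrite divr_gt0.
  have [r r0 rP] := nearf x (e / 2) e2.
  have r2 : 0 < r / 2 by rewrite divr_gt0.
  exists (ball x (r / 2), [set delta | delta < r / 2]); first split => /=.
  + exact: nbhsx_ballx.
  + exact: nbhs_right_lt.
  move=> [y delta] [/= xy dr] w yw.
  have yw' : ball y (r / 2) w by apply: ball_row => // j; apply: lt_trans (yw j) dr.
  have h1 : `|f x - f y| < e / 2 by apply: rP; apply: le_ball xy; lra.
  have h2 : `|f x - f w| < e / 2 by apply: rP; rewrite [r]splitr; exact: ball_triangle xy yw'.
  have := ler_normD (f y - f x) (f x - f w); rewrite addrA subrK (distrC (f y) (f x)).
  lra.
exists delta => // x y xy; have [v [vK fv]] := redK x.
rewrite -(fv x) -(fv y); apply: dP => // j.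
by have := xy j; rewrite !mxE opprD addrACA subrr addr0.
Qed.

Lemma real_periodic_partial f i : real_periodic f -> real_periodic (real_partial i f).
Proof.
move=> pf j x; rewrite /real_partial !derive_lineE.
suff -> : (fun h : R => f (h *: basis_vec i + (x + (2 * pi) *: basis_vec j))) =
  (fun h : R => f (h *: basis_vec i + x)) by [].
by apply/funext => h; rewrite addrA pf.
Qed.

(** By the mean value theorem the difference quotient is the partial derivative at a point within
    |h| of x, and uniform continuity of that derivative bounds the remainder. *)
Lemma unif_derive_partial f i : (forall x, derivable f x (basis_vec i)) ->
  regular (real_partial i f) -> unif_derive i f (real_partial i f).
Proof.
move=> df [_ uf' _] e e0; have [delta d0 dP] := uf' e e0.
exists delta => // x h hd.
pose phi s := f (s *: basis_vec i + x).
have Dphi (s : R) : is_derive s (1 : R) phi (real_partial i f (s *: basis_vec i + x)).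
  have E : (fun a => a^-1 *: ((phi \o shift s) (a *: (1 : R)) - phi s)) =
      (fun a => a^-1 *: ((f \o shift (s *: basis_vec i + x)) (a *: basis_vec i)
                         - f (s *: basis_vec i + x))).
    by apply/funext => a; rewrite /phi /= -[a *: 1]/(a * 1) mulr1 scalerDl addrA.
  by split; rewrite /derivable /derive E //; exact: df.
have cphi : continuous phi.
  by move=> t; apply/differentiable_continuous/derivable1_diffP; apply: ex_derive.
have key a b : a < b -> exists2 c, a < c < b & phi b - phi a = real_partial i f (c *: basis_vec i + x) * (b - a).
  move=> ab; have [c cab E] := MVT ab (fun s _ => Dphi s) (continuous_subspaceT cphi).
  by exists c => //; move: cab; rewrite in_itv.
have [c ch E] : exists2 c, `|c| <= `|h| & f (x + h *: basis_vec i) - f x = real_partial i f (x + c *: basis_vec i) * h.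
  have E0 : phi 0 = f x by rewrite /phi scale0r add0r.
  have Eh : phi h = f (x + h *: basis_vec i) by rewrite /phi addrC.
  have [h0|h0|h0] := ltgtP h 0.
  - have [c /andP[hc c0] E] := key h 0 h0; exists c.
      by rewrite !ltr0_norm // lerN2 ltW.
    rewrite -Eh -E0 -[LHS]opprB E (addrC x); ring.
  - have [c /andP[hc c0] E] := key 0 h h0; exists c.
      by rewrite !gtr0_norm // ltW.
    by rewrite -Eh -E0 E subr0 (addrC x).
  - by exists 0; rewrite ?normr0 // h0 mulr0 scale0r addr0 subrr.
rewrite E (mulrC h) -mulrBl normrM ler_wpM2r //; apply: dP => j.
rewrite !mxE eqxx /= addrAC subrr add0r.
apply: le_lt_trans hd; apply: le_trans ch.
by case: (j =P i) => _; rewrite ?mulr1 // mulr0 normr0.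
Qed.
End SmoothPeriodic.

(** * Fourier coefficients in several coordinates as iterated integrals *)

Section IteratedCoefficients.
Local Open Scope classical_set_scope.
Variables (R : realType) (d : nat).
Implicit Types (f g : 'rV[R]_d -> R) (x y : 'rV[R]_d) (i j : 'I_d) (kappa l : 'I_d -> int)
  (s : seq 'I_d).

Definition coefs s kappa f : 'rV[R]_d -> R :=
  foldr (fun i F => coef_op i (kappa i) F) f s.

Lemma regular_coefs s kappa f : regular f -> regular (coefs s kappa f).
Proof. by move=> rf; elim: s => //= i s IH; apply: regular_coef_op. Qed.

Lemma coefsD s kappa f g : regular f -> regular g ->
  coefs s kappa (fun x => f x + g x) = (fun x => coefs s kappa f x + coefs s kappa g x).
Proof.
by move=> rf rg; elim: s => //= i s ->; rewrite coef_opD //; apply: regular_coefs.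
Qed.

Lemma coefsZ s kappa a f : regular f ->
  coefs s kappa (fun x => a * f x) = (fun x => a * coefs s kappa f x).
Proof.
by move=> rf; elim: s => //= i s ->; rewrite coef_opZ //; apply: regular_coefs.
Qed.

Lemma coefs_sum (I : Type) (r : seq I) (P : pred I) (F : I -> 'rV[R]_d -> R) s kappa :
  (forall a, P a -> regular (F a)) ->
  coefs s kappa (fun x => \sum_(a <- r | P a) F a x) =
  (fun x => \sum_(a <- r | P a) coefs s kappa (F a) x).
Proof.
move=> rF; elim: s => //= i s ->.
by rewrite coef_op_sum // => a Pa; apply: regular_coefs; apply: rF.
Qed.

Lemma unif_derive_coefs s kappa j f g : j \notin s -> regular f -> regular g ->
  unif_derive j f g -> unif_derive j (coefs s kappa f) (coefs s kappa g).
Proof.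
move=> js rf rg fg; elim: s js => //= i s IH; rewrite inE negb_or => /andP[ji js].
by apply: unif_derive_coef_op; rewrite 1?eq_sym //; [apply: regular_coefs|apply: regular_coefs|apply: IH].
Qed.

(** The integrals inside that of coordinate j commute with the derivative along j, the one in
    coordinate j is done by parts, and the outer ones are linear. *)
Lemma coefs_derive2 s kappa j f f' f'' : uniq s -> j \in s ->
  regular f -> regular f' -> regular f'' -> unif_derive j f f' -> unif_derive j f' f'' ->
  coefs s kappa f'' = (fun x => - (kappa j)%:~R ^+ 2 * coefs s kappa f x).
Proof.
move=> us js rf rf' rf'' ff' ff''; elim: s us js => //= i s IH /andP[is_ us].
rewrite inE; have [ji _|ji /= js] := eqVneq j i; last first.
  by rewrite IH // coef_opZ //; apply: regular_coefs.
subst j; apply: (@coef_op_derive2 R d i (kappa i) _ (coefs s kappa f'));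
  by [apply: regular_coefs|apply: unif_derive_coefs].
Qed.

Lemma eq_coefs s kappa l f : {in s, kappa =1 l} -> coefs s kappa f = coefs s l f.
Proof.
elim: s => [//|i s IH] e /=; have -> : kappa i = l i by apply: e; exact: mem_head.
by rewrite IH // => j js; apply: e; rewrite inE js orbT.
Qed.

Lemma coefs_complete s f : uniq s -> regular f ->
  (forall kappa, coefs s kappa f = (fun=> 0)) -> f = (fun=> 0).
Proof.
move=> us rf; elim: s us => [_ /(_ (fun=> 0))//|i s IH /= /andP[is_ us] f0].
apply: IH => // kappa; apply: (@coef_op_complete _ _ i); first exact: regular_coefs.
move=> k; have := f0 (fun j => if j == i then k else kappa j); rewrite eqxx.
rewrite (eq_coefs (l := kappa)) // => j js; case: eqP => // ji.
by move: is_; rewrite -ji js.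
Qed.

Lemma coefs_indep s kappa f x y : (forall j, j \notin s -> x 0 j = y 0 j) ->
  coefs s kappa f x = coefs s kappa f y.
Proof.
elim: s x y => [|i s IH] x y xy /=.
  by congr f; apply/rowP => j; apply: xy.
congr period_int; apply/funext => t; congr (_ * _); apply: IH => j js.
by rewrite !mxE; case: (j =P i) => // /eqP ji; apply: xy; rewrite inE negb_or ji.
Qed.

Definition zwave l : 'rV[R]_d -> R := fun x => \prod_j casz (l j) (x 0 j).

Lemma regular_zwave l : regular (zwave l).
Proof.
apply: regular_continuous.
  apply: continuous_prodr => j _ x.
  apply: (@continuous_comp _ _ _ (fun x : 'rV[R]_d => x 0 j) (casz (l j))).
    exact: coord_continuous.
  exact: continuous_casz.
move=> i x; apply: eq_bigr => j _; rewrite !mxE eqxx /=.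
case: (j =P i) => _; last by rewrite mulr0 addr0.
by rewrite mulr1 /casz mulrDr cas_periodic.
Qed.

Lemma coefs_zwave s kappa l : uniq s ->
  coefs s kappa (zwave l) = (fun x => (\prod_(j <- s) (if kappa j == l j then 2 * pi else 0)) *
    \prod_(j | j \notin s) casz (l j) (x 0 j)).
Proof.
elim: s => [_|i s IH /= /andP[is_ us]].
  by apply/funext => x; rewrite /= big_nil mul1r.
rewrite IH //; apply/funext => x; rewrite /coef_op big_cons.
set c := \prod_(j <- s) _.
pose P := \prod_(j | j \notin i :: s) casz (l j) (x 0 j).
have -> : (fun t => c * (\prod_(j | j \notin s) casz (l j) (upd x i t 0 j)) * casz (kappa i) t) =
  (fun t => c * P * (casz (kappa i) t * casz (l i) t)).
  apply/funext => t; rewrite (bigD1 i) //= mxE eqxx.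
  have -> : \prod_(j | (j \notin s) && (j != i)) casz (l j) (upd x i t 0 j) = P.
    rewrite /P; apply: eq_big => j; first by rewrite inE negb_or andbC.
    by move=> /andP[_ /negPf ji]; rewrite mxE ji.
  by ring.
rewrite period_intZ; last by apply: continuous_mulR; exact: continuous_casz.
by rewrite period_int_casz -/P; case: (_ == _); ring.
Qed.

End IteratedCoefficients.

(** * Eigenfunctions are finite wave sums *)

Section Eigenfunctions.
Local Open Scope classical_set_scope.
Variables (R : realType) (d L n : nat).
Hypothesis nL : (n < L.+1 ^ 2)%N.

Lemma zwaveE (k : {ffun 'I_d -> 'I_(L.*2.+1)}) :
  wave (freq R k) (fun=> 0%N) = zwave (fun j => zcoord (k j)).
Proof.
apply/funext => x; apply: eq_bigr => j _.
by rewrite /casz /freq mul0r addr0.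
Qed.

(** Computing the coefficient of the Laplacian in two ways shows that it vanishes off the sphere.
    Subtracting the finite sum with the remaining coefficients leaves a function all of whose
    coefficients are 0. *)
Lemma eigenfunction_wave_sum (f : 'rV[R]_d -> R) (f1 f2 : 'I_d -> 'rV[R]_d -> R) :
  regular f -> (forall j, regular (f1 j)) -> (forall j, regular (f2 j)) ->
  (forall j, unif_derive j f (f1 j)) -> (forall j, unif_derive j (f1 j) (f2 j)) ->
  (forall x, \sum_j f2 j x = - n%:R * f x) ->
  exists b, f = wave_sum (lattice_sphere d L n) b (fun=> 0%N).
Proof.
move=> rf rf1 rf2 ff1 f12 eig.
set E := lattice_sphere d L n; set s := enum 'I_d.
have us : uniq s := enum_uniq _.
have ms j : j \in s by rewrite mem_enum.
have p0 : 2 * pi != 0 :> R by rewrite mulf_neq0 // gt_eqF // pi_gt0.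
have coef0 kappa : (\sum_j absz (kappa j) ^ 2 != n)%N -> coefs s kappa f = (fun=> 0).
  move=> kn; apply/funext => x.
  have E1 : coefs s kappa (fun x => \sum_j f2 j x) x = - n%:R * coefs s kappa f x.
    by rewrite (_ : (fun x => _) = (fun x => - n%:R * f x)) ?coefsZ //; apply/funext.
  rewrite coefs_sum // in E1.
  have E2 : \sum_j coefs s kappa (f2 j) x = - (\sum_j absz (kappa j) ^ 2)%:R * coefs s kappa f x.
    rewrite natr_sum -sumrN mulr_suml; apply: eq_bigr => j _.
    rewrite (coefs_derive2 kappa us (ms j) rf (rf1 j) (rf2 j) (ff1 j) (f12 j)).
    by rewrite -rmorphXn /= -sqr_absz.
  apply/eqP; rewrite E1 in E2; move/eqP: E2; rewrite -subr_eq0 -mulrBl mulf_eq0 => /orP[|//].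
  by rewrite opprK addrC subr_eq0 eqr_nat (negPf kn).
(* Each cas has square integral 2 pi over a period, whence the normalisation. *)
pose b (k : {ffun 'I_d -> 'I_(L.*2.+1)}) := coefs s (fun j => zcoord (k j)) f 0 / (2 * pi) ^+ d.
exists b; set g := wave_sum E b _.
have rg : regular g.
  apply: regular_sum => k _; apply: regularZ; rewrite zwaveE; exact: regular_zwave.
have rh : regular (fun x => f x + -1 * g x) by apply: regularD => //; apply: regularZ.
suff : (fun x => f x + -1 * g x) = (fun=> 0).
  move=> H; apply/funext => x; have := congr1 (@^~ x) H; rewrite /= mulN1r.
  by move/eqP; rewrite subr_eq0 => /eqP.
apply: (coefs_complete us rh) => kappa.
rewrite coefsD ?coefsZ //; last exact: regularZ.
apply/funext => x.
have wE (k : {ffun 'I_d -> 'I_(L.*2.+1)}) : coefs s kappa (wave (freq R k) (fun=> 0%N)) x =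
    if [forall j, kappa j == zcoord (k j)] then (2 * pi) ^+ d else 0.
  rewrite zwaveE coefs_zwave // [X in _ * X]big1 ?mulr1; last by move=> j; rewrite ms.
  rewrite /s big_enum /=; case: ifP => [/forallP kk|/negbT].
    rewrite (eq_bigr (fun=> 2 * pi)) => [|j _]; last by rewrite kk.
    by rewrite prodr_const card_ord.
  by rewrite negb_forall => /existsP[j /negPf kj]; rewrite (bigD1 j) //= kj mul0r.
have gE : coefs s kappa g x = \sum_(k in E) b k * (if [forall j, kappa j == zcoord (k j)] then (2 * pi) ^+ d else 0).
  rewrite /g /wave_sum coefs_sum; last first.
    by move=> k _; apply: regularZ; rewrite zwaveE; exact: regular_zwave.
  by apply: eq_bigr => k _; rewrite coefsZ ?wE //; rewrite zwaveE; exact: regular_zwave.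
have [kn|kn] := eqVneq (\sum_j absz (kappa j) ^ 2)%N n; last first.
  rewrite coef0 // gE big1 ?mulr0 ?addr0 // => k; rewrite inE => kE.
  case: ifP => [/forallP kk|_]; last by rewrite mulr0.
  case/negP: kn; rewrite -(eqP kE); apply/eqP/eq_bigr => j _.
  by rewrite (eqP (kk j)).
pose k0 : {ffun 'I_d -> 'I_(L.*2.+1)} := [ffun j => zord L (kappa j)].
(* Here n < (L + 1)^2 ensures that no frequency on the sphere falls outside the box. *)
have kL j : (absz (kappa j) <= L)%N.
  rewrite -ltnS -ltn_sqr; apply: leq_ltn_trans nL.
  by rewrite -kn (bigD1 j) //= leq_addr.
have zk0 j : zcoord (k0 j) = kappa j by rewrite ffunE zordK.
have k0E : k0 \in E by rewrite inE -kn; apply/eqP/eq_bigr => j _; rewrite zk0.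
rewrite gE (bigD1 k0) //= big1; last first.
  move=> k /andP[_ kk0]; case: ifP => [/forallP kk|_]; last by rewrite mulr0.
  case/negP: kk0; apply/eqP/ffunP => j; apply: (can_inj (@zcoordK L)).
  by rewrite zk0 (eqP (kk j)).
case: ifP => [_|/negP[]]; last by apply/forallP => j; rewrite zk0.
rewrite addr0 /b divfK ?expf_neq0 // mulN1r.
have -> : coefs s (fun j => zcoord (k0 j)) f 0 = coefs s kappa f x.
  rewrite (eq_coefs (l := kappa)) => [|j _]; last exact: zk0.
  by apply: coefs_indep => j; rewrite ms.
by rewrite subrr.
Qed.
End Eigenfunctions.

(** * Vanishing orders *)

Section ComplexFunctions.
Local Open Scope complex_scope.
Local Open Scope classical_set_scope.
Variables (R : realType) (d : nat).
Implicit Types (u : 'rV[R]_d -> R[i]) (f : 'rV[R]_d -> R) (s : seq 'I_d).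

Definition repart u : 'rV[R]_d -> R := fun x => complex.Re (u x).
Definition impart u : 'rV[R]_d -> R := fun x => complex.Im (u x).

Lemma foldr_partial u s :
  repart (foldr partial u s) = foldr (@real_partial R d) (repart u) s /\
  impart (foldr partial u s) = foldr (@real_partial R d) (impart u) s.
Proof. by elim: s => //= j s [<- <-]. Qed.

Lemma multi_partialE u alpha :
  repart (multi_partial alpha u) = multi_real_partial alpha (repart u) /\
  impart (multi_partial alpha u) = multi_real_partial alpha (impart u).
Proof.
have iterE j n v : repart (iter n (partial j) v) = iter n (real_partial j) (repart v) /\
    impart (iter n (partial j) v) = iter n (real_partial j) (impart v).
  by elim: n => //= n [<- <-].
rewrite /multi_partial /multi_real_partial; elim: (enum _) => //= j s [<- <-].
exact: iterE.
Qed.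

Lemma smooth_parts u : smooth u -> real_smooth (repart u) /\ real_smooth (impart u).
Proof.
move=> su; split=> s; have [E1 E2] := foldr_partial u s; have [[c1 c2] D] := su s.
  rewrite -E1.
  split; first exact: c1.
  by move=> j x; exact: (D j x).1.
rewrite -E2.
split; first exact: c2.
by move=> j x; exact: (D j x).2.
Qed.

Lemma sum_ReIm (I : finType) (F : I -> R[i]) :
  complex.Re (\sum_j F j) = \sum_j complex.Re (F j) /\
  complex.Im (\sum_j F j) = \sum_j complex.Im (F j).
Proof. by split; apply: raddf_sum. Qed.

Definition real_eigenfunction (a : R) f : Prop := [/\ real_periodic f, real_smooth f &
  forall x, \sum_j real_partial j (real_partial j f) x = - a * f x].

Lemma torus_eigenspace_parts (lambda : R) u : torus_eigenspace lambda u ->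
  real_eigenfunction (lambda ^+ 2) (repart u) /\ real_eigenfunction (lambda ^+ 2) (impart u).
Proof.
move=> [pu su eu]; have [s1 s2] := smooth_parts su.
have lap x : \sum_j real_partial j (real_partial j (repart u)) x = - (lambda ^+ 2) * repart u x /\
    \sum_j real_partial j (real_partial j (impart u)) x = - (lambda ^+ 2) * impart u x.
  have [E1 E2] := sum_ReIm (fun j => partial j (partial j u) x).
  have H1 j : complex.Re (partial j (partial j u) x) =
    real_partial j (real_partial j (repart u)) x := congr1 (@^~ x) (foldr_partial u [:: j; j]).1.
  have H2 j : complex.Im (partial j (partial j u) x) =
    real_partial j (real_partial j (impart u)) x := congr1 (@^~ x) (foldr_partial u [:: j; j]).2.
  rewrite (eq_bigr _ (fun j _ => H1 j)) in E1; rewrite (eq_bigr _ (fun j _ => H2 j)) in E2.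
  have := eu x; rewrite /laplacian; set S := \sum_j _ in E1 E2 *.
  move=> eS; have {eS} : S = - ((lambda ^+ 2)%:C * u x) by rewrite -eS opprK.
  move=> eS.
  have [P1 P2] : complex.Re S = - (lambda ^+ 2) * repart u x /\
      complex.Im S = - (lambda ^+ 2) * impart u x.
    rewrite eS /repart /impart; case: (u x) => a b /=.
    by rewrite !mul0r subr0 addr0 !mulNr.
  split; first exact: etrans (esym E1) P1.
  exact: etrans (esym E2) P2.
split; split=> //.
- by move=> j x; rewrite /repart pu.
- by move=> x; have [] := lap x.
- by move=> j x; rewrite /impart pu.
- by move=> x; have [] := lap x.
Qed.

Definition of_real f : 'rV[R]_d -> R[i] := fun x => (f x)%:C.

Lemma partial_of_real f j : partial j (of_real f) = of_real (real_partial j f).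
Proof.
apply/funext => x; rewrite /partial /of_real /=; congr (_ +i* _).
exact: derive_cst.
Qed.

Lemma foldr_partial_of_real f s :
  foldr partial (of_real f) s = of_real (foldr (@real_partial R d) f s).
Proof. by elim: s => //= j s ->; rewrite partial_of_real. Qed.

Lemma multi_partial_of_real f alpha :
  multi_partial alpha (of_real f) = of_real (multi_real_partial alpha f).
Proof.
have iterE j n g : iter n (partial j) (of_real g) = of_real (iter n (real_partial j) g).
  by elim: n => //= n ->; rewrite partial_of_real.
by rewrite /multi_partial /multi_real_partial; elim: (enum _) => //= j s ->; rewrite iterE.
Qed.

Lemma torus_eigenspace_of_real (lambda : R) f :
  real_eigenfunction (lambda ^+ 2) f -> torus_eigenspace lambda (of_real f).
Proof.
move=> [pf sf ef]; split.
- by move=> j x; rewrite /of_real pf.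
- move=> s; rewrite foldr_partial_of_real; have [c D] := sf s; split.
    by split=> //; exact: cst_continuous.
  by move=> j x; split; [exact: D|exact: derivable_cst].
move=> x; rewrite /laplacian.
under eq_bigr do rewrite !partial_of_real /of_real.
by rewrite -rmorph_sum /= ef mulNr rmorphN opprK rmorphM.
Qed.
End ComplexFunctions.

Lemma real_eigenfunction_wave_sum (R : realType) (d L n : nat) (f : 'rV[R]_d -> R) :
  (n < L.+1 ^ 2)%N -> real_eigenfunction n%:R f ->
  exists b, f = wave_sum (lattice_sphere d L n) b (fun=> 0%N).
Proof.
move=> nL [pf sf ef].
have pf1 j := real_periodic_partial j pf.
have pf2 j := real_periodic_partial j (pf1 j).
have r0 : regular f by apply: regular_continuous => //; exact: (sf [::]).1.
have r1 j : regular (real_partial j f).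
  by apply: regular_continuous => //; exact: (sf [:: j]).1.
have r2 j : regular (real_partial j (real_partial j f)).
  by apply: regular_continuous => //; exact: (sf [:: j; j]).1.
apply: (eigenfunction_wave_sum nL r0 r1 r2) => // j.
  by apply: unif_derive_partial => //; exact: (sf [::]).2.
by apply: unif_derive_partial => // x; exact: (sf [:: j]).2.
Qed.

Lemma wave_sum_eigenfunction (R : realType) (d L n : nat) c :
  real_eigenfunction n%:R (wave_sum (R := R) (lattice_sphere d L n) c (fun=> 0%N)).
Proof.
split.
- by move=> i x; exact: wave_sum_periodic.
- exact: real_smooth_wave_sum.
- exact: sum_real_partial2_wave_sum.
Qed.

Lemma eigenfunction_vanishing_eq0 (R : realType) (e L n N : nat) (f : 'rV[R]_e.+2 -> R) :
  (n < L.+1 ^ 2)%N ->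
  (forall r, (r <= n)%N -> (2 * e * L + size (two_squares_abscissae L r) <= N)%N) ->
  real_eigenfunction n%:R f ->
  (forall alpha, (\sum_j alpha j <= N)%N -> multi_real_partial alpha f 0 = 0) ->
  f = (fun=> 0).
Proof.
move=> nL NP ef vf; have [b fb] := real_eigenfunction_wave_sum nL ef.
have b0 := @moments_eq0_le R e L n N b NP _.
rewrite fb; apply/funext => x; apply: big1 => k kE; rewrite b0 ?mul0r //.
by move=> alpha aN; apply/eqP; rewrite -multi_real_partial_wave_sum0 -fb vf.
Qed.

Lemma max_vanishing_order_ge (R : realType) (d L n N : nat) (lambda : R)
    (c : {ffun 'I_d -> 'I_(L.*2.+1)} -> R) :
  lambda ^+ 2 = n%:R ->
  (exists2 k, k \in lattice_sphere d L n & c k != 0) ->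
  (forall alpha, (\sum_j alpha j <= N)%N -> moment (lattice_sphere d L n) c alpha = 0) ->
  ((N%:R : R)%:E <= max_vanishing_order d lambda)%E.
Proof.
move=> ln [k kE ck] mc; set E := lattice_sphere d L n in kE mc.
pose f := wave_sum (R := R) E c (fun=> 0%N).
have vf alpha : (\sum_j alpha j <= N)%N -> multi_real_partial alpha f 0 = 0.
  by move=> aN; apply/eqP; rewrite multi_real_partial_wave_sum0 mc.
have f00 : f 0 = 0.
  (* The value at the origin is the derivative of order 0; it selects the branch of
     [vanishing_order]. *)
  have -> : f = multi_real_partial (fun=> 0%N) f; last by apply: vf; rewrite big1.
  by rewrite /multi_real_partial; elim: (enum _) => //= j s <-.
apply: (@le_trans _ _ (vanishing_order (of_real f))).
  rewrite /vanishing_order /of_real f00 eqxx; apply: ereal_sup_ubound; exists N => //.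
  by move=> alpha aN; rewrite multi_partial_of_real /of_real vf.
apply: ereal_sup_ubound; exists (of_real f) => //; split.
  by apply: torus_eigenspace_of_real; rewrite ln; exact: wave_sum_eigenfunction.
move=> F0; have f0 x : f x = 0 by have := congr1 (@^~ x) F0; case.
(* If f were zero it would also be the wave sum with zero coefficients, so all moments of c would
   vanish, and then c itself on the sphere. *)
have fz : f = wave_sum E (fun=> 0) (fun=> 0%N).
  by apply/funext => x; rewrite f0; symmetry; apply: big1 => l _; rewrite mul0r.
case/negP: ck; apply/eqP; apply: (@moments_eq0 R d L E) kE => alpha.
apply/eqP; rewrite -multi_real_partial_wave_sum0 -/f fz multi_real_partial_wave_sum0.
by apply/eqP; apply: big1 => l _; rewrite mul0r.
Qed.

Lemma max_vanishing_order_le (R : realType) (d : nat) (lambda : R) :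
  (2 <= d)%N -> 3 <= lambda -> lambda ^+ 2 \is a Num.nat ->
  (max_vanishing_order d lambda <=
    (2 * (d%:R - 2) * lambda + expR (74 * ln lambda / ln (ln lambda)))%:E)%E.
Proof.
case: d => [|[|e]] // _ l3 /natrP[n ln2]; set B := _ + expR _.
have l0 : 0 <= lambda by lra.
have B0 : 0 <= B.
  by rewrite addr_ge0 ?expR_ge0 // !mulr_ge0 // -natr1 -natr1; have := ler0n R e; lra.
(* With L the integer part of lambda the box contains the sphere, and the degree 2(d-2)L of the
   separating factors is at most 2(d-2) lambda. *)
pose L := Num.truncn lambda.
have /andP[L1 L2] := truncn_itv l0; rewrite -/L in L1 L2.
have nL : (n < L.+1 ^ 2)%N by rewrite -(ltr_nat R) natrX -ln2 ltrXn2r ?nnegrE.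
apply: ge_ereal_sup => _ [u [eu u0] <-]; rewrite /vanishing_order.
case: ifP => _; last by rewrite lee_fin; lra.
apply: ge_ereal_sup => _ [N vN <-]; rewrite lee_fin leNgt; apply/negP => BN.
have NP r : (r <= n)%N -> (2 * e * L + size (two_squares_abscissae L r) <= N)%N.
  move=> rn; rewrite -(ler_nat R) natrD; apply: le_trans (ltW BN); apply: lerD.
    rewrite natrM natrM ler_pM ?mulr_ge0 // ler_pM2l // -natr1 -natr1; lra.
  exact: two_squares_abscissae_bound l3 ln2 rn.
have [e1 e2] := torus_eigenspace_parts eu; rewrite ln2 in e1 e2.
have z1 : repart u = (fun=> 0).
  apply: (eigenfunction_vanishing_eq0 nL NP e1) => alpha aN.
  by rewrite -(multi_partialE u alpha).1 /repart vN.
have z2 : impart u = (fun=> 0).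
  apply: (eigenfunction_vanishing_eq0 nL NP e2) => alpha aN.
  by rewrite -(multi_partialE u alpha).2 /impart vN.
apply: u0; apply/funext => x; have := congr1 (@^~ x) z1; have := congr1 (@^~ x) z2.
by rewrite /repart /impart; case: (u x) => a b /= -> ->.
Qed.

Lemma max_vanishing_order_ge_power (R : realType) (d : nat) : (5 <= d)%N ->
  exists c : R, 0 < c /\ forall lambda : R, 3 <= lambda -> lambda ^+ 2 \is a Num.nat ->
    ((c * lambda `^ ((d%:R - 2) / (d%:R - 1)))%:E <= max_vanishing_order d lambda)%E.
Proof.
case: d => // d d5; have d1 : (0 < d)%N by lia.
have [c0 [c0_gt0 c0_le1 cardP]] : exists c0 : R, [/\ 0 < c0, c0 <= 1 &
    forall n, (0 < n)%N -> Num.sqrt n%:R ^+ (d.+1 - 2) * c0 <= #|lattice_sphere d.+1 n n|%:R].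
  have D1 : 1 <= 16 * 2 ^+ (d.+1 ^ 2) :> R by rewrite mulr_ege1 ?exprn_ege1 ?ler1n.
  have D0 := lt_le_trans ltr01 D1.
  exists (16 * 2 ^+ (d.+1 ^ 2))^-1; split; first by rewrite invr_gt0.
    by rewrite invf_le1.
  by move=> n n0; apply: card_lattice_sphere_ge.
(* The quarter gives 2 (c1 Y)^d <= 2 c1 Y^d < c0 Y^d, where the last quantity bounds the number of
   lattice points from below. The dimension is now d + 1. *)
pose c1 := c0 / 4; have c1_gt0 : 0 < c1 by rewrite divr_gt0.
have c1_le1 : c1 <= 1 by rewrite /c1; lra.
exists (c1 / 4); split; first by rewrite divr_gt0.
move=> lambda l3 /natrP[n ln2].
have l0 : 0 <= lambda by lra.
have lE : Num.sqrt n%:R = lambda by rewrite -ln2 sqrtr_sqr ger0_norm.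
have n9 : (9 <= n)%N by rewrite -(ler_nat R) -ln2; nra.
have n0 : (0 < n)%N by lia.
have cardE := cardP n n0; rewrite lE in cardE.
set Y := lambda `^ _.
have Y0 : 0 <= Y by exact: powR_ge0.
have dR : (d.+1%:R - 2 : R) = (d.+1 - 2)%N%:R by rewrite natrB //; lia.
have YD : Y ^+ d = lambda ^+ (d.+1 - 2).
  rewrite -powR_mulrn // -powRrM -[in RHS]powR_mulrn // dR; congr (_ `^ _).
  by rewrite -natr1 addrK divfK // pnatr_eq0; lia.
(* If c1 Y < 2, the claimed bound is below 1/2 and order 1 suffices; n >= 9 supplies the points.
   Otherwise N + 1 is the integer part of c1 Y, so N >= 1 and c1 Y < N + 2 <= 4 N. *)
have [small|large] := ltP (c1 * Y) 2.
  have E2 : (2 < #|lattice_sphere d.+1 n n|)%N.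
    by apply: leq_trans (card_lattice_sphere_ge_pred d5 n0 (leqnn n)); lia.
  have [c ck cm] := exists_moments_eq0_1 R E2.
  apply: le_trans (max_vanishing_order_ge ln2 ck cm); rewrite lee_fin.
  by rewrite mulrAC; lra.
pose M := Num.truncn (c1 * Y).
have cY0 : 0 <= c1 * Y by rewrite mulr_ge0 // ltW.
have /andP[M1 M2] := truncn_itv cY0; rewrite -/M in M1 M2.
have M_ge2 : (2 <= M)%N by rewrite truncn_ge_nat.
have [N EN] : exists N, M = N.+1 by exists M.-1; rewrite prednK // ltnW.
have cardN : (2 * N.+1 ^ d < #|lattice_sphere d.+1 n n|)%N.
  rewrite -(ltr_nat R); apply: lt_le_trans cardE; rewrite -EN natrM natrX -YD.
  have h1 : M%:R ^+ d <= c1 * Y ^+ d.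
    apply: (@le_trans _ _ ((c1 * Y) ^+ d)); first by rewrite lerXn2r ?nnegrE.
    by rewrite exprMn ler_wpM2r ?exprn_ge0 // -[leRHS]expr1 ler_wiXn2l ?(ltW c1_gt0).
  have h2 : 0 < M%:R ^+ d :> R by rewrite exprn_gt0 // ltr0n ltnW.
  have h3 : 0 < Y ^+ d by move: h1 h2; rewrite /c1; nra.
  move: h1; rewrite /c1; nra.
have [c ck cm] := exists_moments_eq0 R cardN.
apply: le_trans (max_vanishing_order_ge ln2 ck cm); rewrite lee_fin mulrAC.
have : M%:R = N%:R + 1 :> R by rewrite EN -natr1.
have : 1 <= N%:R :> R by rewrite ler1n -ltnS -EN.
by rewrite -natr1 in M2; lra.
Qed.

Theorem theorem2p1 (R : realType) :
  exists C : R, 0 < C /\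
    forall d : nat, (5 <= d)%N ->
      exists c : R, 0 < c /\
        forall lambda : R, 3 <= lambda -> lambda ^+ 2 \is a Num.nat ->
          ((c * lambda `^ ((d%:R - 2) / (d%:R - 1)))%:E
             <= max_vanishing_order d lambda)%E /\
          (max_vanishing_order d lambda
             <= (2 * (d%:R - 2) * lambda
                 + expR (C * ln lambda / ln (ln lambda)))%:E)%E.
Proof.
exists 74; split=> // d d5; have [c [c0 cP]] := max_vanishing_order_ge_power R d5.
exists c; split=> // lambda l3 ln; split; first exact: cP.
by apply: max_vanishing_order_le => //; apply: leq_trans d5.
Qed.
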